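(* Assume $\xi_1,\dots,\xi_n$ are i.i.d. $N(0,\sigma^2)$ and let $f(\mathbf M)=\sum_{i=1}^n|Y_i-\langle\mathbf M,\mathbf X_i\rangle|$. There exist absolute constants $C_1,C_2,C_4>0$ and $c_0,c_1,c_2,c_3\in(0,1)$ such that the following holds. Put $\tau_{\rm comp}=\sigma$, $\tau_{\rm stat}=C_2\sigma(rd_1/n)^{1/2}$, $\mu_{\rm comp}=n/12$, $\mu_{\rm stat}=n/(12\sigma)$, $L_{\rm comp}=2n$, $L_{\rm stat}=C_4n\sigma^{-1}$. If $n\ge C_1rd_1$, the initialization $\mathbf M_0\in\mathbb M_r$ satisfies $\|\mathbf M_0-\mathbf M^*\|_{\rm F}\le c_0\sigma_r$, and the stepsizes follow the two-phase schedule (see context), then with probability at least $1-\exp(-c_1rd_1)$ the RsGrad iterates have the following dynamics: (1) during phase one, when $\|\mathbf M_{l-1}-\mathbf M^*\|_{\rm F}\ge\sigma$, one has $\|\mathbf M_l-\mathbf M^*\|_{\rm F}\le(1-c_2)^l\|\mathbf M_0-\mathbf M^*\|_{\rm F}$; after $l_1=\Theta(\log(\sigma_r/\sigma))$ iterations in phase one, $\|\mathbf M_{l_1}-\mathbf M^*\|_{\rm F}\le\sigma$; (2) during phase two, when $\tau_{\rm stat}\le\|\mathbf M_{l_1+l}-\mathbf M^*\|_{\rm F}\le\sigma$, one has $\|\mathbf M_{l_1+l+1}-\mathbf M^*\|_{\rm F}\le(1-c_3)\|\mathbf M_{l_1+l}-\mathbf M^*\|_{\rm F}$; after $l_2=\Theta(\log(n/(d_1r)))$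 iterations in phase two, $\|\mathbf M_{l_1+l_2}-\mathbf M^*\|_{\rm F}\le C_2\sigma(rd_1/n)^{1/2}$.
   Context: Model: $d_1\ge d_2$; $\mathbf M^*\in\mathbb R^{d_1\times d_2}$ has rank $r$ with smallest nonzero singular value $\sigma_r$; $(\mathbf X_i,Y_i)_{i=1}^n$ are i.i.d. with $Y_i=\langle\mathbf X_i,\mathbf M^*\rangle+\xi_i$, $\langle\mathbf A,\mathbf B\rangle={\rm tr}(\mathbf A^\top\mathbf B)$, where $\mathbf X_i$ has i.i.d. $N(0,1)$ entries and is independent of the noise. $\mathbb M_r$ is the set of $d_1\times d_2$ matrices of rank at most $r$; $\|\cdot\|_{\rm F}$ is the Frobenius norm; ${\rm SVD}_r$ is the best rank-$r$ approximation. $\partial f$ is the sub-differential of the convex function $f$. RsGrad: starting from $\mathbf M_0\in\mathbb M_r$, for $l=0,1,\dots$ choose any $\mathbf G_l\in\partial f(\mathbf M_l)$ and set $\mathbf M_{l+1}={\rm SVD}_r(\mathbf M_l-\eta_l\mathcal P_{\mathbb T_l}(\mathbf G_l))$, where, for the thin SVD $\mathbf M_l=\mathbf U_l\boldsymbol\Sigma_l\mathbf V_l^\top$, $\mathcal P_{\mathbb T_l}(\mathbf G)=\mathbf U_l\mathbf U_l^\top\mathbf G+\mathbf G\mathbf V_l\mathbf V_l^\top-\mathbf U_l\mathbf U_l^\top\mathbf G\mathbf V_l\mathbf V_l^\top$. Two-phase stepsize schedule with parameters $(\tau_{\rm comp},\tau_{\rm stat},\mu_{\rm comp},\mu_{\rm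 stat},L_{\rm comp},L_{\rm stat})$: $\eta_0\in[0.2\|\mathbf M_0-\mathbf M^*\|_{\rm F}\mu_{\rm comp}L_{\rm comp}^{-2},\,0.3\|\mathbf M_0-\mathbf M^*\|_{\rm F}\mu_{\rm comp}L_{\rm comp}^{-2}]$; in phase one (when $\|\mathbf M_l-\mathbf M^*\|_{\rm F}\ge\tau_{\rm comp}$), $\eta_l=(1-0.04\mu_{\rm comp}^2L_{\rm comp}^{-2})^l\eta_0$; in phase two (when $\tau_{\rm comp}>\|\mathbf M_l-\mathbf M^*\|_{\rm F}\ge\tau_{\rm stat}$), $\eta_l\in[0.125\mu_{\rm stat}L_{\rm stat}^{-2},\,0.75\mu_{\rm stat}L_{\rm stat}^{-2}]$. $\Theta(\cdot)$ means up to constant factors. *)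

(* Defs.v *)
From HB Require Import structures.
From mathcomp Require Import all_boot all_order all_algebra.
From mathcomp Require Import all_classical all_reals all_analysis.
Import Order.TTheory GRing.Theory Num.Theory.
Import numFieldNormedType.Exports.

Set Implicit Arguments.
Unset Strict Implicit.
Unset Printing Implicit Defensive.

Local Open Scope classical_set_scope.
Local Open Scope ring_scope.

Section Matrices.
Context {R : realType} {d1 d2 : nat}.
Implicit Types (A B G M N Z W : 'M[R]_(d1, d2)).

Definition inner A B : R := \tr (A^T *m B).

(* The norm `|A| that MathComp-Analysis puts on matrices is the sup norm. *)
Definition frob A : R := Num.sqrt (inner A A).

Definition singular_value A (s : R) : Prop :=
  0 <= s /\ eigenvalue (A^T *m A) (s ^+ 2).

Definition smallest_nonzero_singular_value A (s : R) : Prop :=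
  [/\ singular_value A s, s != 0 &
      forall t, singular_value A t -> t != 0 -> s <= t].

(* U and V have r columns; when \rank M < r some entries of s are zero. *)
Definition thin_svd (r : nat) M
    (U : 'M[R]_(d1, r)) (s : 'rV[R]_r) (V : 'M[R]_(d2, r)) : Prop :=
  [/\ U^T *m U = 1%:M, V^T *m V = 1%:M,
      (forall i j : 'I_r, (i <= j)%N -> s 0 j <= s 0 i),
      (forall i, 0 <= s 0 i) & M = U *m diag_mx s *m V^T].

Definition tangent_proj (r : nat) (U : 'M[R]_(d1, r)) (V : 'M[R]_(d2, r)) G :
    'M[R]_(d1, d2) :=
  U *m U^T *m G + G *m V *m V^T - U *m U^T *m G *m V *m V^T.

(* A relation rather than a function, since a best approximation need not be
   unique when the r-th and (r+1)-th singular values of Z coincide. *)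
Definition SVD_approx (r : nat) Z W : Prop :=
  (\rank W <= r)%N /\
  forall W', (\rank W' <= r)%N -> frob (Z - W) <= frob (Z - W').

Definition subdifferential (f : 'M[R]_(d1, d2) -> R) M :
    set 'M[R]_(d1, d2) :=
  [set G | forall N, f M + inner G (N - M) <= f N].

Definition abs_loss (n : nat) (X : 'I_n -> 'M[R]_(d1, d2)) (Y : 'I_n -> R) M : R :=
  \sum_(i < n) `|Y i - inner M (X i)|.

Definition rsgrad_step (r : nat) (f : 'M[R]_(d1, d2) -> R) (eta : R) M M' : Prop :=
  exists G (U : 'M[R]_(d1, r)) (s : 'rV[R]_r) (V : 'M[R]_(d2, r)),
    [/\ subdifferential f M G, thin_svd M U s V &
        SVD_approx r (M - eta *: tangent_proj U V G) M'].

Definition rsgrad_run (r : nat) (f : 'M[R]_(d1, d2) -> R)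
    (eta : nat -> R) (M : nat -> 'M[R]_(d1, d2)) : Prop :=
  (\rank (M 0) <= r)%N /\
  forall l, rsgrad_step r f (eta l) (M l) (M l.+1).

End Matrices.

Section Schedule.
Context {R : realType}.

(* D l is the Frobenius distance of the l-th iterate to the target. The range
   of eta 0 is only required when iteration 0 belongs to phase one; otherwise
   it would compete with the phase-two range at l = 0. *)
Definition two_phase_schedule
    (tau_comp tau_stat mu_comp mu_stat L_comp L_stat : R)
    (D eta : nat -> R) : Prop :=
  (tau_comp <= D 0%N ->
     2 / 10 * D 0%N * mu_comp * L_comp ^- 2 <= eta 0%N
       <= 3 / 10 * D 0%N * mu_comp * L_comp ^- 2) /\
  forall l,
    (tau_comp <= D l ->
       eta l = (1 - 4 / 100 * mu_comp ^+ 2 * L_comp ^- 2) ^+ l * eta 0%N) /\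
    (tau_stat <= D l < tau_comp ->
       125 / 1000 * mu_stat * L_stat ^- 2 <= eta l
         <= 75 / 100 * mu_stat * L_stat ^- 2).

(* The schedule prescribes the stepsize of an iteration only while the iterate
   is at distance at least tau_stat. [scheduled tau_stat D l] says that the
   first l iterations are all in phase one or phase two. *)
Definition scheduled (tau_stat : R) (D : nat -> R) (l : nat) : Prop :=
  forall k, (k < l)%N -> tau_stat <= D k.

Definition theta_between (a b t : R) (l : nat) : Prop :=
  a * t <= l%:R <= b * t.

End Schedule.

Section Model.
Context {R : realType} {dT : measure_display} {T : measurableType dT}.
Variable P : probability T R.

Definition mutually_independent (I : finType) (Z : I -> {RV P >-> R}) : Prop :=
  forall (J : {set I}) (A : I -> set R),
    (forall i, measurable (A i)) ->
    P (\bigcap_(i in [set` J]) (Z i @^-1` A i)) =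
      (\prod_(i in J) P (Z i @^-1` A i))%E.

Definition normal_rv (Z : {RV P >-> R}) (m s : R) : Prop :=
  forall A : set R, measurable A -> distribution P Z A = normal_prob m s A.

Definition design_noise_family (n d1 d2 : nat)
    (X : 'I_n -> 'I_d1 -> 'I_d2 -> {RV P >-> R}) (xi : 'I_n -> {RV P >-> R})
    (k : ('I_n * 'I_d1 * 'I_d2) + 'I_n) : {RV P >-> R} :=
  match k with
  | inl (i, a, b) => X i a b
  | inr i => xi i
  end.

(* Joint independence of all the entries and noises amounts to: independent
   samples, independent entries within a design matrix, and each design matrix
   independent of its noise. *)
Definition gaussian_model (n d1 d2 : nat) (sigma : R)
    (X : 'I_n -> 'I_d1 -> 'I_d2 -> {RV P >-> R})
    (xi : 'I_n -> {RV P >-> R}) : Prop :=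
  [/\ forall i a b, normal_rv (X i a b) 0 1,
      forall i, normal_rv (xi i) 0 sigma &
      mutually_independent (design_noise_family X xi)].

Definition design (n d1 d2 : nat)
    (X : 'I_n -> 'I_d1 -> 'I_d2 -> {RV P >-> R}) (w : T) (i : 'I_n) :
    'M[R]_(d1, d2) :=
  \matrix_(a, b) X i a b w.

End Model.

(* Main.v *)
(* The loss excess H(D) = f(Mstar + D) - f(Mstar) is, for all D of rank at most 4r at
   once, bounded below by a multiple of n |D| when |D| >= sigma and of
   n |D|^2 / sigma when tau_stat <= |D| <= sigma, and bounded above by a multiple
   of n |D|^2 / sigma in the latter range. At scale d = sigma 2^-j this is seen
   by splitting the noises into those in the band |xi_i| <= 14/100 d, each of
   which contributes at least |x_i| - 28/100 d, and the others, whose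
   contribution is - sign(xi_i) x_i plus a nonnegative part; convexity along rays
   passes from |D| = d to |D| >= d. The resulting sums are controlled by Chernoff
   bounds on a net of the unit sphere of the rank-4r matrices, summed over j.
   Evaluating f along a subgradient G then gives <G, N> <= L |N| for low-rank N,
   L being of order n in phase one and n |D| / sigma in phase two, so that a
   projected subgradient step contracts |M - Mstar|; truncating to rank r costs only
   a second-order factor, because M' is the projection of the untruncated matrix
   onto its own tangent space and Mstar is nearly tangent there. *)
Require Import Defs.
From HB Require Import structures.
From mathcomp Require Import all_boot all_order all_algebra.
From mathcomp Require Import all_classical all_reals all_analysis.
From mathcomp Require Import measurable_realfun.
From mathcomp Require Import ring lra.
Import Order.TTheory GRing.Theory Num.Theory.
Import numFieldNormedType.Exports.

Set Implicit Arguments.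
Unset Strict Implicit.
Unset Printing Implicit Defensive.

Local Open Scope classical_set_scope.
Local Open Scope ring_scope.

(** The schedule prescribes numbers: [1/12], [2] and the decay [1 - q] with [q = 0.04/576]. So phase
    one cannot run on unspecified absolute constants: the relative gain of a step, about
    [0.044 w - 1.96 w^2] with [w >= 1/240], must exceed [2 q], and it does so with little to spare.
    This is why [22/1000] and [14/10] are tracked explicitly and why [|x|] gets an explicit
    exponential minorant. Phase two has the free constant [C4] and can afford crude bounds. The rank
    [4 r] is [2 r] for the error of an iterate plus [2 r] for a tangent direction. The scales stop
    at tau_stat because the signed sum has a tail exponent of order [n t^2] only, at scale [t], and
    this must beat the entropy of the net, of order [r d1]. Independence is given on events, so the
    Chernoff bounds work with finite sums of products of functions of one variable each, whose
    expectations factor. The good event is fixed before any iterate is looked at; on it the dynamics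
    is deterministic. *)

(** * Frobenius inner product, partial isometries, orthonormalisation *)

Section Frobenius.
Context {R : realType}.
Implicit Types m n p : nat.

Lemma innerE m n (A B : 'M[R]_(m, n)) : inner A B = \sum_i \sum_j A i j * B i j.
Proof.
rewrite /inner /mxtrace exchange_big /=; apply: eq_bigr => j _.
by rewrite mxE; apply: eq_bigr => i _; rewrite mxE.
Qed.

Lemma innerC m n (A B : 'M[R]_(m, n)) : inner A B = inner B A.
Proof. by rewrite !innerE; do 2!apply: eq_bigr => ? _; rewrite mulrC. Qed.

Lemma innerDr m n (A B C : 'M[R]_(m, n)) : inner A (B + C) = inner A B + inner A C.
Proof. by rewrite /inner mulmxDr mxtraceD. Qed.

Lemma innerDl m n (A B C : 'M[R]_(m, n)) : inner (A + B) C = inner A C + inner B C.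
Proof. by rewrite innerC innerDr !(innerC C). Qed.

Lemma innerZr m n a (A B : 'M[R]_(m, n)) : inner A (a *: B) = a * inner A B.
Proof. by rewrite /inner -scalemxAr mxtraceZ. Qed.

Lemma innerZl m n a (A B : 'M[R]_(m, n)) : inner (a *: A) B = a * inner A B.
Proof. by rewrite innerC innerZr innerC. Qed.

Lemma innerNr m n (A B : 'M[R]_(m, n)) : inner A (- B) = - inner A B.
Proof. by rewrite -scaleN1r innerZr mulN1r. Qed.

Lemma innerNl m n (A B : 'M[R]_(m, n)) : inner (- A) B = - inner A B.
Proof. by rewrite innerC innerNr innerC. Qed.

Lemma innerBr m n (A B C : 'M[R]_(m, n)) : inner A (B - C) = inner A B - inner A C.
Proof. by rewrite innerDr innerNr. Qed.

Lemma innerBl m n (A B C : 'M[R]_(m, n)) : inner (A - B) C = inner A C - inner B C.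
Proof. by rewrite innerDl innerNl. Qed.

Lemma inner0r m n (A : 'M[R]_(m, n)) : inner A 0 = 0.
Proof. by rewrite -(scale0r 0) innerZr mul0r. Qed.

Lemma inner0l m n (A : 'M[R]_(m, n)) : inner 0 A = 0.
Proof. by rewrite innerC inner0r. Qed.

Lemma inner_suml m n I (s : seq I) (P : pred I) (F : I -> 'M[R]_(m, n)) B :
  inner (\sum_(i <- s | P i) F i) B = \sum_(i <- s | P i) inner (F i) B.
Proof.
by elim/big_rec2: _ => [|i x y _ <-]; rewrite ?inner0l ?innerDl.
Qed.

Lemma inner_mulmxl m n p (P : 'M[R]_(m, p)) (A : 'M[R]_(p, n)) B :
  inner (P *m A) B = inner A (P^T *m B).
Proof. by rewrite /inner trmx_mul mulmxA. Qed.

Lemma inner_tr m n (A B : 'M[R]_(m, n)) : inner A^T B^T = inner A B.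
Proof.
by rewrite !innerE exchange_big; do 2!apply: eq_bigr => ? _; rewrite !mxE.
Qed.

Lemma inner_mulmxr m n p (A : 'M[R]_(m, p)) (Q : 'M[R]_(p, n)) B :
  inner (A *m Q) B = inner A (B *m Q^T).
Proof. by rewrite -inner_tr trmx_mul inner_mulmxl -inner_tr trmx_mul !trmxK. Qed.

Lemma inner_ge0 m n (A : 'M[R]_(m, n)) : 0 <= inner A A.
Proof. by rewrite innerE; do 2!apply: sumr_ge0 => ? _; rewrite -expr2 sqr_ge0. Qed.

Lemma inner_eq0 m n (A : 'M[R]_(m, n)) : inner A A = 0 -> A = 0.
Proof.
rewrite innerE => /psumr_eq0P H; apply/matrixP => i j; rewrite mxE.
have /psumr_eq0P H2 : \sum_j A i j * A i j = 0.
  by apply: H => // k _; apply: sumr_ge0 => l _; rewrite -expr2 sqr_ge0.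
have : A i j * A i j = 0 by apply: H2 => // k _; rewrite -expr2 sqr_ge0.
by move/eqP; rewrite mulf_eq0 orbb => /eqP.
Qed.

Lemma frob_ge0 m n (A : 'M[R]_(m, n)) : 0 <= frob A.
Proof. exact: sqrtr_ge0. Qed.
#[local] Hint Resolve frob_ge0 : core.

Lemma frob_sqr m n (A : 'M[R]_(m, n)) : frob A ^+ 2 = inner A A.
Proof. by rewrite sqr_sqrtr ?inner_ge0. Qed.

Lemma frob0 m n : frob (0 : 'M[R]_(m, n)) = 0.
Proof. by rewrite /frob inner0r sqrtr0. Qed.

Lemma frob_eq0 m n (A : 'M[R]_(m, n)) : frob A = 0 -> A = 0.
Proof. by move=> A0; apply: inner_eq0; rewrite -frob_sqr A0 expr0n. Qed.

Lemma frobZ m n a (A : 'M[R]_(m, n)) : frob (a *: A) = `|a| * frob A.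
Proof. by rewrite /frob innerZl innerZr mulrA -expr2 sqrtrM ?sqr_ge0// sqrtr_sqr. Qed.

Lemma frobN m n (A : 'M[R]_(m, n)) : frob (- A) = frob A.
Proof. by rewrite /frob innerNl innerNr opprK. Qed.

Lemma frob_tr m n (A : 'M[R]_(m, n)) : frob A^T = frob A.
Proof. by rewrite /frob inner_tr. Qed.

Lemma cauchy_schwarz m n (A B : 'M[R]_(m, n)) : inner A B <= frob A * frob B.
Proof.
have [A0|A0] := eqVneq (frob A) 0.
  by rewrite (frob_eq0 A0) inner0l mulr_ge0.
have [B0|B0] := eqVneq (frob B) 0.
  by rewrite (frob_eq0 B0) inner0r mulr_ge0.
have := inner_ge0 (frob B *: A - frob A *: B).
rewrite innerBl !innerBr !innerZl !innerZr (innerC B A) -!frob_sqr.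
have : 0 < frob A * frob B by rewrite mulr_gt0// lt0r ?A0 ?B0 /=.
move: (frob A) (frob B) (inner A B) => a b c ab0 H.
rewrite -(ler_pM2l ab0); nra.
Qed.

Lemma normr_inner m n (A B : 'M[R]_(m, n)) : `|inner A B| <= frob A * frob B.
Proof.
rewrite ler_norml cauchy_schwarz andbT lerNl -innerNl -(frobN A).
exact: cauchy_schwarz.
Qed.

Lemma frobD m n (A B : 'M[R]_(m, n)) : frob (A + B) <= frob A + frob B.
Proof.
rewrite -ler_sqr ?nnegrE ?addr_ge0//.
rewrite sqrrD !frob_sqr innerDl !innerDr (innerC B A).
have := cauchy_schwarz A B; lra.
Qed.

Lemma frobB m n (A B : 'M[R]_(m, n)) : frob (A - B) <= frob A + frob B.
Proof. by rewrite -(frobN B) frobD. Qed.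

Lemma frob_distC m n (A B : 'M[R]_(m, n)) : frob (A - B) = frob (B - A).
Proof. by rewrite -frobN opprB. Qed.

Lemma frobM m n p (A : 'M[R]_(m, p)) (B : 'M[R]_(p, n)) :
  frob (A *m B) <= frob A * frob B.
Proof.
rewrite -ler_sqr ?nnegrE ?mulr_ge0// exprMn !frob_sqr.
have -> : inner A A = \sum_i frob (row i A) ^+ 2.
  rewrite innerE; apply: eq_bigr => i _; rewrite frob_sqr innerE big_ord1.
  by apply: eq_bigr => j _; rewrite !mxE.
have -> : inner B B = \sum_j frob (col j B)^T ^+ 2.
  rewrite innerE exchange_big; apply: eq_bigr => j _.
  by rewrite frob_sqr innerE big_ord1; apply: eq_bigr => i _; rewrite !mxE.
rewrite innerE big_distrlr; apply: ler_sum => i _; apply: ler_sum => j _ /=.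
have -> : (A *m B) i j = inner (row i A) (col j B)^T.
  by rewrite innerE big_ord1 mxE; apply: eq_bigr => k _; rewrite !mxE.
rewrite -exprMn -expr2 -[X in X <= _]real_normK ?num_real//.
by rewrite ler_sqr ?nnegrE ?mulr_ge0// normr_inner.
Qed.

Lemma pythagoras m n (A B : 'M[R]_(m, n)) :
  inner A B = 0 -> frob (A + B) ^+ 2 = frob A ^+ 2 + frob B ^+ 2.
Proof. by move=> AB; rewrite !frob_sqr innerDl !innerDr (innerC B A) AB; ring. Qed.

(* Q *m Q^T *m Q = Q says that Q is a partial isometry. *)
Lemma frob_isom m n p (Q : 'M[R]_(m, p)) (B : 'M[R]_(p, n)) :
  Q *m Q^T *m Q = Q -> frob (Q *m B) <= frob B.
Proof.
move=> hQ.
have E : B = Q^T *m (Q *m B) + (B - Q^T *m (Q *m B)) by rewrite addrC subrK.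
have orth : inner (Q^T *m (Q *m B)) (B - Q^T *m (Q *m B)) = 0.
  by rewrite inner_mulmxl trmxK mulmxBr !mulmxA hQ subrr inner0r.
have E2 : frob (Q *m B) ^+ 2 = frob (Q^T *m (Q *m B)) ^+ 2.
  by rewrite !frob_sqr [RHS]inner_mulmxl trmxK !mulmxA hQ.
rewrite -ler_sqr ?nnegrE// E2 [in leRHS]E pythagoras//.
by rewrite lerDl sqr_ge0.
Qed.

Lemma frob_isom_tr m n p (Q : 'M[R]_(m, p)) (B : 'M[R]_(m, n)) :
  Q *m Q^T *m Q = Q -> frob (Q^T *m B) <= frob B.
Proof.
move=> hQ; apply: frob_isom.
by rewrite trmxK -[in RHS]hQ !trmx_mul trmxK mulmxA.
Qed.

Lemma frob_isom_r m n p (Q : 'M[R]_(p, n)) (B : 'M[R]_(m, p)) :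
  Q *m Q^T *m Q = Q -> frob (B *m Q) <= frob B.
Proof.
by move=> hQ; rewrite -frob_tr trmx_mul -(frob_tr B); exact: frob_isom_tr.
Qed.

Lemma frob_isom_tr_r m n p (Q : 'M[R]_(n, p)) (B : 'M[R]_(m, p)) :
  Q *m Q^T *m Q = Q -> frob (B *m Q^T) <= frob B.
Proof.
by move=> hQ; rewrite -frob_tr trmx_mul -(frob_tr B) trmxK; exact: frob_isom.
Qed.

Lemma orth_proj_isom n (P : 'M[R]_n) : P^T = P -> P *m P = P -> P *m P^T *m P = P.
Proof. by move=> -> PP; rewrite !PP. Qed.

Lemma compl_orth_proj n (P : 'M[R]_n) : P^T = P -> P *m P = P ->
  (1%:M - P)^T = 1%:M - P /\ (1%:M - P) *m (1%:M - P) = 1%:M - P.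
Proof.
move=> Pt PP; split; first by rewrite linearB /= trmx1 Pt.
by rewrite mulmxBr mulmx1 mulmxBl mul1mx PP subrr subr0.
Qed.

(** The factorisation [Q = A *m C] keeps the columns of [Q] in the column space of [A]; with the
    second identity, [Q *m Q^T] is the orthogonal projection onto that space, whatever the rank of
    [A]. *)
Lemma gram_schmidt m k (A : 'M[R]_(m, k)) :
  exists Q : 'M[R]_(m, k), exists C : 'M[R]_k, Q = A *m C /\ Q *m Q^T *m A = A.
Proof.
elim: k A => [|k IH] A.
  by exists 0, 0; split; apply/matrixP => i [].
move: A; rewrite -addn1 => A; rewrite -(hsubmxK A).
set B := lsubmx A; set a := rsubmx A.
have [Q [C [QE QB]]] := IH B.
have QQQ : Q *m Q^T *m Q = Q by rewrite {3}QE mulmxA QB.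
have QtQ : Q^T *m (1%:M - Q *m Q^T) = 0.
  apply: trmx_inj; rewrite trmx0 trmx_mul linearB /= trmx1 trmx_mul !trmxK.
  by rewrite mulmxBl mul1mx QQQ subrr.
pose v := a - Q *m Q^T *m a.
(* If [a] depends on the previous columns then [v = 0] and the new column is zero, [0^-1] being 0:
   [Q] is then a partial isometry only. *)
pose c := (frob v)^-1; pose q := c *: v.
have Qv : Q^T *m v = 0.
  have -> : v = (1%:M - Q *m Q^T) *m a by rewrite mulmxBl mul1mx.
  by rewrite mulmxA QtQ mul0mx.
have vQ : v^T *m Q = 0 by rewrite -[LHS]trmxK trmx_mul trmxK Qv trmx0.
have vv : v^T *m v = (frob v ^+ 2)%:M.
  rewrite frob_sqr /inner; apply/matrixP => i j; rewrite !ord1 [RHS]mxE /=.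
  by rewrite /mxtrace big_ord1 mulr1n.
have qqv : q *m q^T *m v = v.
  rewrite /q linearZ /= -scalemxAl -scalemxAr scalerA -scalemxAl -mulmxA vv.
  rewrite mul_mx_scalar scalerA.
  have [v0|v0] := eqVneq (frob v) 0; first by rewrite (frob_eq0 v0) scaler0.
  have -> : c * c * frob v ^+ 2 = 1 by rewrite /c; field.
  by rewrite scale1r.
have Qt q' : row_mx Q q' *m (row_mx Q q')^T = Q *m Q^T + q' *m q'^T.
  by rewrite tr_row_mx mul_row_col.
have BE : v^T *m B = 0.
  by rewrite -QB !mulmxA vQ !mul0mx.
have qB : q *m q^T *m B = 0.
  by rewrite /q linearZ /= -scalemxAl -scalemxAr scalerA -scalemxAl -mulmxA BE
    mulmx0 scaler0.
have aE : a = Q *m Q^T *m a + v by rewrite addrC subrK.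
exists (row_mx Q q), (block_mx C (- c *: (C *m Q^T *m a)) 0 (c%:M)); split.
  rewrite mul_row_block mulmx0 addr0 -QE; congr row_mx.
  rewrite mul_mx_scalar /q /v scalerBr -scalemxAr !mulmxA -QE scaleNr addrC.
  by [].
rewrite Qt mul_mx_row; congr row_mx.
  by rewrite mulmxDl QB qB addr0.
rewrite mulmxDl [in X in _ + X]aE mulmxDr qqv.
rewrite [X in X + v](_ : _ = 0) ?add0r -?aE//.
rewrite /q linearZ /= -scalemxAl -scalemxAr scalerA -scalemxAl.
by rewrite -!mulmxA (mulmxA v^T) vQ mul0mx mulmx0 scaler0.
Qed.

Lemma orth_basis m k (A : 'M[R]_(m, k)) :
  exists Q : 'M[R]_(m, k), Q *m Q^T *m A = A /\ Q *m Q^T *m Q = Q.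
Proof.
have [Q [C [QE QA]]] := gram_schmidt A.
by exists Q; split=> //; rewrite {3}QE mulmxA QA.
Qed.

End Frobenius.
#[export] Hint Extern 0 (is_true (0 <= frob _)) => solve [exact: frob_ge0] : core.

(** * The smallest nonzero singular value as a lower bound on the row space *)

Section SmallestSingularValue.
Context {R : realType}.
Implicit Types m n p : nat.

Lemma continuous_frob_mulmx n p (C : 'M[R]_(n, p)) :
  continuous (fun x : 'rV[R]_n => frob (x *m C)).
Proof.
have cc j : continuous (fun x : 'rV[R]_n => (x *m C) 0 j).
  under eq_fun do rewrite mxE.
  apply: continuous_big => [|i _ x]; first by move=> z; apply: cvgD; [exact: cvg_fst|exact: cvg_snd].
  by apply: continuousM; [exact: coord_continuous|exact: cst_continuous].
have ci : continuous (fun x : 'rV[R]_n => inner (x *m C) (x *m C)).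
  under eq_fun do rewrite innerE big_ord1.
  apply: continuous_big => [|i _ x]; first by move=> z; apply: cvgD; [exact: cvg_fst|exact: cvg_snd].
  by apply: continuousM; exact: cc.
move=> x; apply: (cvg_comp _ Num.sqrt); first exact: ci.
exact: sqrt_continuous.
Qed.

(** A minimiser of [|x M^T|] on the compact unit sphere of the row space is an eigenvector of
    [M^T M] by first-order optimality. The minimum is nonzero since a row [x = y M] with [x M^T = 0]
    vanishes, so the minimality of [s] applies to it. *)
Lemma rowspace_lower_bound_rV m n (M : 'M[R]_(m, n)) (s : R) (x : 'rV[R]_n) :
  smallest_nonzero_singular_value M s -> (x <= M)%MS ->
  s * frob x <= frob (x *m M^T).
Proof.
move=> [[s0 _] sn0 smin] xM.
have [x0|x0] := eqVneq (frob x) 0; first by rewrite x0 mulr0.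
have xp : 0 < frob x by rewrite lt0r x0 /=.
pose A := [set y : 'rV[R]_n | frob y = 1 /\ (y <= M)%MS].
have Ax : A ((frob x)^-1 *: x).
  split; last by rewrite scalemx_sub.
  by rewrite frobZ ger0_norm ?invr_ge0 ?frob_ge0// mulVf.
have cA : compact A.
  apply: bounded_closed_compact.
  - exists 1; split; first exact: num_real.
    move=> z z1 y [y1 _]; apply: ltW; apply: le_lt_trans z1.
    rewrite /Num.norm /= mx_normrE; apply/bigmax_leP; split => // -[i j] _ /=.
    rewrite -y1 -ler_sqr ?nnegrE//= real_normK ?num_real// frob_sqr innerE.
    rewrite (bigD1 i)//= (bigD1 j)//= -expr2 -addrA lerDl addr_ge0//.
      by apply: sumr_ge0 => k _; rewrite -expr2 sqr_ge0.
    by do 2!apply: sumr_ge0 => ? _; rewrite -expr2 sqr_ge0.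
  (* [cokermx M] turns membership in the row space into a closed condition. *)
  - have -> : A = (fun y : 'rV[R]_n => frob (y *m 1%:M)) @^-1` [set 1] `&`
                  (fun y : 'rV[R]_n => frob (y *m cokermx M)) @^-1` [set 0].
      apply/seteqP; split => y /=.
        by move=> [y1 yM]; rewrite mulmx1; split=> //; move: yM;
          rewrite submxE => /eqP ->; rewrite frob0.
      by rewrite mulmx1 => -[y1 /frob_eq0 yM]; split=> //; rewrite submxE yM.
    apply: closedI; apply: preimage_closed; try exact: closed_eq.
      by move=> y _; exact: continuous_frob_mulmx.
    by move=> y _; exact: continuous_frob_mulmx.
have [||c] := @EVT_min_rV R n (fun y => frob (y *m M^T)) A _ cA.
- by exists ((frob x)^-1 *: x).
- by apply: continuous_subspaceT; exact: continuous_frob_mulmx.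
rewrite inE => -[c1 cM] cmin.
set l := frob (c *m M^T) in cmin *.
have lmin (y : 'rV[R]_n) : (y <= M)%MS -> l * frob y <= frob (y *m M^T).
  move=> yM; have [->|y0] := eqVneq (frob y) 0; first by rewrite mulr0.
  have : A ((frob y)^-1 *: y).
    split; last by rewrite scalemx_sub.
    by rewrite frobZ ger0_norm ?invr_ge0 ?frob_ge0// mulVf.
  move/mem_set/cmin; rewrite -scalemxAl frobZ ger0_norm ?invr_ge0//.
  by rewrite [X in _ <= X]mulrC ler_pdivlMr ?lt0r ?y0 ?frob_ge0.
have l0 : 0 <= l by exact: frob_ge0.
(* first-order optimality of c *)
have opt (w : 'rV[R]_n) : (w <= M)%MS -> inner (c *m M^T) (w *m M^T) = l ^+ 2 * inner c w.
  move=> wM.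
  pose k := inner (c *m M^T) (w *m M^T) - l ^+ 2 * inner c w.
  suff : k = 0 by move/eqP; rewrite subr_eq0 => /eqP.
  pose e := frob (w *m M^T) ^+ 2 - l ^+ 2 * frob w ^+ 2.
  (* Minimality along [c + t w]: a nonnegative quadratic in [t] without constant term has no linear
     term. *)
  have quad t : 0 <= 2 * t * k + t ^+ 2 * e.
    have := lmin (c + t *: w); rewrite addmx_sub ?scalemx_sub// => /(_ isT).
    rewrite -ler_sqr ?nnegrE ?mulr_ge0// exprMn !frob_sqr mulmxDl -scalemxAl.
    rewrite !innerDl !innerDr !innerZl !innerZr (innerC w c) (innerC (w *m _)).
    rewrite -!frob_sqr c1 -/l /k /e; lra.
  have [e0|e0] := leP e 0.
    have := quad 1; have := quad (-1); have := quad 2; have := quad (-2); lra.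
  have := quad (- (k / e)); have -> : 2 * - (k / e) * k + (- (k / e)) ^+ 2 * e =
    - (k ^+ 2 / e) by field; rewrite gt_eqF.
  rewrite oppr_ge0 pmulr_lle0 ?invr_gt0// => k2.
  by apply/eqP; rewrite -sqrf_eq0 eq_le k2 sqr_ge0.
have eig : c *m (M^T *m M) = l ^+ 2 *: c.
  apply/eqP; rewrite -subr_eq0; apply/eqP; apply: inner_eq0.
  set w := _ - _; have wM : (w <= M)%MS.
    by rewrite /w addmx_sub ?eqmx_opp ?scalemx_sub// mulmxA submxMl.
  by rewrite {1}/w innerBl innerZl mulmxA inner_mulmxr opt// subrr.
have lne0 : l != 0.
  apply/eqP => /frob_eq0 cMt; case/submxP: cM => y cE.
  have : inner c c = 0 by rewrite {1}cE inner_mulmxr cMt inner0r.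
  by rewrite -frob_sqr c1 expr1n => /eqP; rewrite oner_eq0.
have : singular_value M l.
  split=> //; apply/eigenvalueP; exists c => //.
  by apply/eqP => c0; move: c1; rewrite c0 frob0 => /eqP; rewrite eq_sym oner_eq0.
move=> /smin/(_ lne0) sl; apply: le_trans (lmin _ xM).
by rewrite ler_wpM2r.
Qed.

Lemma rowspace_lower_bound m n p (M : 'M[R]_(m, n)) (s : R) (B : 'M[R]_(p, n)) :
  smallest_nonzero_singular_value M s -> (B <= M)%MS ->
  s * frob B <= frob (B *m M^T).
Proof.
move=> hs BM; have s0 : 0 <= s by case: hs => -[].
rewrite -ler_sqr ?nnegrE ?mulr_ge0// exprMn.
have sqE q (C : 'M[R]_(p, q)) : frob C ^+ 2 = \sum_i frob (row i C) ^+ 2.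
  rewrite frob_sqr innerE; apply: eq_bigr => i _; rewrite frob_sqr innerE big_ord1.
  by apply: eq_bigr => j _; rewrite !mxE.
rewrite !sqE mulr_sumr; apply: ler_sum => i _.
rewrite row_mul -exprMn ler_sqr ?nnegrE ?mulr_ge0//.
by apply: rowspace_lower_bound_rV => //; apply: submx_trans BM; exact: row_sub.
Qed.

(* The part of M lying outside the tangent space at M' = P M' Q is of second
   order: it factors through (M - M') on both sides and the inverse of M on its
   row space. *)
Lemma normal_part_le m n (M M' : 'M[R]_(m, n)) (s : R)
    (P : 'M[R]_m) (Q : 'M[R]_n) :
  smallest_nonzero_singular_value M s ->
  P^T = P -> P *m P = P -> Q^T = Q -> Q *m Q = Q ->
  P *m M' = M' -> M' *m Q = M' ->
  s * frob ((1%:M - P) *m M *m (1%:M - Q)) <= frob (M - M') ^+ 2.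
Proof.
move=> hs Pt PP Qt QQ PM QM.
have s0 : 0 <= s by case: hs => -[].
have [P't PP'] := compl_orth_proj Pt PP; have [Q't QQ'] := compl_orth_proj Qt QQ.
have PM' : (1%:M - P) *m M' = 0 by rewrite mulmxBl mul1mx PM subrr.
have QM' : M' *m (1%:M - Q) = 0 by rewrite mulmxBr mulmx1 QM subrr.
move: (1%:M - P) (1%:M - Q) P't PP' Q't QQ' PM' QM' => P1 Q1 P1t PP1 Q1t QQ1 PM1 QM1.
have [V [C [VE VM]]] := gram_schmidt M^T.
have VV : V *m V^T *m V = V by rewrite {3}VE mulmxA VM.
(* The rows of [B] lie in the row space of [M], and [B *m M^T] is the transpose of [(M - M') *m Q1]
   because [M' *m Q1 = 0]; hence [s |B|] is at most [|M - M'|]. *)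
pose B := (V *m V^T *m Q1)^T.
have MV : M *m (V *m V^T) = M.
  by apply: trmx_inj; rewrite !trmx_mul trmxK VM.
have BM : (B <= M)%MS.
  by rewrite /B !trmx_mul trmxK {2}VE trmx_mul trmxK !mulmxA submxMl.
have P1E : frob (P1 *m (M - M')) <= frob (M - M').
  by apply: frob_isom; exact: orth_proj_isom.
have BE : B *m M^T = ((M - M') *m Q1)^T.
  by rewrite /B -trmx_mul mulmxA MV mulmxBl QM1 subr0.
have Bs : s * frob B <= frob (M - M').
  apply: le_trans (rowspace_lower_bound hs BM) _.
  by rewrite BE frob_tr; apply: frob_isom_r; exact: orth_proj_isom.
have -> : P1 *m M *m Q1 = P1 *m (M - M') *m (V *m V^T *m Q1).
  by rewrite mulmxBr PM1 subr0 mulmxA -(mulmxA P1 M (V *m V^T)) MV.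
have -> : V *m V^T *m Q1 = B^T by rewrite /B trmxK.
apply: le_trans (_ : s * (frob (P1 *m (M - M')) * frob B) <= _).
  by rewrite ler_wpM2l// -(frob_tr B) frobM.
rewrite mulrCA expr2 ler_pM// mulr_ge0//.
Qed.

End SmallestSingularValue.

(** * One projected subgradient step and its truncation *)

Section OneStep.
Context {R : realType} {d1 d2 : nat}.
Implicit Types (M N Z W : 'M[R]_(d1, d2)) (r : nat).

Lemma col_proj_sym m k (U : 'M[R]_(m, k)) : (U *m U^T)^T = U *m U^T.
Proof. by rewrite trmx_mul trmxK. Qed.

Lemma col_proj_idem m k (U : 'M[R]_(m, k)) :
  U^T *m U = 1%:M -> (U *m U^T) *m (U *m U^T) = U *m U^T.
Proof. by move=> UU; rewrite mulmxA -(mulmxA U) UU mulmx1. Qed.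

Lemma tangent_projE r (U : 'M[R]_(d1, r)) (V : 'M[R]_(d2, r)) M :
  tangent_proj U V M = M - (1%:M - U *m U^T) *m M *m (1%:M - V *m V^T).
Proof.
rewrite /tangent_proj mulmxBl mul1mx mulmxBr mulmx1 mulmxBl !mulmxA.
move: (U *m U^T *m M) (M *m V *m V^T) (U *m U^T *m M *m V *m V^T) => a b c.
by apply/matrixP => i j; rewrite !mxE; ring.
Qed.

Lemma inner_tangent_normal r (U : 'M[R]_(d1, r)) (V : 'M[R]_(d2, r)) M N :
  U^T *m U = 1%:M -> V^T *m V = 1%:M ->
  inner (tangent_proj U V M)
        ((1%:M - U *m U^T) *m N *m (1%:M - V *m V^T)) = 0.
Proof.
move=> /col_proj_idem PP /col_proj_idem QQ.
have [Pt PP'] := compl_orth_proj (col_proj_sym U) PP.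
have [Qt QQ'] := compl_orth_proj (col_proj_sym V) QQ.
rewrite tangent_projE.
move: (1%:M - U *m U^T) (1%:M - V *m V^T) Pt PP' Qt QQ' => P Q Pt PP' Qt QQ'.
rewrite innerC inner_mulmxr Qt inner_mulmxl Pt mulmxA mulmxBr mulmxBl !mulmxA.
by rewrite PP' -(mulmxA _ Q Q) QQ' subrr inner0r.
Qed.

Lemma inner_tangentC r (U : 'M[R]_(d1, r)) (V : 'M[R]_(d2, r)) M N :
  inner M (tangent_proj U V N) = inner (tangent_proj U V M) N.
Proof.
rewrite !tangent_projE innerBr innerBl; congr (_ - _).
have compl_sym k l (A : 'M[R]_(k, l)) : (1%:M - A *m A^T)^T = 1%:M - A *m A^T.
  by rewrite linearB /= trmx1 col_proj_sym.
by rewrite inner_mulmxr inner_mulmxl !compl_sym mulmxA.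
Qed.

Lemma tangent_split r (U : 'M[R]_(d1, r)) (V : 'M[R]_(d2, r)) M N :
  U^T *m U = 1%:M -> V^T *m V = 1%:M ->
  frob (tangent_proj U V M
        - (1%:M - U *m U^T) *m N *m (1%:M - V *m V^T)) ^+ 2 =
  frob (tangent_proj U V M) ^+ 2
  + frob ((1%:M - U *m U^T) *m N *m (1%:M - V *m V^T)) ^+ 2.
Proof.
move=> UU VV; rewrite pythagoras ?frobN//.
by rewrite innerNr inner_tangent_normal ?oppr0.
Qed.

Lemma frob_tangent_le r (U : 'M[R]_(d1, r)) (V : 'M[R]_(d2, r)) M :
  U^T *m U = 1%:M -> V^T *m V = 1%:M -> frob (tangent_proj U V M) <= frob M.
Proof.
move=> UU VV; rewrite -ler_sqr ?nnegrE//.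
have {2}-> : M = tangent_proj U V M
    - (1%:M - U *m U^T) *m (- M) *m (1%:M - V *m V^T).
  by rewrite tangent_projE mulmxN mulNmx opprK subrK.
by rewrite (tangent_split M (- M) UU VV) lerDl; exact: sqr_ge0.
Qed.

Lemma rankD_leq m n (A B : 'M[R]_(m, n)) a b :
  (\rank A <= a)%N -> (\rank B <= b)%N -> (\rank (A + B)%R <= a + b)%N.
Proof.
move=> Aa Bb; apply: leq_trans (mxrankS (addmx_sub_adds _ _)) _; rewrite ?submx_refl//.
exact: leq_trans (mxrank_adds_leqif _ _) (leq_add Aa Bb).
Qed.

Lemma rankZ_leq m n (A : 'M[R]_(m, n)) (c : R) a :
  (\rank A <= a)%N -> (\rank (c *: A)%R <= a)%N.
Proof.
by apply: leq_trans; apply: mxrankS; apply: scalemx_sub; exact: submx_refl.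
Qed.

Lemma rankB_leq m n (A B : 'M[R]_(m, n)) a b :
  (\rank A <= a)%N -> (\rank B <= b)%N -> (\rank (A - B)%R <= a + b)%N.
Proof.
by move=> Aa Bb; rewrite -scaleN1r; apply: rankD_leq => //; exact: rankZ_leq.
Qed.

Lemma rank_tangent r (U : 'M[R]_(d1, r)) (V : 'M[R]_(d2, r)) M :
  (\rank (tangent_proj U V M) <= 2 * r)%N.
Proof.
have -> : tangent_proj U V M = U *m (U^T *m M)
    + (M *m V - U *m U^T *m M *m V) *m V^T.
  by rewrite /tangent_proj mulmxBl !mulmxA addrA.
rewrite mul2n -addnn; apply: rankD_leq; first exact: leq_trans (mxrankM_maxl _ _) (rank_leq_col _).
exact: leq_trans (mxrankM_maxr _ _) (rank_leq_row _).
Qed.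

Lemma thin_svd_proj r M (U : 'M[R]_(d1, r)) s (V : 'M[R]_(d2, r)) :
  thin_svd M U s V -> U *m U^T *m M = M /\ M *m (V *m V^T) = M.
Proof.
move=> [UU VV _ _ ->]; split.
  by rewrite -!mulmxA (mulmxA U^T) UU mul1mx.
by rewrite -!mulmxA (mulmxA V^T V) VV mul1mx.
Qed.

(** Projecting [W] onto the column space or the row space of [W'] gives a competitor of rank at most
    [r], by Pythagoras strictly closer to [W] unless it equals [W']. So both one-sided projections
    of [W] are [W'], whichever best approximation was picked. *)
Lemma best_approx_proj r W W' (U : 'M[R]_(d1, r)) s (V : 'M[R]_(d2, r)) :
  SVD_approx r W W' -> thin_svd W' U s V -> tangent_proj U V W = W'.
Proof.
move=> [_ opt] svd; have [PW WQ] := thin_svd_proj svd.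
have [UU VV _ _ _] := svd.
have PWE : U *m U^T *m W = W'.
  apply/eqP; rewrite -subr_eq0; apply/eqP; apply: frob_eq0.
  have := opt (U *m U^T *m W); rewrite -mulmxA => /(_ _).
  have r1 : (\rank (U *m (U^T *m W)) <= r)%N.
    exact: leq_trans (mxrankM_maxl _ _) (rank_leq_col _).
  move=> /(_ r1); rewrite mulmxA -ler_sqr ?nnegrE//.
  have -> : W - W' = (W - U *m U^T *m W) + (U *m U^T *m W - W') by rewrite subrKA.
  rewrite pythagoras; last first.
    rewrite -{1}PW -mulmxBr innerC inner_mulmxl col_proj_sym mulmxBr mulmxA.
    by rewrite col_proj_idem// subrr inner0r.
  rewrite gerDl => z0; apply/eqP; rewrite -sqrf_eq0 eq_le z0 sqr_ge0 //.
have WQE : W *m (V *m V^T) = W'.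
  apply/eqP; rewrite -subr_eq0; apply/eqP; apply: frob_eq0.
  have r1 : (\rank (W *m (V *m V^T)) <= r)%N.
    by rewrite mulmxA; exact: leq_trans (mxrankM_maxr _ _) (rank_leq_row _).
  have := opt _ r1; rewrite -ler_sqr ?nnegrE//.
  have -> : W - W' = (W - W *m (V *m V^T)) + (W *m (V *m V^T) - W') by rewrite subrKA.
  rewrite pythagoras; last first.
    rewrite -{1}WQ -mulmxBl innerC inner_mulmxr col_proj_sym mulmxBl -mulmxA.
    by rewrite col_proj_idem// subrr inner0r.
  rewrite gerDl => z0; apply/eqP; rewrite -sqrf_eq0 eq_le z0 sqr_ge0 //.
rewrite /tangent_proj PWE -(mulmxA W) WQE -(mulmxA W') WQ.
by rewrite addrK.
Qed.

(** The error splits orthogonally into the tangential part of [W - Mstar] and the normal part of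
    [Mstar] at [W']. The latter is at most [|W' - Mstar|^2 / sr], and
    [|W' - Mstar| <= 2 |W - Mstar|] by best approximation; hence [16 = 4^2]. *)
Lemma svd_truncation_le r (Mstar W W' : 'M[R]_(d1, d2)) sr
    (U : 'M[R]_(d1, r)) s (V : 'M[R]_(d2, r)) :
  (\rank Mstar <= r)%N -> smallest_nonzero_singular_value Mstar sr -> 0 < sr ->
  SVD_approx r W W' -> thin_svd W' U s V ->
  frob (W' - Mstar) ^+ 2 <=
    frob (W - Mstar) ^+ 2 * (1 + 16 * (frob (W - Mstar) / sr) ^+ 2).
Proof.
move=> rkM hsr sr0 app svd.
have [PW WQ] := thin_svd_proj svd; have [UU VV _ _ _] := svd.
have proj := best_approx_proj app svd.
have res := normal_part_le hsr (col_proj_sym U) (col_proj_idem UU)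
  (col_proj_sym V) (col_proj_idem VV) PW WQ.
have tri : frob (W' - Mstar) <= 2 * frob (W - Mstar).
  have := frobB (W - Mstar) (W - W').
  have -> : W - Mstar - (W - W') = W' - Mstar.
    by apply/matrixP => i j; rewrite !mxE; ring.
  have := app.2 _ rkM; lra.
have E : W' - Mstar = tangent_proj U V (W - Mstar)
    - (1%:M - U *m U^T) *m Mstar *m (1%:M - V *m V^T).
  rewrite -{1}proj !tangent_projE (mulmxBr _ W Mstar) (mulmxBl (_ *m W)).
  move: (_ *m W *m _) (_ *m Mstar *m _) => a b.
  by apply/matrixP => i j; rewrite !mxE; ring.
move: res; rewrite frob_distC; set x := frob (_ *m _ *m _) => res.
rewrite {1}E tangent_split// -/x.
have := frob_tangent_le (W - Mstar) UU VV.
move: tri res; have := frob_ge0 (W - Mstar); have : 0 <= x by exact: frob_ge0.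
have := frob_ge0 (W' - Mstar); have := frob_ge0 (tangent_proj U V (W - Mstar)).
move: (frob _) (frob (W' - _)) (frob (W - _)) => a y z a0 y0 x0 z0 yz xy az.
have x2 : x <= 4 * z ^+ 2 / sr.
  rewrite ler_pdivlMr//; nra.
have -> : z ^+ 2 * (1 + 16 * (z / sr) ^+ 2) = z ^+ 2 + (4 * z ^+ 2 / sr) ^+ 2.
  by field; rewrite gt_eqF.
by apply: lerD; rewrite ler_sqr ?nnegrE// (le_trans x0).
Qed.

(** A bound on [G] in directions of rank at most [2 r] controls the whole tangential part [g], which
    has such a rank and satisfies [|g|^2 = <G, g>]. In the cross term, moving the projection onto
    [M - Mstar] leaves the normal part of [Mstar], at a cost of [L |M - Mstar|^2 / sr]. *)
Lemma rsgrad_descent r (f : 'M[R]_(d1, d2) -> R) eta (M G Mstar : 'M[R]_(d1, d2))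
    sr (L : R) (U : 'M[R]_(d1, r)) s (V : 'M[R]_(d2, r)) :
  (\rank Mstar <= r)%N -> smallest_nonzero_singular_value Mstar sr -> 0 < sr ->
  0 <= eta -> subdifferential f M G -> thin_svd M U s V ->
  (forall N, (\rank N <= 2 * r)%N -> inner G N <= L * frob N) -> 0 <= L ->
  frob (M - eta *: tangent_proj U V G - Mstar) ^+ 2 <=
    frob (M - Mstar) ^+ 2
    - 2 * eta * (f M - f Mstar - L * (frob (M - Mstar) ^+ 2 / sr))
    + eta ^+ 2 * L ^+ 2.
Proof.
move=> rkM hsr sr0 eta0 sub svd GL L0.
have [PW WQ] := thin_svd_proj svd; have [UU VV _ _ _] := svd.
have res := normal_part_le hsr (col_proj_sym U) (col_proj_idem UU)
  (col_proj_sym V) (col_proj_idem VV) PW WQ.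
set g := tangent_proj U V G.
have gL : frob g <= L.
  have [->//|g0] := eqVneq (frob g) 0.
  rewrite -(@ler_pM2r _ (frob g)) ?lt0r ?g0 ?frob_ge0// -expr2 frob_sqr.
  apply: le_trans (GL _ (rank_tangent U V G)).
  have gg : tangent_proj U V g = g.
    rewrite tangent_projE.
    suff -> : (1%:M - U *m U^T) *m g *m (1%:M - V *m V^T) = 0 by rewrite subr0.
    have [_ PP1] := compl_orth_proj (col_proj_sym U) (col_proj_idem UU).
    have [_ QQ1] := compl_orth_proj (col_proj_sym V) (col_proj_idem VV).
    rewrite /g tangent_projE.
    move: (1%:M - U *m U^T) (1%:M - V *m V^T) PP1 QQ1 => P1 Q1 PP1 QQ1.
    by rewrite mulmxBr mulmxBl !mulmxA PP1 -(mulmxA _ Q1 Q1) QQ1 subrr.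
  by rewrite -[X in inner G X]gg inner_tangentC.
have h1 : f M - f Mstar - L * (frob (M - Mstar) ^+ 2 / sr) <= inner (M - Mstar) g.
  have := sub Mstar; rewrite innerBr => subM.
  set x := (1%:M - U *m U^T) *m Mstar *m (1%:M - V *m V^T) in res.
  have tE : tangent_proj U V (M - Mstar) = M - Mstar + x.
    rewrite tangent_projE; congr (_ + _).
    have -> : (1%:M - U *m U^T) *m (M - Mstar) = - ((1%:M - U *m U^T) *m Mstar).
      by rewrite mulmxBr (mulmxBl _ _ M) mul1mx PW subrr add0r.
    by rewrite mulNmx opprK.
  rewrite /g inner_tangentC tE innerDl innerBl !(innerC _ G).
  have xL : inner G (- x) <= L * frob x.
    rewrite -frobN; apply: GL; rewrite -scaleN1r; apply: rankZ_leq.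
    apply: leq_trans (mxrankM_maxl _ _) _; apply: leq_trans (mxrankM_maxr _ _) _.
    by apply: leq_trans rkM _; rewrite leq_pmull.
  have : L * frob x <= L * (frob (M - Mstar) ^+ 2 / sr).
    by rewrite ler_wpM2l// ler_pdivlMr// mulrC frob_distC.
  move: xL; rewrite innerNr; lra.
have -> : M - eta *: g - Mstar = (M - Mstar) - eta *: g by rewrite addrAC.
move: (M - Mstar) h1 {res} => Z h1.
rewrite [X in X <= _]frob_sqr innerBl !innerBr !innerZl !innerZr -!frob_sqr.
rewrite (innerC g).
have : frob g ^+ 2 <= L ^+ 2 by rewrite ler_sqr ?nnegrE.
move: h1; move: (inner _ g) (frob g ^+ 2) => a b h1 bL.
have : eta * (f M - f Mstar - L * (frob Z ^+ 2 / sr)) <= eta * a.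
  by rewrite ler_wpM2l.
have : eta ^+ 2 * b <= eta ^+ 2 * L ^+ 2 by rewrite ler_wpM2l ?sqr_ge0.
lra.
Qed.
End OneStep.

(** * Scalar recursions behind the two phases *)

Section Stepsizes.
Context {R : realType}.
Implicit Types n D e eta w x y z sr c k mu K rho : R.

(** Here [e] is the geometric bound on [D] and [w] is [eta * n]; the stepsize follows [e], not [D].
    The coefficient is [2 * 22/1000 - 2 * 14/10 / 10^4]. The bound on [x] is largest at [D = e] and,
    being convex in [w], at an end of its interval; the lower end [w = e / 240] gives
    [1481 / 10^7]. *)
Lemma phase_one_quad D e w x : 0 <= D -> D <= e ->
  2 / 480 * e <= w -> w <= 3 / 480 * e ->
  x <= D ^+ 2 - 4372 / 100 / 1000 * (w * D) + 196 / 100 * w ^+ 2 ->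
  x <= (1 - 1481 / 10 / 1000 / 1000) * e ^+ 2.
Proof.
move=> D0 De wl wu xle.
have h1 : 0 <= (e - D) * (e + D - 4372 / 100 / 1000 * w).
  by apply: mulr_ge0; move: wu De D0; clear; lra.
have h2 : 0 <= (w - 2 / 480 * e) * (3 / 480 * e - w) by rewrite mulr_ge0 ?subr_ge0.
have h3 : 0 <= e * (w - 2 / 480 * e) by rewrite mulr_ge0 ?subr_ge0// (le_trans D0).
move: h1 h2 h3 xle; clear; nra.
Qed.

(** [1 / 144 / 100 = 4/100 * (1/24)^2] is the decay rate of the prescribed stepsizes. As
    [1481 / 10^7] exceeds twice this rate, there is room for the truncation factor, at most
    [1 + 2 / 10^7]. *)
Lemma phase_one_contract e x y z : 0 <= e -> 0 <= z -> 0 <= y ->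
  0 <= x <= 1 / 100 / 100 ->
  z ^+ 2 <= (1 - 1481 / 10 / 1000 / 1000) * e ^+ 2 ->
  y ^+ 2 <= z ^+ 2 * (1 + 16 * x ^+ 2) -> y <= (1 - 1 / 144 / 100) * e.
Proof.
move=> e0 z0 y0 /andP[x0 xle] zle yle.
have x2 : 16 * x ^+ 2 <= 2 / 10 / 1000 / 1000.
  have : x ^+ 2 <= (1 / 100 / 100) ^+ 2 by rewrite ler_sqr ?nnegrE//; lra.
  clear; lra.
have y1 : y ^+ 2 <= z ^+ 2 * (1 + 2 / 10 / 1000 / 1000).
  by apply: le_trans yle _; rewrite ler_wpM2l ?sqr_ge0// lerD2l.
have c0 : 0 <= (1 - 1 / 144 / 100) * e by rewrite mulr_ge0//; clear; lra.
rewrite -ler_sqr ?nnegrE//; have := sqr_ge0 e; move: zle y1; clear; lra.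
Qed.

Lemma phase_one_arith n D e eta z y sr c :
  0 < n -> 0 <= D -> D <= e -> 0 < sr -> 0 <= z -> 0 <= y ->
  0 < c <= 1 / 100 / 100 -> e <= c * sr ->
  2 / 10 * e * (n / 12) * (2 * n) ^- 2 <= eta
    <= 3 / 10 * e * (n / 12) * (2 * n) ^- 2 ->
  z ^+ 2 <= D ^+ 2 - 2 * eta * (22 / 1000 * n * D - 14 / 10 * n * (D ^+ 2 / sr))
    + eta ^+ 2 * (14 / 10 * n) ^+ 2 ->
  y ^+ 2 <= z ^+ 2 * (1 + 16 * (z / sr) ^+ 2) ->
  y <= (1 - 1 / 144 / 100) * e.
Proof.
move=> n0 D0 De sr0 z0 y0 /andP[c0 c1] esr /andP[etal etau] zle yle.
have e0 : 0 <= e by exact: le_trans De.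
have wl : 2 / 480 * e <= eta * n.
  rewrite -ler_pdivrMr//; apply: le_trans etal; rewrite le_eqVlt; apply/orP; left.
  by apply/eqP; field; rewrite gt_eqF.
have wu : eta * n <= 3 / 480 * e.
  rewrite -ler_pdivlMr//; apply: le_trans etau _; rewrite le_eqVlt; apply/orP; left.
  by apply/eqP; field; rewrite gt_eqF.
have w0 : 0 <= eta * n by apply: le_trans wl; apply: mulr_ge0 e0; clear; lra.
have esr' : e <= 1 / 100 / 100 * sr by apply: le_trans esr _; rewrite ler_wpM2r// ltW.
have Dsr : D ^+ 2 / sr <= 1 / 100 / 100 * D.
  rewrite ler_pdivrMr// expr2 mulrAC ler_wpM2r//; exact: le_trans esr'.
have z2 : z ^+ 2 <= (1 - 1481 / 10 / 1000 / 1000) * e ^+ 2.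
  apply: phase_one_quad D0 De wl wu _; apply: le_trans zle _.
  have -> : D ^+ 2 - 2 * eta * (22 / 1000 * n * D - 14 / 10 * n * (D ^+ 2 / sr))
    + eta ^+ 2 * (14 / 10 * n) ^+ 2 =
    D ^+ 2 - 44 / 1000 * (eta * n * D) + 28 / 10 * (eta * n * (D ^+ 2 / sr))
    + 196 / 100 * (eta * n) ^+ 2.
    by field; rewrite gt_eqF.
  have := ler_wpM2l w0 Dsr; clear; lra.
apply: (phase_one_contract e0 z0 y0 _ z2 yle).
apply/andP; split; first by apply: divr_ge0 => //; exact: ltW.
rewrite (ler_pdivrMr _ _ sr0); apply: le_trans esr'.
rewrite -ler_sqr ?nnegrE//; apply: le_trans z2 _.
by apply: ler_piMl; [exact: sqr_ge0|clear; lra].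
Qed.

(** With [rho = mu / (192 k)]: [(1 - rho) (1 + rho / 2) <= 1 - rho / 2 <= (1 - rho / 4)^2]. *)
Lemma phase_two_contract D y z x k mu :
  0 < k -> 0 < mu -> mu <= 192 * k -> 0 <= D -> 0 <= y ->
  z ^+ 2 <= D ^+ 2 * (1 - mu / (192 * k)) -> 16 * x ^+ 2 <= mu / (384 * k) ->
  y ^+ 2 <= z ^+ 2 * (1 + 16 * x ^+ 2) -> y <= (1 - mu / (768 * k)) * D.
Proof.
move=> k0 mu0 muk D0 y0 zle xle yle.
have : exists2 rho, 0 < rho <= 1 & [/\ mu / (192 * k) = rho, mu / (384 * k) = rho / 2
   & mu / (768 * k) = rho / 4].
  exists (mu / (192 * k)).
    by rewrite divr_gt0 ?mulr_gt0//= ler_pdivrMr ?mulr_gt0// mul1r.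
  by split=> //; field; rewrite gt_eqF.
case=> rho /andP[rho0 rho1] [E1 E2 E3]; rewrite E1 in zle; rewrite E2 in xle; rewrite E3.
move: k0 mu0 muk E1 E2 E3 => _ _ _ _ _ _.
have y2 : y ^+ 2 <= D ^+ 2 * (1 - rho / 2).
  apply: le_trans yle _.
  apply: le_trans (_ : z ^+ 2 * (1 + rho / 2) <= _).
    by rewrite ler_wpM2l ?sqr_ge0// lerD2l.
  apply: le_trans (_ : D ^+ 2 * (1 - rho) * (1 + rho / 2) <= _).
    by rewrite ler_wpM2r//; move: rho0; clear; lra.
  rewrite -mulrA ler_wpM2l ?sqr_ge0//; move: rho0; clear; nra.
have c0 : 0 <= (1 - rho / 4) * D by rewrite mulr_ge0//; move: rho1; clear; lra.
rewrite -ler_sqr ?nnegrE//.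
apply: le_trans y2 _; rewrite exprMn mulrC ler_wpM2r ?sqr_ge0//; clear; nra.
Qed.

(** [w] is [eta * n / sg], [a] is [D / sr] and [k] is [C4^2]; the schedule puts [w] between
    [1 / (96 k)] and [1 / (16 k)]. Of the gain [2 w mu], at most one half goes to the curvature term
    and one quarter to the quadratic term; the rest is at least [mu / (192 k)]. *)
Lemma phase_two_quad a mu K c w k : 0 <= a -> a <= c -> 0 < mu -> 0 < K -> 0 < k ->
  K * c <= mu / 2 -> K ^+ 2 <= 8 * mu * k -> 1 <= 96 * k * w -> 16 * k * w <= 1 ->
  1 - 2 * w * (mu - K * a) + w * (w * K ^+ 2) <= 1 - mu / (192 * k).
Proof.
move=> a0 ac mu0 K0 k0 Kc KC wl wu.
have w0 : 0 < w.
  have k96 : 0 < 96 * k by rewrite mulr_gt0.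
  by rewrite -(pmulr_rgt0 _ k96) (lt_le_trans _ wl)// ltr01.
have h1 : w * K ^+ 2 <= mu / 2.
  have h : w * K ^+ 2 <= w * (8 * mu * k) by rewrite ler_wpM2l// ltW.
  have : mu * (16 * k * w) <= mu by rewrite ger_pMr.
  move: h; clear; lra.
have h2 : K * a <= mu / 2 by apply: le_trans Kc; rewrite ler_wpM2l// ltW.
have h3 : mu / (192 * k) <= w * mu / 2.
  rewrite ler_pdivrMr ?mulr_gt0//.
  have := ler_wpM2l (ltW mu0) wl; clear; lra.
have := ler_wpM2l (ltW w0) h1; have := ler_wpM2l (ltW w0) h2; move: h3; clear; lra.
Qed.

Lemma phase_two_arith n D eta z y sr c sg mu K C4 :
  0 < n -> 0 <= D -> 0 < sr -> 0 <= z -> 0 <= y -> 0 < c -> 0 < sg ->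
  0 < mu -> 0 < K -> 0 < C4 -> D <= c * sr ->
  K * c <= mu / 2 -> K ^+ 2 <= 8 * mu * C4 ^+ 2 -> 16 * c ^+ 2 <= mu / (384 * C4 ^+ 2) ->
  mu <= 192 * C4 ^+ 2 ->
  125 / 1000 * (n / (12 * sg)) * (C4 * n * sg^-1) ^- 2 <= eta
    <= 75 / 100 * (n / (12 * sg)) * (C4 * n * sg^-1) ^- 2 ->
  z ^+ 2 <= D ^+ 2
    - 2 * eta * (mu * n * D ^+ 2 / sg - K * n * D / sg * (D ^+ 2 / sr))
    + eta ^+ 2 * (K * n * D / sg) ^+ 2 ->
  y ^+ 2 <= z ^+ 2 * (1 + 16 * (z / sr) ^+ 2) ->
  y <= (1 - mu / (768 * C4 ^+ 2)) * D.
Proof.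
move=> n0 D0 sr0 z0 y0 c0 sg0 mu0 K0 C40 Dc Kc KC cC muC /andP[etal etau] zle yle.
have k0 : 0 < C4 ^+ 2 by rewrite exprn_gt0.
have wl : 1 <= 96 * C4 ^+ 2 * (eta * n / sg).
  have E : 96 * C4 ^+ 2 *
      (125 / 1000 * (n / (12 * sg)) * (C4 * n * sg^-1) ^- 2 * n / sg) = 1.
    by field; rewrite !gt_eqF.
  rewrite -[leLHS]E ler_pM2l ?mulr_gt0// ler_pM2r ?invr_gt0//.
  by rewrite ler_pM2r.
have wu : 16 * C4 ^+ 2 * (eta * n / sg) <= 1.
  have E : 16 * C4 ^+ 2 *
      (75 / 100 * (n / (12 * sg)) * (C4 * n * sg^-1) ^- 2 * n / sg) = 1.
    by field; rewrite !gt_eqF.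
  rewrite -[leRHS]E ler_pM2l ?mulr_gt0// ler_pM2r ?invr_gt0//.
  by rewrite ler_pM2r.
have Dsr : D / sr <= c by rewrite ler_pdivrMr.
have Dsr0 : 0 <= D / sr by rewrite divr_ge0// ltW.
have z1 : z ^+ 2 <= D ^+ 2 * (1 - mu / (192 * C4 ^+ 2)).
  apply: le_trans zle _.
  have -> : D ^+ 2
    - 2 * eta * (mu * n * D ^+ 2 / sg - K * n * D / sg * (D ^+ 2 / sr))
    + eta ^+ 2 * (K * n * D / sg) ^+ 2 =
    D ^+ 2 * (1 - 2 * (eta * n / sg) * (mu - K * (D / sr))
              + (eta * n / sg) * ((eta * n / sg) * K ^+ 2)).
    by field; rewrite !gt_eqF.
  rewrite ler_wpM2l ?sqr_ge0//.
  exact: (phase_two_quad Dsr0 Dsr mu0 K0 k0 Kc KC wl wu).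
have zD : z <= D.
  rewrite -ler_sqr ?nnegrE//; apply: le_trans z1 _; rewrite ler_piMr ?sqr_ge0//.
  by rewrite gerBl divr_ge0 ?(ltW mu0)// mulr_ge0// ltW.
apply: (phase_two_contract k0 mu0 muC D0 y0 z1 _ yle); apply: le_trans cC.
rewrite ler_pM2l// ler_sqr ?nnegrE ?(ltW c0) ?divr_ge0 ?(ltW sr0)//.
by apply: le_trans Dsr; rewrite ler_pM2r ?invr_gt0.
Qed.

End Stepsizes.

(** * Deterministic dynamics under the landscape bounds *)

Section Dynamics.
Context {R : realType} {d1 d2 : nat}.
Variables (r : nat) (f : 'M[R]_(d1, d2) -> R) (Mstar : 'M[R]_(d1, d2)).
Variables (n sr sg tau mu K C4 c : R).
Variables (M : nat -> 'M[R]_(d1, d2)) (eta : nat -> R).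

Let D l := frob (M l - Mstar).

Hypotheses (n0 : 0 < n) (sr0 : 0 < sr) (sg0 : 0 < sg) (mu0 : 0 < mu) (K0 : 0 < K)
  (C40 : 0 < C4) (c01 : 0 < c <= 1 / 100 / 100).
Hypotheses (Kc : K * c <= mu / 2) (KC : K ^+ 2 <= 8 * mu * C4 ^+ 2)
  (cC : 16 * c ^+ 2 <= mu / (384 * C4 ^+ 2)) (muC : mu <= 192 * C4 ^+ 2).
Hypothesis tau0 : 0 < tau.
Hypotheses (rkM : (\rank Mstar <= r)%N)
  (hsr : smallest_nonzero_singular_value Mstar sr).

Hypothesis f_lip : forall A N, (\rank N <= 4 * r)%N ->
  f (A + N) - f A <= 14 / 10 * n * frob N.
Hypothesis f_far : forall A, (\rank A <= r)%N -> sg <= frob (A - Mstar) ->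
  22 / 1000 * n * frob (A - Mstar) <= f A - f Mstar.
Hypothesis f_near : forall A, (\rank A <= r)%N -> tau <= frob (A - Mstar) < sg ->
  mu * n * frob (A - Mstar) ^+ 2 / sg <= f A - f Mstar.
Hypothesis f_upper : forall B d, (\rank (B - Mstar)%R <= 4 * r)%N ->
  tau <= d < sg -> frob (B - Mstar) <= 2 * d -> f B - f Mstar <= K * n * d ^+ 2 / sg.

Hypothesis run : rsgrad_run r f eta M.
Hypothesis init : D 0 <= c * sr.
Hypothesis sched : two_phase_schedule sg tau (n / 12) (n / (12 * sg)) (2 * n)
  (C4 * n * sg^-1) D eta.

Let q : R := 1 / 144 / 100.
Let c3 : R := mu / (768 * C4 ^+ 2).

Lemma subgrad_le (F : 'M[R]_(d1, d2) -> R) A G N t L : 0 < t ->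
  subdifferential F A G -> F (A + t *: N) - F A <= t * L -> inner G N <= L.
Proof.
move=> t0 sub FL; rewrite -(ler_pM2l t0) -innerZr.
have := sub (A + t *: N); rewrite [A + _ - A]addrAC subrr add0r; lra.
Qed.

Lemma iterate_rank l : (\rank (M l) <= r)%N.
Proof. by case: l => [|l]; [case: run|have [_ /(_ l)[G[U[s[V[_ _ []]]]]]] := run]. Qed.

Lemma phase_one_step l : D l <= (1 - q) ^+ l * D 0 -> sg <= D l ->
  D l.+1 <= (1 - q) ^+ l.+1 * D 0.
Proof.
move=> Dl sgD.
have q01 : 0 <= 1 - q <= 1 by rewrite /q; lra.
have pow1 : (1 - q) ^+ l <= 1 by case/andP: q01 => ? ?; exact: exprn_ile1.
have pow0 : 0 <= (1 - q) ^+ l by case/andP: q01 => ? ?; exact: exprn_ge0.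
have D00 : 0 <= D 0 by exact: frob_ge0.
have sgD0 : sg <= D 0 by apply: le_trans sgD _; apply: le_trans Dl _; rewrite ler_piMl.
have [G [U [s [V [sub svd app]]]]] := run.2 l.
(* The thin SVD of the new iterate is the one used by the next step of the run. *)
have [G' [U' [s' [V' [_ svd' _]]]]] := run.2 l.+1.
have [/(_ sgD0)/andP[etal etau] /(_ l)[/(_ sgD) etaE _]] := sched.
(* The stepsize decays exactly like the bound [e] on the distance, so their ratio stays in the same
   range at every iteration. *)
have qE : 1 - 4 / 100 * (n / 12) ^+ 2 * (2 * n) ^- 2 = 1 - q.
  by rewrite /q; field; rewrite gt_eqF.
rewrite qE in etaE.
set e := (1 - q) ^+ l * D 0.
have e0 : 0 <= e by rewrite mulr_ge0.
have eta_rng : 2 / 10 * e * (n / 12) * (2 * n) ^- 2 <= eta l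
    <= 3 / 10 * e * (n / 12) * (2 * n) ^- 2.
  rewrite etaE /e; apply/andP; split.
    by have := ler_wpM2l pow0 etal; apply: le_trans; rewrite le_eqVlt; apply/orP; left; apply/eqP; ring.
  by have := ler_wpM2l pow0 etau => /le_trans; apply; rewrite le_eqVlt; apply/orP; left; apply/eqP; ring.
have eta0 : 0 <= eta l.
  have n12 : 0 <= n / 12 by rewrite divr_ge0// ltW.
  apply: le_trans (andP eta_rng).1; rewrite mulr_ge0 ?invr_ge0 ?exprn_ge0//.
    by rewrite mulr_ge0// mulr_ge0// divr_ge0.
  by rewrite mulr_ge0// ltW.
have GL N : (\rank N <= 2 * r)%N -> inner G N <= 14 / 10 * n * frob N.
  move=> rkN; apply: (@subgrad_le f (M l) G N 1) => //; rewrite mul1r scale1r.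
  by apply: f_lip; apply: leq_trans rkN _; rewrite leq_mul2r orbT.
have L0 : 0 <= 14 / 10 * n by move: (n0); lra.
have step := rsgrad_descent rkM hsr sr0 eta0 sub svd GL L0.
have trunc := svd_truncation_le rkM hsr sr0 app svd'.
have -> : (1 - q) ^+ l.+1 * D 0 = (1 - q) * e by rewrite exprS mulrA.
apply: (phase_one_arith n0 _ Dl sr0 _ _ c01 _ eta_rng _ trunc) => //.
- exact: frob_ge0.
- by apply: le_trans init; rewrite ler_piMl.
- apply: le_trans step _; rewrite lerD2r lerD2l lerN2.
  by rewrite ler_wpM2l ?mulr_ge0// lerD2r; apply: f_far; first exact: iterate_rank.
Qed.

Lemma phase_two_step l : D l <= D 0 -> tau <= D l < sg -> D l.+1 <= (1 - c3) * D l.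
Proof.
move=> DD tsg; have /andP[tD Dsg] := tsg.
have Dp : 0 < D l by exact: lt_le_trans tD.
have [G [U [s [V [sub svd app]]]]] := run.2 l.
have [G' [U' [s' [V' [_ svd' _]]]]] := run.2 l.+1.
have [_ /(_ l)[_ /(_ tsg) eta_rng]] := sched.
have eta0 : 0 <= eta l.
  have n12 : 0 <= n / (12 * sg) by rewrite divr_ge0 ?mulr_ge0// ltW.
  have Cn : 0 <= C4 * n * sg^-1 by rewrite ltW// divr_gt0// mulr_gt0.
  have {}Cn : 0 <= (C4 * n * sg^-1) ^- 2 by rewrite invr_ge0 exprn_ge0.
  have h : 0 <= 125 / 1000 :> R by rewrite divr_ge0 ?ler0n.
  have /andP[+ _] := eta_rng; apply: le_trans.
  exact: mulr_ge0 (mulr_ge0 h n12) Cn.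
have L0 : 0 <= K * n * D l / sg by rewrite ltW// divr_gt0// !mulr_gt0.
have fge : mu * n * D l ^+ 2 / sg <= f (M l) - f Mstar.
  by apply: f_near => //; exact: iterate_rank.
have GL N : (\rank N <= 2 * r)%N -> inner G N <= K * n * D l / sg * frob N.
  move=> rkN; have [N0|N0] := eqVneq (frob N) 0.
    by rewrite (frob_eq0 N0) inner0r frob0 mulr0.
  have Np : 0 < frob N by rewrite lt0r N0 frob_ge0.
  (* A move of length [D l] along [N] stays within [2 * D l] of [Mstar], where [f_upper] applies;
     this makes the subgradient bound proportional to [D l]. The rank is at most [r + r + 2 r]. *)
  apply: (@subgrad_le f (M l) G N (D l / frob N)) => //; first by rewrite divr_gt0.
  have up : f (M l + (D l / frob N) *: N) - f Mstar <= K * n * D l ^+ 2 / sg.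
    apply: f_upper => //.
      have -> : M l + (D l / frob N) *: N - Mstar = M l - Mstar + (D l / frob N) *: N.
        by rewrite addrAC.
      apply: leq_trans (_ : r + r + 2 * r <= _)%N; last by rewrite addnn -mul2n -mulnDl.
      apply: rankD_leq; last exact: rankZ_leq.
      by apply: rankB_leq => //; exact: iterate_rank.
    rewrite addrAC; apply: le_trans (frobD _ _) _.
    by rewrite frobZ ger0_norm ?divr_ge0 ?frob_ge0// divfK// -/(D l) mulr_natl mulr2n.
  have -> : D l / frob N * (K * n * D l / sg * frob N) = K * n * D l ^+ 2 / sg.
    by field; rewrite N0 gt_eqF.
  have : 0 <= mu * n * D l ^+ 2 / sg by rewrite ltW// divr_gt0// !mulr_gt0// exprn_gt0.
  lra.
have step := rsgrad_descent rkM hsr sr0 eta0 sub svd GL L0.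
have trunc := svd_truncation_le rkM hsr sr0 app svd'.
have /andP[c0 _] := c01.
apply: (phase_two_arith n0 (ltW Dp) sr0 _ _ c0 sg0 mu0 K0 C40 _ Kc KC cC muC eta_rng _ trunc) => //.
- exact: le_trans init.
- apply: le_trans step _; rewrite lerD2r lerD2l lerN2.
  by rewrite ler_wpM2l ?mulr_ge0// lerD2r.
Qed.

Lemma c3_ge0_le1 : 0 < c3 < 1.
Proof.
have p := exprn_gt0 2 C40.
have k0 : 0 < 768 * C4 ^+ 2 by move: p; lra.
rewrite /c3; apply/andP; split; first exact: divr_gt0.
by rewrite (ltr_pdivrMr _ _ k0); move: (muC) p; lra.
Qed.

(** The run may enter the ball of radius [sg] before the geometric bound predicts it. From then on
    phase two keeps it there; until then the geometric bound holds. *)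
Lemma iterate_invariant l : scheduled tau D l ->
  D l <= D 0 /\ (D l < sg \/ D l <= (1 - q) ^+ l * D 0).
Proof.
have q01 : 0 <= 1 - q <= 1 by rewrite /q; lra.
elim: l => [_|l IH sc]; first by split=> //; right; rewrite expr0 mul1r.
have [DD inv] : D l <= D 0 /\ (D l < sg \/ D l <= (1 - q) ^+ l * D 0).
  by apply: IH => k kl; apply: sc; exact: ltnW.
have [Dsg|sgD] := ltP (D l) sg.
  have := @phase_two_step l DD; rewrite Dsg (sc l (ltnSn _)) => /(_ isT) H.
  have Dl0 : 0 <= D l by exact: frob_ge0.
  have HH : D l.+1 <= D l by apply: le_trans H _; rewrite ler_piMl//; have := c3_ge0_le1; lra.
  by split; [exact: le_trans DD|left; exact: le_lt_trans Dsg].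
have /phase_one_step/(_ sgD) H : D l <= (1 - q) ^+ l * D 0.
  by case: inv => //; rewrite ltNge sgD.
split; last by right.
apply: le_trans H _; rewrite ler_piMl ?frob_ge0//.
by case/andP: q01 => ? ?; exact: exprn_ile1.
Qed.

Lemma phase_one l : scheduled tau D l -> sg <= D l ->
  D l.+1 <= (1 - q) ^+ l.+1 * D 0.
Proof.
move=> /iterate_invariant[_ inv] sgD; apply: phase_one_step => //.
by case: inv => //; rewrite ltNge sgD.
Qed.

Lemma phase_two l : scheduled tau D l -> tau <= D l < sg -> D l.+1 <= (1 - c3) * D l.
Proof. by move=> /iterate_invariant[DD _]; exact: phase_two_step. Qed.

Lemma phase_two_iter m k : scheduled tau D (m + k) -> D m < sg ->
  D (m + k)%N < sg /\ D (m + k)%N <= (1 - c3) ^+ k * sg.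
Proof.
move=> + Dm; elim: k => [|k IH] sc.
  by rewrite addn0 expr0 mul1r; split=> //; exact: ltW.
have sc' : scheduled tau D (m + k).
  by move=> i ik; apply: sc; rewrite addnS; exact: ltnW.
have [Dsg Dk] := IH sc'.
rewrite addnS; have := @phase_two _ sc'.
rewrite Dsg (sc (m + k)%N) ?addnS// => /(_ isT) H.
have c3b := c3_ge0_le1; have Dl0 : 0 <= D (m + k)%N by exact: frob_ge0.
split.
  by apply: le_lt_trans Dsg; apply: le_trans H _; rewrite ler_piMl//; lra.
by apply: le_trans H _; rewrite exprS -mulrA ler_wpM2l//; lra.
Qed.

End Dynamics.

(** * Covering numbers of low-rank matrices *)

Section Nets.
Context {R : realType}.
Implicit Types (m n p q r : nat) (e : R).

Lemma sum_expRN_sqr_le B : \sum_(k < B) expR (- (k%:R ^+ 2)) <= 2 :> R.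
Proof.
apply: (@le_trans _ _ (\sum_(k < B) (1 / 2) ^+ k)).
  apply: ler_sum => -[k _] _ /=.
  apply: (@le_trans _ _ (expR (k%:R * (-1)))).
    rewrite ler_expR mulrN1 lerN2 -natrX ler_nat; case: k => // k.
    by rewrite expnS expn1 leq_pmulr.
  rewrite expRM_natl lerXn2r ?nnegrE ?expR_ge0 ?divr_ge0// expRN div1r.
  by rewrite lef_pV2 ?posrE ?expR_gt0//; have := expR_ge1Dx (1 : R); lra.
suff -> : \sum_(k < B) (1 / 2) ^+ k = 2 - 2 * (1 / 2) ^+ B :> R.
  by rewrite gerBl mulr_ge0// exprn_ge0// divr_ge0.
by elim: B => [|B IH]; rewrite ?big_ord0 ?expr0 ?big_ord_recr ?IH /= ?exprS; lra.
Qed.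

Definition grid_mx p q (B : nat) (d : R) (t : {ffun 'I_p * 'I_q -> bool * 'I_B}) :
    'M[R]_(p, q) := \matrix_(i, j) ((-1) ^+ (t (i, j)).1 * ((t (i, j)).2%:R * d)).

Lemma grid_mx_sqr p q B d (t : {ffun 'I_p * 'I_q -> bool * 'I_B}) :
  frob (grid_mx d t) ^+ 2 = d ^+ 2 * \sum_k (t k).2%:R ^+ 2.
Proof.
rewrite frob_sqr innerE pair_big mulr_sumr; apply: eq_bigr => -[i j] _ /=.
by rewrite !mxE -expr2 exprMn sqrr_sign mul1r exprMn mulrC.
Qed.

(** An exponential Markov bound for counting: a counted point has weight at least 1 in
    [exp (x - sum of squares)], and the total weight factors over the coordinates, each contributing
    at most [2 * 2] (sign times magnitude). *)
Lemma card_grid_le (T : finType) (B : nat) (x : R) :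
  #|[pred t : {ffun T -> bool * 'I_B} | \sum_k (t k).2%:R ^+ 2 <= x]|%:R
    <= expR x * 4 ^+ #|T|.
Proof.
apply: (@le_trans _ _ (\sum_(t : {ffun T -> bool * 'I_B})
    expR (x - \sum_k (t k).2%:R ^+ 2))).
  rewrite -sum1_card natr_sum big_mkcond /=; apply: ler_sum => t _.
  case: ifPn => [|_]; last exact: expR_ge0.
  by rewrite inE => tx; rewrite -[leLHS]expR0 ler_expR subr_ge0.
under eq_bigr do rewrite expRD -sumrN expR_sum.
rewrite -mulr_sumr ler_wpM2l ?expR_ge0//.
rewrite -(bigA_distr_bigA (fun=> fun k : bool * 'I_B => expR (- (k.2%:R ^+ 2)))) /=.
rewrite prodr_const lerXn2r ?nnegrE ?cardT//.
  by apply: sumr_ge0 => ? _; exact: expR_ge0.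
have -> : \sum_(j : bool * 'I_B) expR (- (j.2%:R ^+ 2)) =
    \sum_(b : bool) \sum_(k < B) expR (- (k%:R ^+ 2)) :> R by rewrite pair_big.
rewrite big_bool /=; have := sum_expRN_sqr_le B; lra.
Qed.

(* Grid points of mesh e / sqrt (p q) in the unit ball; their number is only
   exponential in p q because the grid vectors have squared integer norm at most
   p q / e^2. *)
Lemma ball_net p q e : (0 < p)%N -> (0 < q)%N -> 0 < e -> exists s : seq 'M[R]_(p, q),
  [/\ (size s)%:R <= expR ((2 + e ^- 2) * (p * q)%:R),
      (forall A, A \in s -> frob A <= 1) &
      forall A, frob A <= 1 -> exists2 A', A' \in s & frob (A - A') <= e].
Proof.
move=> p0 q0 e0.
pose m : R := (p * q)%:R; have m0 : 0 < m by rewrite ltr0n muln_gt0 p0.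
pose d := e / Num.sqrt m; have d0 : 0 < d by rewrite divr_gt0 ?sqrtr_gt0.
have dm : d ^+ 2 * m = e ^+ 2.
  by rewrite exprMn exprVn sqr_sqrtr ?(ltW m0)// divfK// gt_eqF.
pose B := (Num.truncn d^-1).+1.
have e4 : 4 <= expR 2 :> R.
  have -> : 2 = 2%:R * 1 :> R by rewrite mulr1.
  by rewrite expRM_natl expr2; have := expR_ge1Dx (1 : R); nra.
pose ok := [pred t : {ffun 'I_p * 'I_q -> bool * 'I_B} |
  \sum_k (t k).2%:R ^+ 2 <= m * e ^- 2].
exists [seq grid_mx d t | t in ok]; split.
- rewrite size_image; apply: (le_trans (card_grid_le ('I_p * 'I_q)%type B (m * e ^- 2))).
  rewrite card_prod !card_ord mulrDl expRD mulrC [m * _]mulrC ler_pM2r ?expR_gt0//.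
  rewrite mulrC expRM_natl lerXn2r ?nnegrE ?expR_ge0//.
- move=> A /mapP[t]; rewrite mem_enum inE => tm ->.
  rewrite -ler_sqr ?nnegrE// expr1n grid_mx_sqr.
  apply: le_trans (ler_wpM2l (sqr_ge0 d) tm) _.
  by rewrite mulrA dm divff// expf_neq0// gt_eqF.
move=> A A1.
have Aij i j : `|A i j| <= 1.
  rewrite -ler_sqr ?nnegrE// real_normK ?num_real//; apply: le_trans (_ : frob A ^+ 2 <= _).
    rewrite frob_sqr innerE (bigD1 i)//= (bigD1 j)//= -expr2 -addrA lerDl addr_ge0//.
      by apply: sumr_ge0 => k _; rewrite -expr2 sqr_ge0.
    by do 2!apply: sumr_ge0 => ? _; rewrite -expr2 sqr_ge0.
  by rewrite ler_sqr ?nnegrE.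
(* Rounding is towards zero: no entry grows, so the grid point stays in the unit ball. *)
pose k i j := Num.truncn (`|A i j| / d).
have kB i j : (k i j < B)%N.
  rewrite ltnS; apply: le_truncn; rewrite -[leRHS]mul1r ler_pM2r ?invr_gt0//.
have kle i j : (k i j)%:R * d <= `|A i j|.
  by rewrite -ler_pdivlMr// truncn_le divr_ge0// ltW.
have kge i j : `|A i j| - (k i j)%:R * d <= d.
  rewrite lerBlDr -[X in X + _]mul1r -mulrDl -ler_pdivrMr//.
  by rewrite addrC natr1 ltW// truncnS_gt.
pose t : {ffun 'I_p * 'I_q -> bool * 'I_B} :=
  [ffun ij => (A ij.1 ij.2 < 0, Ordinal (kB ij.1 ij.2))].
exists (grid_mx d t).
  apply: map_f; rewrite mem_enum inE -(ler_pM2l (exprn_gt0 2 d0)) mulrA dm.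
  rewrite divff ?expf_neq0 ?gt_eqF// -grid_mx_sqr.
  apply: le_trans (_ : frob A ^+ 2 <= 1); last by rewrite -(expr1n _ 2) ler_sqr ?nnegrE.
  rewrite !frob_sqr !innerE; apply: ler_sum => i _; apply: ler_sum => j _.
  rewrite !mxE !ffunE /= -!expr2 exprMn sqrr_sign mul1r -[leRHS]real_normK ?num_real//.
  by rewrite ler_sqr ?nnegrE// mulr_ge0// ltW.
rewrite -ler_sqr ?nnegrE ?(ltW e0)// frob_sqr innerE.
apply: (@le_trans _ _ (\sum_(i < p) \sum_(j < q) d ^+ 2)).
  apply: ler_sum => i _; apply: ler_sum => j _.
  rewrite !mxE !ffunE /= -expr2 -[leLHS]real_normK ?num_real// ler_sqr ?nnegrE ?(ltW d0)//.
  have -> : A i j - (-1) ^+ (A i j < 0)%R * ((k i j)%:R * d) =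
     (-1) ^+ (A i j < 0)%R * (`|A i j| - (k i j)%:R * d).
    by rewrite mulrBr -numEsign.
  by rewrite normrMsign ger0_norm ?subr_ge0.
by rewrite !sumr_const !card_ord -mulrnA -mulr_natr mulnC -/m dm.
Qed.

Lemma factor_rank m n r (N : 'M[R]_(m, n)) : (\rank N <= r)%N ->
  exists C : 'M[R]_(m, r), exists D : 'M[R]_(r, n), N = C *m D.
Proof.
move=> rk; exists (col_base N *m pid_mx (\rank N)), (pid_mx (\rank N) *m row_base N).
rewrite -mulmxA (mulmxA (pid_mx _)) pid_mx_id// pid_mx_1 mul1mx.
by rewrite mulmx_base.
Qed.

(* Rounding N V, where V is an orthonormal basis of the row space of N, already
   determines an approximate column space; projecting N onto it and rounding
   the coordinates never multiplies two rounding errors, which is why Frobenius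
   nets of the two factors suffice. *)
Lemma low_rank_net m n r e : (0 < m)%N -> (0 < n)%N -> (0 < r)%N -> 0 < e <= 1 ->
  exists s : seq 'M[R]_(m, n),
  [/\ (size s)%:R <= expR ((2 + (e / 4) ^- 2) * (r * (m + n))%:R),
      (forall N, N \in s -> (\rank N <= r)%N /\ frob N = 1) &
      forall N, (\rank N <= r)%N -> frob N = 1 ->
        exists2 N', N' \in s & frob (N - N') <= e].
Proof.
move=> m0 n0 r0 /andP[e0 e1]; have e40 : 0 < e / 4 by rewrite divr_gt0.
have [s1 [sz1 _ net1]] := ball_net m0 r0 e40.
have [s2 [sz2 ball2 net2]] := ball_net r0 n0 e40.
pose Qf (A : 'M[R]_(m, r)) := projT1 (cid (orth_basis A)).
have QfP A : Qf A *m (Qf A)^T *m A = A /\ Qf A *m (Qf A)^T *m Qf A = Qf A.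
  exact: projT2 (cid (orth_basis A)).
pose s0 := [seq Qf A *m B | A <- s1, B <- s2].
(* Normalising is cheap: for the product approximating a unit matrix the norm lies between
   [1 - e / 2] and 1, so this moves it by at most [e / 2]. *)
exists [seq (frob N)^-1 *: N | N <- s0 & frob N != 0]; split.
- rewrite size_map; apply: (@le_trans _ _ (size s0)%:R).
    by rewrite ler_nat size_filter count_size.
  rewrite /s0 size_allpairs natrM mulnDr natrD mulrDr expRD (mulnC r m).
  by apply: ler_pM.
- move=> _ /mapP[N + ->]; rewrite mem_filter => /andP[N0 /allpairsP[[A B] [As Bs NE]]].
  split.
    by apply: rankZ_leq; rewrite NE; exact: leq_trans (mxrankM_maxl _ _) (rank_leq_col _).
  by rewrite frobZ ger0_norm ?invr_ge0// mulVf.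
move=> N rkN N1.
have [C [D ND]] := factor_rank rkN.
have [V [VD VV]] := orth_basis D^T.
have NV : N *m (V *m V^T) = N.
  rewrite ND -mulmxA; congr (_ *m _).
  by apply: trmx_inj; rewrite !trmx_mul trmxK.
have [|A As Ae] := net1 (N *m V); first by rewrite -N1; exact: frob_isom_r.
have [QA QQ] := QfP A; set Q := Qf A in QA QQ.
have [|B Bs Be] := net2 (Q^T *m N); first by rewrite -N1; exact: frob_isom_tr.
have Pt : (Q *m Q^T)^T = Q *m Q^T by exact: col_proj_sym.
have PP : (Q *m Q^T) *m (Q *m Q^T) = Q *m Q^T by rewrite mulmxA QQ.
(* [1 - Q Q^T] kills [A], so only the rounding error [N V - A] survives outside the approximate
   column space. *)
have d1 : frob (N - Q *m Q^T *m N) <= e / 4.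
  have -> : N - Q *m Q^T *m N = (1%:M - Q *m Q^T) *m ((N *m V - A) *m V^T).
    have PA : (1%:M - Q *m Q^T) *m A = 0 by rewrite mulmxBl mul1mx QA subrr.
    rewrite mulmxA (mulmxBr _ (N *m V) A) PA subr0 -(mulmxA _ (N *m V)).
    by rewrite -(mulmxA N) NV mulmxBl mul1mx.
  have [Pt' PP'] := compl_orth_proj Pt PP.
  apply: le_trans (frob_isom _ (orth_proj_isom Pt' PP')) _.
  by apply: le_trans Ae; exact: frob_isom_tr_r.
have d2 : frob (Q *m Q^T *m N - Q *m B) <= e / 4.
  rewrite -mulmxA -mulmxBr; apply: le_trans Be; exact: frob_isom.
have d3 : frob (N - Q *m B) <= e / 2.
  rewrite -(subrKA (Q *m Q^T *m N)); apply: le_trans (frobD _ _) _; lra.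
have QBs : Q *m B \in s0 by apply/allpairsP; exists (A, B).
have QBl : frob (Q *m B) <= 1.
  by apply: le_trans (ball2 _ Bs); exact: frob_isom.
have QBg : 1 - e / 2 <= frob (Q *m B).
  have := frobD (N - Q *m B) (Q *m B); rewrite subrK N1; lra.
have QB0 : frob (Q *m B) != 0 by rewrite gt_eqF//; lra.
exists ((frob (Q *m B))^-1 *: (Q *m B)).
  by apply/mapP; exists (Q *m B) => //; rewrite mem_filter QB0.
rewrite -(subrKA (Q *m B)); apply: le_trans (frobD _ _) _.
have -> : Q *m B - (frob (Q *m B))^-1 *: (Q *m B) = (1 - (frob (Q *m B))^-1) *: (Q *m B).
  by rewrite scalerBl scale1r.
rewrite frobZ -[X in `|_| * X]ger0_norm// -normrM mulrBl mul1r mulVf//.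
by rewrite ler0_norm ?subr_le0//; lra.
Qed.

(** A plain difference has rank up to [2 r]. Projecting it onto the column space of [N'], and onto
    the complement, where [N'] disappears, gives rank at most [r] twice without increasing the
    norm. *)
Lemma low_rank_split m n r (N N' : 'M[R]_(m, n)) :
  (\rank N <= r)%N -> (\rank N' <= r)%N -> exists E1 E2 : 'M[R]_(m, n),
  [/\ N = N' + E1 + E2, (\rank E1 <= r)%N, (\rank E2 <= r)%N,
      frob E1 <= frob (N - N') & frob E2 <= frob (N - N')].
Proof.
move=> rkN rkN'.
have [Q [QN QQ]] := orth_basis (col_base N').
have QN' : Q *m Q^T *m N' = N'.
  by have /= := congr1 (fun Z => Z *m row_base N') QN; rewrite -(mulmxA (Q *m Q^T)) mulmx_base.
have Pt : (Q *m Q^T)^T = Q *m Q^T by exact: col_proj_sym.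
have PP : (Q *m Q^T) *m (Q *m Q^T) = Q *m Q^T by rewrite mulmxA QQ.
have [Pt' PP'] := compl_orth_proj Pt PP.
exists (Q *m Q^T *m (N - N')), ((1%:M - Q *m Q^T) *m (N - N')); split.
- by rewrite -addrA -mulmxDl [Q *m _ + _]addrC subrK mul1mx addrC subrK.
- rewrite -mulmxA; apply: leq_trans (mxrankM_maxl _ _) _.
  exact: leq_trans (rank_leq_col _) _.
- rewrite mulmxBr (_ : _ *m N' = 0) ?subr0; last by rewrite mulmxBl mul1mx QN' subrr.
  exact: leq_trans (mxrankM_maxr _ _) rkN.
- by apply: frob_isom; exact: orth_proj_isom.
- by apply: frob_isom; exact: orth_proj_isom.
Qed.

(* The supremum of W over low-rank matrices is controlled by its values on the
   net: N - N' splits into two matrices of rank at most r. *)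
Lemma net_dual m n r e (s : seq 'M[R]_(m, n)) (W : 'M[R]_(m, n)) b :
  0 < e < 1 / 2 -> 0 <= b ->
  (forall N, N \in s -> (\rank N <= r)%N) ->
  (forall N, (\rank N <= r)%N -> frob N = 1 ->
     exists2 N', N' \in s & frob (N - N') <= e) ->
  (forall N, N \in s -> inner W N <= b) ->
  forall N, (\rank N <= r)%N -> (1 - 2 * e) * inner W N <= b * frob N.
Proof.
move=> /andP[e0 e12] b0 srk net Wb.
(* The supremum [S] over the unit ball of rank at most [r] is finite by Cauchy-Schwarz and satisfies
   [S <= b + 2 e S]. *)
pose A := [set x | exists N, [/\ (\rank N <= r)%N, frob N <= 1 & x = inner W N]].
have A0 : A 0 by exists 0; rewrite mxrank0 frob0 inner0r.
have ubA : ubound A (frob W).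
  move=> _ [N [_ N1 ->]]; apply: le_trans (cauchy_schwarz _ _) _.
  by rewrite ler_piMr.
have AS x : A x -> x <= sup A by apply: ub_le_sup; exists (frob W).
have S0 : 0 <= sup A by exact: AS.
have scale N : (\rank N <= r)%N -> frob N <= e -> inner W N <= e * sup A.
  move=> rkN Ne; rewrite -ler_pdivrMl// -innerZr; apply: AS; exists (e^-1 *: N).
  split=> //; first exact: rankZ_leq.
  by rewrite frobZ ger0_norm ?invr_ge0 ?(ltW e0)// ler_pdivrMl// mulr1.
have unit N : (\rank N <= r)%N -> frob N = 1 -> inner W N <= b + 2 * e * sup A.
  move=> rkN N1; have [N' sN' Ne] := net _ rkN N1.
  have [E1 [E2 [NE rk1 rk2 E1e E2e]]] := low_rank_split rkN (srk _ sN').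
  rewrite NE !innerDr -addrA; apply: lerD; first exact: Wb.
  rewrite -mulrA mulr_natl mulr2n.
  by apply: lerD; apply: scale => //; [exact: le_trans E1e Ne|exact: le_trans E2e Ne].
have gen N : (\rank N <= r)%N -> inner W N <= frob N * (b + 2 * e * sup A).
  move=> rkN; have [N0|N0] := eqVneq (frob N) 0.
    by rewrite (frob_eq0 N0) inner0r frob0 mul0r.
  rewrite -ler_pdivrMl ?lt0r ?N0 ?frob_ge0// -innerZr; apply: unit.
    exact: rankZ_leq.
  by rewrite frobZ ger0_norm ?invr_ge0// mulVf.
have c0 : 0 <= b + 2 * e * sup A by rewrite addr_ge0// !mulr_ge0// ltW.
have Sle : sup A <= b + 2 * e * sup A.
  apply: ge_sup; first by exists 0.
  move=> _ [N [rkN N1 ->]]; apply: le_trans (gen _ rkN) _.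
  by rewrite ler_piMl.
move=> N rkN.
have e20 : 0 < 1 - 2 * e by move: e0; lra.
apply: le_trans (ler_wpM2l (ltW e20) (gen _ rkN)) _.
rewrite mulrCA mulrC ler_wpM2r//.
have : (1 - 2 * e) * sup A <= b by move: Sle; lra.
move: e0 => /ltW e0 /(ler_wpM2l e0); lra.
Qed.

End Nets.

(** * Integration against an image measure with density *)

Section Density.
Context {R : realType} {d d' : measure_display}
  {T : measurableType d} {T' : measurableType d'}.
Variables (mu : {measure set T -> \bar R}) (nu : {measure set T' -> \bar R}).
Variables (g : T -> R) (Z : T -> T').
Hypotheses (mg : measurable_fun setT g) (g0 : forall w, 0 <= g w)
  (mZ : measurable_fun setT Z).
Hypothesis nuE : forall B, measurable B ->
  nu B = (\int[mu]_w (g w * \1_B (Z w))%:E)%E.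

Import HBNNSimple.

Let ge0_integral_density_nnsfun (h : {nnsfun T' >-> R}) :
  (\int[nu]_y (h y)%:E = \int[mu]_w (g w * h (Z w))%:E)%E.
Proof.
have mI B : measurable B -> measurable_fun setT (fun w => \1_B (Z w) : R).
  by move=> mB; exact: measurableT_comp (measurable_indic mB) mZ.
have mh r : measurable (h @^-1` [set r]) by exact: measurable_sfunP.
under [LHS]eq_integral do rewrite fimfunEord -sumEFin.
rewrite ge0_integral_sum//; last 2 first.
  - by move=> i; apply/measurable_EFinP; apply: measurable_funM.
  - move=> i y _; rewrite EFinM; apply: nnfun_muleindic_ge0.
under [RHS]eq_integral do rewrite fimfunEord mulr_sumr -sumEFin.
rewrite [RHS]ge0_integral_sum//; last 2 first.
  - move=> i; apply/measurable_EFinP; apply: measurable_funM => //.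
    by apply: measurable_funM => //; exact: mI.
  - move=> i w _; rewrite lee_fin mulr_ge0// -lee_fin EFinM.
    exact: nnfun_muleindic_ge0.
apply: eq_bigr => i _; set r := _`_i; set A := h @^-1` [set r].
have [r0|r0] := leP 0 r; last first.
  have A0 : A = set0.
    by apply/seteqP; split=> // y /= hy; move: r0; rewrite -hy ltNge fun_ge0.
  rewrite A0; under eq_integral do rewrite indic0 mulr0.
  under [RHS]eq_integral do rewrite indic0 !mulr0.
  by rewrite !integral0.
have mA : measurable A by exact: measurable_sfunP.
under eq_integral do rewrite EFinM.
rewrite ge0_integralZl_EFin//; last first.
  exact/measurable_EFinP.
rewrite integral_indic// setIT nuE//.
under [RHS]eq_integral do rewrite mulrCA EFinM.
rewrite ge0_integralZl_EFin//.
- by move=> w _; rewrite lee_fin mulr_ge0.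
- apply/measurable_EFinP; apply: measurable_funM => //.
  exact: mI.
Qed.

(** Serves for the law of one variable weighted by a product of the others, and for the normal
    density, both under the law of a variable and under [normal_prob]. *)
Lemma ge0_integral_density (f : T' -> R) : measurable_fun setT f ->
  (forall y, 0 <= f y) -> (\int[nu]_y (f y)%:E = \int[mu]_w (g w * f (Z w))%:E)%E.
Proof.
move=> mf f0; have mf' : measurable_fun setT (EFin \o f) by exact/measurable_EFinP.
pose f_ := nnsfun_approx measurableT mf'.
have cvgf y : (f_ n y)%:E @[n --> \oo] --> (f y)%:E.
  by apply: cvg_nnsfun_approx => // x _; rewrite lee_fin.
transitivity (limn (fun n => \int[nu]_y (f_ n y)%:E))%E.
  rewrite -monotone_convergence//=.
  - by apply: eq_integral => y _; apply/esym/cvg_lim => //; exact: cvgf.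
  - by move=> n; exact/measurable_EFinP.
  - by move=> n y _; rewrite lee_fin.
  - by move=> y _ a b ab; rewrite lee_fin; exact/lefP/nd_nnsfun_approx.
transitivity (limn (fun n => \int[mu]_w (g w * f_ n (Z w))%:E))%E.
  by congr (limn _); apply/funext => n; exact: ge0_integral_density_nnsfun.
rewrite -monotone_convergence//=.
- apply: eq_integral => w _; apply/cvg_lim => //.
  rewrite EFinM; under eq_fun do rewrite EFinM.
  by apply: cvgeZl => //; exact: cvgf.
- move=> n; apply/measurable_EFinP; apply: measurable_funM => //.
  exact: measurableT_comp.
- by move=> n w _; rewrite lee_fin mulr_ge0.
- move=> w _ a b ab; rewrite lee_fin ler_wpM2l//.
  exact/lefP/nd_nnsfun_approx.
Qed.

End Density.

(** * Factorisation of expectations under independence *)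

Section Independence.
Context {R : realType} {dT : measure_display} {T : measurableType dT}.
Variable P : probability T R.

Lemma measurable_prodr (I : finType) (f : I -> T -> R) :
  (forall i, measurable_fun setT (f i)) ->
  forall Q : pred I, measurable_fun setT (fun w => \prod_(i | Q i) f i w).
Proof.
move=> mf Q; rewrite (_ : (fun w => _) = (fun w => \prod_(i <- [seq i <- index_enum I | Q i]) f i w)).
  by apply: measurable_prod => i _; exact: mf.
by apply/funext => w; rewrite big_filter.
Qed.

Lemma integral_mul_indep (g : T -> R) (Z : {RV P >-> R}) (c : R) (f : R -> R) (e : R) :
  measurable_fun setT g -> (forall w, 0 <= g w) -> 0 <= c ->
  (forall B, measurable B ->
    (\int[P]_w (g w * \1_B (Z w))%:E = (c * fine (P (Z @^-1` B)))%:E)%E) ->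
  measurable_fun setT f -> (forall y, 0 <= f y) ->
  (\int[P]_w (f (Z w))%:E = e%:E)%E ->
  (\int[P]_w (g w * f (Z w))%:E = (c * e)%:E)%E.
Proof.
move=> mg g0 c0 gB mf f0 fe.
pose cn : {nonneg R} := NngNum c0.
have mf' : measurable_fun setT (fun y => (f y)%:E) by exact/measurable_EFinP.
rewrite -(@ge0_integral_density _ _ _ _ _ P (mscale cn (distribution P Z))) //.
- rewrite ge0_integral_mscale//; last by move=> y _; rewrite lee_fin.
  rewrite ge0_integral_distribution//.
  by rewrite /comp fe EFinM.
- move=> B mB; rewrite gB// /mscale/= EFinM fineK//.
  by rewrite fin_num_measure// -[X in measurable X]setTI; exact: measurable_funPT.
Qed.

Lemma expectation_prod_indep (K : finType) (Z : K -> {RV P >-> R})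
    (f : K -> R -> R) (e : K -> R) :
  mutually_independent Z ->
  (forall k, measurable_fun setT (f k)) -> (forall k y, 0 <= f k y) ->
  (forall k, (\int[P]_w (f k (Z k w))%:E = (e k)%:E)%E) ->
  (\int[P]_w (\prod_k f k (Z k w))%:E = (\prod_k e k)%:E)%E.
Proof.
move=> indep mf f0 fe.
have mZB k B : measurable B -> measurable (Z k @^-1` B).
  by move=> mB; rewrite -[X in measurable X]setTI; exact: measurable_funPT.
suff H (s : seq K) (h : K -> R -> R) (e' : K -> R) : 
  (forall k, k \notin s -> exists2 B, measurable B & h k = \1_B) ->
  (forall k, measurable_fun setT (h k)) -> (forall k y, 0 <= h k y) ->
  (forall k, (\int[P]_w (h k (Z k w))%:E = (e' k)%:E)%E) ->
  (\int[P]_w (\prod_k h k (Z k w))%:E = (\prod_k e' k)%:E)%E.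
  by apply: (H (enum K)) => // k; rewrite mem_enum.
elim: s h e' => [|k0 s IH] h e' hB mh h0 he.
  have /choice[B HB] : forall k, exists B, measurable B /\ h k = \1_B.
    by move=> k; have [//|B mB hE] := hB k; exists B.
  have ek k : e' k = fine (P (Z k @^-1` B k)).
    apply: EFin_inj; rewrite -he (HB k).2 fineK ?fin_num_measure//; last first.
      exact: mZB (HB k).1.
    have -> : (fun w => (\1_(B k) (Z k w))%:E) = EFin \o (\1_(Z k @^-1` B k) : T -> R) by [].
    by rewrite integral_indic ?setIT//; exact: mZB (HB k).1.
  have capE : (fun w => (\prod_k h k (Z k w))%:E) =
      EFin \o (\1_(\bigcap_(k in [set` [set: K]%SET]) (Z k @^-1` B k)) : T -> R).
    apply/funext => w /=; congr EFin; rewrite indicE.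
    have [wB|wB] := pselect ((\bigcap_(k in [set` [set: K]%SET]) (Z k @^-1` B k)) w).
      rewrite mem_set// big1// => k _; rewrite (HB k).2 indicE mem_set//.
      by apply: wB; rewrite /= inE.
    rewrite memNset//.
    have [k kB] : exists k, ~ B k (Z k w).
      by apply: contrapT => nk; apply: wB => k _ /=; apply: contrapT => kB; apply: nk; exists k.
    by rewrite (bigD1 k)//= (HB k).2 indicE memNset// mul0r.
  rewrite capE integral_indic//; last first.
    by apply: fin_bigcap_measurable => [|k _]; [exact: finite_finset|exact: mZB (HB k).1].
  rewrite setIT; apply: etrans (indep [set: K]%SET B (fun k => (HB k).1)) _.
  rewrite -prodEFin big_mkcond /=; apply: eq_bigr => k _; rewrite inE ek fineK//.
  by rewrite fin_num_measure//; exact: mZB (HB k).1.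
rewrite (bigD1 k0)//=; under eq_integral do rewrite (bigD1 k0)//= mulrC.
rewrite mulrC; apply: (@integral_mul_indep _ (Z k0) _ (h k0)) => //.
- apply: measurable_prodr => k; exact: measurableT_comp.
- by move=> w; apply: prodr_ge0 => k _.
- apply: prodr_ge0 => k _; rewrite -lee_fin -he.
  by apply: integral_ge0 => w _; rewrite lee_fin.
(* With [\1_B] in place of the factor [k0], the identity is the induction hypothesis. *)
move=> B mB; pose h' k := if k == k0 then \1_B else h k.
have := IH h' (fun k => if k == k0 then fine (P (Z k0 @^-1` B)) else e' k).
rewrite (bigD1 k0)//= eqxx.
rewrite (eq_bigr e') => [|k /negbTE -> //].
have E w : \prod_k h' k (Z k w) = \prod_(k | k != k0) h k (Z k w) * \1_B (Z k0 w).
  rewrite (bigD1 k0)//= {1}/h' eqxx mulrC; congr (_ * _).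
  by apply: eq_bigr => k /negbTE kk0; rewrite /h' kk0.
under eq_integral do rewrite E.
rewrite mulrC; apply.
- move=> k ks; rewrite /h'; case: eqP => [_|kk0]; first by exists B.
  by apply: hB; rewrite inE negb_or ks andbT; apply/eqP.
- by move=> k; rewrite /h'; case: eqP => // _; exact: measurable_indic.
- by move=> k y; rewrite /h'; case: eqP => // _; rewrite indicE.
- move=> k; rewrite /h'; case: eqP => // ->.
  have -> : (fun w => (\1_B (Z k0 w))%:E) = EFin \o (\1_(Z k0 @^-1` B) : T -> R) by [].
  rewrite integral_indic ?setIT ?fineK ?fin_num_measure//; exact: mZB.
Qed.

End Independence.

(** * Integrals of functions of a normal variable *)

Section NormalIntegrals.
Context {R : realType} {dT : measure_display} {T : measurableType dT}.
Variable P : probability T R.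
Local Notation mu := (@lebesgue_measure R).

Lemma integral_normal_rv (Z : {RV P >-> R}) m s (f : R -> R) :
  normal_rv Z m s -> measurable_fun setT f -> (forall y, 0 <= f y) ->
  (\int[P]_w (f (Z w))%:E = \int[mu]_y (normal_pdf m s y * f y)%:E)%E.
Proof.
move=> nZ mf f0.
rewrite -(@ge0_integral_density _ _ _ _ _ mu (distribution P Z) (normal_pdf m s) id)//.
- by rewrite ge0_integral_distribution//; exact/measurable_EFinP.
- exact: measurable_normal_pdf.
- exact: normal_pdf_ge0.
- move=> B mB; apply: etrans (nZ B mB) _; rewrite /normal_prob [LHS]integral_mkcond.
  apply: eq_integral => y _; rewrite patchE indicE.
  by case: (y \in B); rewrite ?mulr1 ?mulr0.
Qed.

Lemma mgf_normal (Z : {RV P >-> R}) t : normal_rv Z 0 1 ->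
  (\int[P]_w (expR (t * Z w))%:E = (expR (t ^+ 2 / 2))%:E)%E.
Proof.
move=> nZ.
have mf : measurable_fun setT (fun y : R => expR (t * y)).
  by apply: measurableT_comp => //; exact: measurable_funM.
rewrite (integral_normal_rv nZ mf (fun y => expR_ge0 (t * y))).
have E y : (normal_pdf 0 1 y * expR (t * y))%:E =
    ((expR (t ^+ 2 / 2))%:E * (normal_pdf t 1 y)%:E)%E.
  rewrite -EFinM !normal_pdfE ?oner_neq0//= /normal_fun.
  congr EFin; rewrite [RHS]mulrCA -mulrA -!expRD; congr (_ * expR _).
  by rewrite subr0 expr1n mulr2n; field.
transitivity (\int[mu]_y ((expR (t ^+ 2 / 2))%:E * (normal_pdf t 1 y)%:E))%E.
  by apply: eq_integral => y _; rewrite E.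
rewrite ge0_integralZl_EFin ?expR_ge0 ?integral_normal_pdf ?mule1//.
- by move=> y _; rewrite lee_fin normal_pdf_ge0.
- by apply/measurable_EFinP; exact: measurable_normal_pdf.
Qed.

End NormalIntegrals.

(** * Mass and Laplace transform of the noise near zero *)

Section NoiseLaw.
Context {R : realType}.
Variable s : R.
Hypothesis s0 : 0 < s.
Local Notation mu := (@lebesgue_measure R).

Lemma integral_normal_prob m (f : R -> R) :
  measurable_fun setT f -> (forall y, 0 <= f y) ->
  (\int[normal_prob m s]_y (f y)%:E = \int[mu]_y (normal_pdf m s y * f y)%:E)%E.
Proof.
move=> mf f0; apply: (@ge0_integral_density _ _ _ _ _ mu (normal_prob m s) (normal_pdf m s) id) => //.
- exact: measurable_normal_pdf.
- exact: normal_pdf_ge0.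
- move=> B mB; rewrite /normal_prob [LHS]integral_mkcond.
  apply: eq_integral => y _; rewrite patchE indicE.
  by case: (y \in B); rewrite ?mulr1 ?mulr0.
Qed.

Lemma normal_peak_le : normal_peak s <= (2 * s)^-1.
Proof.
rewrite /normal_peak lef_pV2 ?posrE ?mulr_gt0 ?sqrtr_gt0 ?mulrn_wgt0 ?mulr_gt0 ?exprn_gt0 ?pi_gt0//.
rewrite -[leLHS]ger0_norm ?mulr_ge0 ?(ltW s0)// -sqrtr_sqr ler_wsqrtr//.
have := pi_ge2 R; have := sqr_ge0 s; rewrite -mulr_natl; nra.
Qed.

(** [283/100] is just above [sqrt 8], which bounds [sqrt (2 pi)] because [pi < 4]. *)
Lemma normal_peak_ge : (283 / 100 * s)^-1 <= normal_peak s.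
Proof.
have h : 0 < 283 / 100 * s by move: (s0); lra.
rewrite /normal_peak lef_pV2 ?posrE ?sqrtr_gt0 ?mulrn_wgt0 ?mulr_gt0 ?exprn_gt0 ?pi_gt0//.
rewrite -[leRHS]ger0_norm ?(ltW h)// -sqrtr_sqr ler_wsqrtr//.
have := pihalf_02 R => /andP[_]; have := sqr_ge0 s; rewrite -mulr_natl; nra.
Qed.

Definition noise_mass (b : R) : R := fine (normal_prob 0 s `[-b, b]).

Lemma noise_massE b : normal_prob 0 s `[-b, b]%classic = (noise_mass b)%:E.
Proof. by rewrite /noise_mass fineK// fin_num_measure. Qed.

Lemma noise_mass_ge0 b : 0 <= noise_mass b.
Proof. by rewrite /noise_mass fine_ge0. Qed.

Lemma noise_mass_le1 b : noise_mass b <= 1.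
Proof. by rewrite -lee_fin -noise_massE probability_le1. Qed.

Let integral_cst_itv (b c : R) : 0 <= b ->
  (\int[mu]_(y in `[(- b)%R, b]) c%:E = (c * (2 * b))%R%:E)%E.
Proof.
move=> b0; rewrite integral_cst//= lebesgue_measure_itv /= lte_fin.
case: ltP => bb; first by rewrite opprK -EFinD -EFinM mulr2n mulrDl mul1r.
have -> : b = 0 by move: b0 bb; lra.
by rewrite mule0 !mulr0.
Qed.

Lemma noise_mass_le (b : R) : 0 <= b -> noise_mass b <= b / s.
Proof.
move=> b0; rewrite -lee_fin -noise_massE /normal_prob.
have -> : b / s = (2 * s)^-1 * (2 * b) by field; rewrite gt_eqF.
rewrite -integral_cst_itv//; apply: ge0_le_integral => //.
- by move=> y _; rewrite lee_fin normal_pdf_ge0.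
- by apply: measurable_funTS; apply/measurable_EFinP; exact: measurable_normal_pdf.
- move=> y _; rewrite lee_fin; apply: le_trans normal_peak_le.
  by apply: normal_pdf_ub; rewrite gt_eqF.
Qed.

Lemma noise_mass_ge (b : R) : 0 <= b -> b <= s ->
  2 * b / (283 / 100 * s) * (1 - (b / s) ^+ 2 / 2) <= noise_mass b.
Proof.
move=> b0 bs; rewrite -lee_fin -noise_massE /normal_prob.
have h : 0 < 283 / 100 * s by move: (s0); lra.
have -> : 2 * b / (283 / 100 * s) * (1 - (b / s) ^+ 2 / 2) =
  ((283 / 100 * s)^-1 * (1 - (b / s) ^+ 2 / 2)) * (2 * b).
  by field; rewrite gt_eqF.
rewrite -integral_cst_itv//.
have bs1 : (b / s) ^+ 2 <= 1.
  by rewrite expr_le1// ?divr_ge0 ?(ltW s0)// ler_pdivrMr// mul1r.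
apply: ge0_le_integral => //.
- by move=> y _; rewrite lee_fin mulr_ge0 ?invr_ge0 ?(ltW h)//; move: bs1; lra.
- by apply: measurable_funTS; apply/measurable_EFinP; exact: measurable_normal_pdf.
- move=> y; rewrite /= in_itv /= => /andP[yl yu]; rewrite lee_fin.
  rewrite normal_pdfE ?gt_eqF//=; apply: ler_pM.
  + by rewrite invr_ge0 ltW.
  + by move: bs1; lra.
  + exact: normal_peak_ge.
  + rewrite /normal_fun subr0; apply: le_trans (expR_ge1Dx _).
    rewrite lerD2l mulNr lerN2 mulr2n.
    have -> : (b / s) ^+ 2 / 2 = b ^+ 2 / (s ^+ 2 + s ^+ 2).
      by rewrite expr_div_n -mulrA -invfM mulr_natr mulr2n.
    rewrite ler_pM2r ?invr_gt0 ?addr_gt0 ?exprn_gt0//.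
    by move: yl yu; nra.
Qed.

Lemma integral_opp (f : R -> R) : measurable_fun setT f -> (forall y, 0 <= f y) ->
  (\int[mu]_y (f (- y))%:E = \int[mu]_y (f y)%:E)%E.
Proof.
move=> mf f0.
transitivity (\int[pushforward mu (-%R : _ -> measurableTypeR R)]_y (f y)%:E)%E.
  rewrite ge0_integral_pushforward//=; first exact/measurable_EFinP.
  by move=> y _; rewrite lee_fin.
by apply: eq_measure_integral => A mA _; exact: lebesgue_measureN.
Qed.

(** The normal density is at most [1 / (2 s)], and [exp (- l |y|)] is dominated by [1 / l] times the
    exponential density plus its mirror image, of total mass 2. *)
Lemma integral_expRN_abs l : 0 < l ->
  (\int[normal_prob 0 s]_y (expR (- l * `|y|))%:E <= ((l * s)^-1)%:E)%E.
Proof.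
move=> l0.
have mf : measurable_fun setT (fun y : R => expR (- l * `|y|)).
  apply: measurableT_comp => //; apply: measurable_funM => //.
rewrite integral_normal_prob//.
have mexp := @measurable_exponential_pdf R l.
pose c := (2 * s)^-1 * l^-1.
have c0 : 0 <= c by rewrite mulr_ge0 ?invr_ge0 ?mulr_ge0 ?(ltW s0) ?(ltW l0).
apply: (@le_trans _ _ (\int[mu]_y (c * (exponential_pdf l y + exponential_pdf l (- y)))%:E)%E).
  apply: ge0_le_integral => //.
  - by move=> y _; rewrite lee_fin mulr_ge0 ?normal_pdf_ge0 ?expR_ge0.
  - apply/measurable_EFinP; apply: measurable_funM => //; exact: measurable_normal_pdf.
  - apply/measurable_EFinP; apply: measurable_funM => //; apply: measurable_funD => //.
    exact: measurableT_comp.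
  move=> y _; rewrite lee_fin /c -mulrA; apply: ler_pM.
  - exact: normal_pdf_ge0.
  - exact: expR_ge0.
  - by apply: le_trans normal_peak_le; apply: normal_pdf_ub; rewrite gt_eqF.
  - rewrite ler_pdivlMl//.
    have pdf_ge0 z := @exponential_pdf_ge0 R l (ltW l0) z.
    have pdfE z : 0 <= z -> exponential_pdf l z = l * expR (- l * z).
      by move=> z0; rewrite /exponential_pdf patchE mem_set//= in_itv/= z0.
    rewrite -pdfE//; have [y0|y0] := leP 0 y.
      by rewrite ger0_norm// lerDl.
    by rewrite ltr0_norm// lerDr.
have me2 : measurable_fun setT (fun y : R => exponential_pdf l (- y)).
  exact: measurableT_comp.
under eq_integral do rewrite EFinM EFinD.
have pdf_ge0 z : (0 <= (exponential_pdf l z)%:E)%E.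
  by rewrite lee_fin exponential_pdf_ge0// ltW.
rewrite ge0_integralZl_EFin//; last 2 first.
- by move=> y _; rewrite adde_ge0.
- by apply: emeasurable_funD; exact/measurable_EFinP.
rewrite ge0_integralD//; try exact/measurable_EFinP.
rewrite integral_opp//.
rewrite integral_exponential_pdf// -EFinD -EFinM lee_fin.
rewrite /c le_eqVlt; apply/orP; left; apply/eqP; field; rewrite !gt_eqF//.
Qed.

End NoiseLaw.

(** * Chernoff bound for sums over the samples *)

Section Chernoff.
Context {R : realType} {dT : measure_display} {T : measurableType dT}.
Variable P : probability T R.

Lemma prod_triple (A B C : finType) (F : A * B * C -> R) :
  \prod_k F k = \prod_a \prod_b \prod_c F (a, b, c).
Proof. by rewrite pair_bigA /= pair_bigA /=; apply: eq_bigr => -[[]]. Qed.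

(** Coefficients of both signs occur ([lower_k1] is negative), so linearity rests on
    integrability. *)
Lemma integral_lincomb (I : finType) (c v : I -> R) (V : I -> T -> R) :
  (forall i, measurable_fun setT (V i)) -> (forall i w, 0 <= V i w) ->
  (forall i, (\int[P]_w (V i w)%:E = (v i)%:E)%E) ->
  (\int[P]_w (\sum_i c i * V i w)%:E = (\sum_i c i * v i)%:E)%E.
Proof.
move=> mV V0 Vv.
have iV i : P.-integrable setT (fun w => (V i w)%:E).
  apply/integrableP; split; first exact/measurable_EFinP.
  under eq_integral do rewrite gee0_abs ?lee_fin//.
  by rewrite Vv ltry.
have icV i : P.-integrable setT (fun w => (c i * V i w)%:E).
  by under eq_fun do rewrite EFinM; exact: integrableZl.
under eq_integral do rewrite -sumEFin.
rewrite integral_sum// -sumEFin; apply: eq_bigr => i _.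
by under eq_integral do rewrite EFinM; rewrite integralZl// Vv -EFinM.
Qed.

Variables (n d1 d2 : nat) (sigma : R).
Variables (X : 'I_n -> 'I_d1 -> 'I_d2 -> {RV P >-> R}) (xi : 'I_n -> {RV P >-> R}).
Hypothesis model : gaussian_model sigma X xi.

Lemma measurable_inner_design (N : 'M[R]_(d1, d2)) i :
  measurable_fun setT (fun w => inner N (design X w i)).
Proof.
have -> : (fun w => inner N (design X w i)) =
    (fun w => \sum_(k <- index_enum _) \sum_(l <- index_enum _) N k l * X i k l w).
  by apply/funext => w; rewrite innerE; do 2!apply: eq_bigr => ? _; rewrite mxE.
apply: measurable_sum => k; apply: measurable_sum => l.
exact: measurable_funM.
Qed.

(* By independence, the expectation of each product of the dominating factors
   u t (xi i) * exp (th t * x_i) is explicit, the x_i being standard normal. *)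
Lemma chernoff_design (I : finType) (c th U : I -> R) (u : I -> R -> R)
    (N : 'M[R]_(d1, d2)) (G : R -> R -> R) (B : R) (S : set T) :
  frob N = 1 ->
  (forall t, measurable_fun setT (u t)) -> (forall t y, 0 <= u t y) ->
  (forall t, (\int[normal_prob 0 sigma]_y (u t y)%:E = (U t)%:E)%E) ->
  (forall y x, expR (G y x) <= \sum_t c t * (u t y * expR (th t * x))) ->
  measurable S ->
  (forall w, S w -> B <= \sum_(i < n) G (xi i w) (inner N (design X w i))) ->
  (P S <= (expR (- B) * (\sum_t c t * (U t * expR (th t ^+ 2 / 2))) ^+ n)%:E)%E.
Proof.
move=> N1 mu0 u0 uU GF mS SB.
have [nX nxi indep] := model.
pose x i w := inner N (design X w i).
(* One product per choice of a dominating term for each sample: expanding the product of the sums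
   [F] over the samples gives a linear combination of these. *)
pose V (t : {ffun 'I_n -> I}) w :=
  \prod_i (u (t i) (xi i w) * expR (th (t i) * x i w)).
pose phi (t : {ffun 'I_n -> I}) (k : ('I_n * 'I_d1 * 'I_d2) + 'I_n) : R -> R :=
  match k with
  | inl (i, a, b) => fun y => expR (th (t i) * N a b * y)
  | inr i => u (t i)
  end.
pose e (t : {ffun 'I_n -> I}) (k : ('I_n * 'I_d1 * 'I_d2) + 'I_n) : R :=
  match k with
  | inl (i, a, b) => expR ((th (t i) * N a b) ^+ 2 / 2)
  | inr i => U (t i)
  end.
have VE t w : V t w = \prod_k phi t k (design_noise_family X xi k w).
  rewrite big_sumType /= /V big_split /= mulrC; congr (_ * _).
  rewrite prod_triple; apply: eq_bigr => i _; rewrite /x innerE mulr_sumr expR_sum.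
  apply: eq_bigr => a _; rewrite mulr_sumr expR_sum; apply: eq_bigr => b _.
  by rewrite mxE mulrA.
have eE t : \prod_k e t k = \prod_i (U (t i) * expR (th (t i) ^+ 2 / 2)).
  rewrite big_sumType /= big_split /= mulrC; congr (_ * _).
  rewrite prod_triple; apply: eq_bigr => i _.
  have -> : th (t i) ^+ 2 / 2 = \sum_a \sum_b (th (t i) * N a b) ^+ 2 / 2.
    transitivity (th (t i) ^+ 2 / 2 * frob N ^+ 2); first by rewrite N1 expr1n mulr1.
    rewrite frob_sqr innerE mulr_sumr.
    apply: eq_bigr => a _; rewrite mulr_sumr; apply: eq_bigr => b _.
    by rewrite exprMn -expr2 mulrAC.
  by rewrite expR_sum; apply: eq_bigr => a _; rewrite expR_sum.
have mphi t k : measurable_fun setT (phi t k).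
  case: k => [[[i a] b]|i] //=.
  by apply: measurableT_comp => //; exact: measurable_funM.
have phi0 t k y : 0 <= phi t k y by case: k => [[[i a] b]|i] //=; exact: expR_ge0.
have phie t k : (\int[P]_w (phi t k (design_noise_family X xi k w))%:E = (e t k)%:E)%E.
  case: k => [[[i a] b]|i] /=; first exact: mgf_normal.
  rewrite -uU integral_normal_prob//.
  by apply: integral_normal_rv.
have Vint t : (\int[P]_w (V t w)%:E = (\prod_i (U (t i) * expR (th (t i) ^+ 2 / 2)))%:E)%E.
  under eq_integral do rewrite VE.
  by rewrite (expectation_prod_indep indep (mphi t) (phi0 t) (phie t)) eE.
have mV t : measurable_fun setT (V t).
  have -> : V t = fun w => \prod_k phi t k (design_noise_family X xi k w).
    by apply/funext => w; exact: VE.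
  by apply: measurable_prodr => k; exact: measurableT_comp.
have V0 t w : 0 <= V t w.
  by apply: prodr_ge0 => i _; rewrite mulr_ge0// expR_ge0.
pose F y z := \sum_t c t * (u t y * expR (th t * z)).
have FV w : \prod_i F (xi i w) (x i w) =
    \sum_(t : {ffun 'I_n -> I}) (\prod_i c (t i)) * V t w.
  rewrite /F (bigA_distr_bigA (fun i t => c t * (u t (xi i w) * expR (th t * x i w)))).
  by apply: eq_bigr => t _; rewrite big_split.
have FE : (\int[P]_w (\prod_i F (xi i w) (x i w))%:E =
    ((\sum_t c t * (U t * expR (th t ^+ 2 / 2))) ^+ n)%:E)%E.
  under eq_integral do rewrite FV.
  rewrite (integral_lincomb _ mV V0 Vint); congr EFin.
  rewrite -[in RHS](card_ord n) -prodr_const.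
  rewrite (bigA_distr_bigA (fun _ t => c t * (U t * expR (th t ^+ 2 / 2)))).
  by apply: eq_bigr => t _; rewrite -big_split.
have F0 y z : 0 <= F y z by apply: le_trans (GF y z); exact: expR_ge0.
have mF : measurable_fun setT (fun w => \prod_i F (xi i w) (x i w)).
  have -> : (fun w => \prod_i F (xi i w) (x i w)) =
      (fun w => \sum_(t <- index_enum {ffun 'I_n -> I}) (\prod_i c (t i)) * V t w).
    by apply/funext => w; exact: FV.
  by apply: measurable_sum => t; exact: measurable_funM.
rewrite EFinM -FE -ge0_integralZl_EFin ?expR_ge0//; last 2 first.
- by move=> w _; rewrite lee_fin prodr_ge0.
- exact/measurable_EFinP.
rewrite -[X in P X]setIT -integral_indic//; apply: ge0_le_integral => //.
- exact/measurable_EFinP.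
- by apply/measurable_EFinP; exact: measurable_funM.
move=> w _; rewrite -EFinM lee_fin indicE.
have [wS|wS] := boolP (w \in S); last first.
  by rewrite mulr_ge0 ?expR_ge0 ?prodr_ge0.
apply: (@le_trans _ _ (expR (- B) * expR (\sum_i G (xi i w) (x i w)))).
  rewrite -expRD -[leLHS]expR0 ler_expR addrC subr_ge0; apply: SB.
  by rewrite inE in wS.
rewrite ler_wpM2l ?expR_ge0// expR_sum; apply: ler_prod => i _.
by rewrite expR_ge0 /=; exact: GF.
Qed.

End Chernoff.

(** * Exponential minorants of the absolute value *)

Section AbsLowerBound.
Context {R : realType}.
Implicit Types s u v x : R.

(** A truncated arcsinh series: the difference vanishes at 0 and, with [C = cosh], its derivative is
    [(C - 1)^2 (C + 2) / 2]. *)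
Lemma sinh_cubic_le s : 0 <= s ->
  (expR s - expR (- s)) / 2 - ((expR s - expR (- s)) / 2) ^+ 3 / 6 <= s.
Proof.
move=> s0.
pose f := fun s : R => s - (expR s - expR (- s)) / 2 + ((expR s - expR (- s)) / 2) ^+ 3 / 6.
pose df := fun x : R => 1 - (expR x + expR (- x)) / 2
  + 3 * (((expR x - expR (- x)) / 2) ^+ 2 * ((expR x + expR (- x)) / 2)) / 6.
have fdf x : is_derive x 1 f (df x).
  by apply: is_derive_eq; rewrite /df /GRing.scale /=; field.
have cf : {within `[0, s], continuous f}.
  apply: continuous_subspaceT => x; apply: differentiable_continuous.
  by apply/derivable1_diffP; exact: ex_derive.
have [c cs] := MVT_segment s0 (fun x _ => fdf x) cf.
have -> : f 0 = 0 by rewrite /f oppr0 subrr !mul0r expr0n /= mul0r subrr add0r.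
rewrite !subr0 => fE.
suff dfc : 0 <= df c.
  by have : 0 <= f s; [rewrite fE mulr_ge0|rewrite /f; lra].
rewrite /df expRN.
have e0 : 0 < expR c by exact: expR_gt0.
move: (expR c) e0 => e e0.
have -> : 1 - (e + e^-1) / 2 + 3 * (((e - e^-1) / 2) ^+ 2 * ((e + e^-1) / 2)) / 6 =
  ((e + e^-1) / 2 - 1) ^+ 2 * ((e + e^-1) / 2 + 2) / 2 by field; rewrite gt_eqF.
have C0 : 0 <= (e + e^-1) / 2 by apply: divr_ge0 => //; apply: addr_ge0; rewrite ?invr_ge0 ltW.
by apply: divr_ge0 => //; apply: mulr_ge0; [exact: sqr_ge0|exact: addr_ge0].
Qed.

(** With [v = sinh (u / 2)] the left side is [17 v^2 - 188 v^4], while [u >= 2 v - v^3 / 3] by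
    [sinh_cubic_le]. The coefficients keep the remaining cubic barely positive at its minimum, near
    [v = 0.17]. *)
Lemma abs_ge_cosh_aux u : 0 <= u ->
  (17 / 2 + 4 * (47 / 2)) * ((expR u + expR (- u)) / 2 - 1)
  - 47 / 2 * ((expR (2 * u) + expR (- (2 * u))) / 2 - 1) <= u.
Proof.
move=> u0.
have [t tE] : exists t, u = t + t by exists (u / 2); field.
have t0 : 0 <= t by lra.
have := sinh_cubic_le t0; rewrite tE.
have -> : 2 * (t + t) = t + t + (t + t) by ring.
rewrite !expRN !expRD.
have e0 : 0 < expR t by exact: expR_gt0.
have e1 : 1 <= expR t by rewrite -[leLHS]expR0 ler_expR.
move: (expR t) e0 e1 => e e0 e1.
pose v := (e - e^-1) / 2.
have v0 : 0 <= v.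
  apply: divr_ge0 => //; rewrite subr_ge0; by apply: le_trans (e1); rewrite invf_le1.
have -> : (e * e + (e * e)^-1) / 2 - 1 = 2 * v ^+ 2 by rewrite /v; field; rewrite gt_eqF.
have -> : (e * e * (e * e) + (e * e * (e * e))^-1) / 2 - 1 = 8 * v ^+ 2 * (v ^+ 2 + 1).
  by rewrite /v; field; rewrite gt_eqF.
rewrite -/v => h.
suff : 0 <= v * (94 * v ^+ 3 - v ^+ 2 / 6 - 17 / 2 * v + 1) by lra.
rewrite mulr_ge0//.
have h1 : 0 <= v * (v - 7 / 40) ^+ 2 by rewrite mulr_ge0 ?sqr_ge0.
have h2 : 0 <= (v - 3477 / 200 / 100) ^+ 2 by exact: sqr_ge0.
lra.
Qed.

(* Dominating - |x| by finitely many exponentials of linear forms keeps its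
   moment generating function within reach of chernoff_design. *)
Lemma abs_ge_cosh x :
  5 * ((17 / 2 + 4 * (47 / 2)) * ((expR (1 / 5 * x) + expR (- 1 / 5 * x)) / 2 - 1)
  - 47 / 2 * ((expR (2 / 5 * x) + expR (- 2 / 5 * x)) / 2 - 1)) <= `|x|.
Proof.
have pos (y : R) : 0 <= y ->
  5 * ((17 / 2 + 4 * (47 / 2)) * ((expR (1 / 5 * y) + expR (- 1 / 5 * y)) / 2 - 1)
  - 47 / 2 * ((expR (2 / 5 * y) + expR (- 2 / 5 * y)) / 2 - 1)) <= y.
  move=> y0; have y50 : 0 <= y / 5 by rewrite divr_ge0.
  have := abs_ge_cosh_aux y50.
  have -> : - (y / 5) = - 1 / 5 * y by field.
  have -> : - (2 * (y / 5)) = - 2 / 5 * y by field.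
  have -> : 2 * (y / 5) = 2 / 5 * y by field.
  have -> : y / 5 = 1 / 5 * y by field.
  lra.
have [x0|x0] := leP 0 x; first by rewrite ger0_norm//; exact: pos.
rewrite ltr0_norm//; have := pos (- x); rewrite oppr_ge0 ltW// => /(_ isT).
have -> : 1 / 5 * - x = - 1 / 5 * x by field.
have -> : - 1 / 5 * - x = 1 / 5 * x by field.
have -> : 2 / 5 * - x = - 2 / 5 * x by field.
have -> : - 2 / 5 * - x = 2 / 5 * x by field.
by rewrite (addrC (expR (- 1 / 5 * x))) (addrC (expR (- 2 / 5 * x))).
Qed.

Lemma expR_le_inv v : v < 1 -> expR v <= (1 - v)^-1.
Proof.
move=> v1; rewrite -[expR v]invrK -expRN lef_pV2 ?posrE ?expR_gt0 ?subr_gt0//.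
exact: expR_ge1Dx.
Qed.

Lemma sqr_le_cosh x : x ^+ 2 / 8 <= (expR x + expR (- x)) / 2 - 1.
Proof.
have pos (y : R) : 0 <= y -> y ^+ 2 / 8 <= (expR y + expR (- y)) / 2 - 1.
  move=> y0; have [t tE] : exists t, y = t + t by exists (y / 2); field.
  have t0 : 0 <= t by lra.
  rewrite tE expRN expRD.
  have e0 : 0 < expR t by exact: expR_gt0.
  pose v := (expR t - (expR t)^-1) / 2.
  have -> : (expR t * expR t + (expR t * expR t)^-1) / 2 - 1 = 2 * v ^+ 2.
    by rewrite /v; field; rewrite gt_eqF.
  suff : t <= 2 * v by nra.
  have e1 := expR_ge1Dx t.
  have t1 : 0 < 1 + t by lra.
  have : (expR t)^-1 <= (1 + t)^-1 by rewrite lef_pV2.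
  have : (1 + t)^-1 <= 1 by rewrite invf_le1// lerDl.
  by rewrite /v; lra.
have [x0|x0] := leP 0 x; first exact: pos.
by have := pos (- x); rewrite oppr_ge0 ltW// sqrrN opprK [_ + expR x]addrC; apply.
Qed.

End AbsLowerBound.

(** * Upper tails of the absolute, band and signed sums *)

Section Events.
Context {R : realType} {dT : measure_display} {T : measurableType dT}.
Variable P : probability T R.
Variables (n d1 d2 : nat) (sigma : R).
Variables (X : 'I_n -> 'I_d1 -> 'I_d2 -> {RV P >-> R}) (xi : 'I_n -> {RV P >-> R}).
Hypotheses (sigma0 : 0 < sigma) (model : gaussian_model sigma X xi).
Implicit Types (N : 'M[R]_(d1, d2)) (b s x y : R).

Definition ind b y : R := \1_(`[(- b)%R, b]%classic) y.
Definition sgn_off b y : R := \1_(`]b, +oo[%classic) y - \1_(`]-oo, (- b)%R[%classic) y.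

Lemma indE b y : ind b y = (`|y| <= b)%R%:R.
Proof. by rewrite /ind indicE mem_setE in_itv /= -ler_norml. Qed.

Lemma sgn_offE b y : sgn_off b y = (b < y)%R%:R - (y < - b)%R%:R.
Proof. by rewrite /sgn_off !indicE !mem_setE !in_itv /= andbT. Qed.

Lemma measurable_ind b : measurable_fun setT (ind b).
Proof. exact: measurable_indic. Qed.

Lemma measurable_sgn_off b : measurable_fun setT (sgn_off b).
Proof. by apply: measurable_funB; exact: measurable_indic. Qed.

Lemma ind_ge0 b y : 0 <= ind b y. Proof. by rewrite indE. Qed.

Lemma measurable_ge_set (F : T -> R) b : measurable_fun setT F ->
  measurable [set w | b <= F w].
Proof.
move=> mF; have -> : [set w | b <= F w] = F @^-1` `[b, +oo[%classic.
  by apply/seteqP; split => w /=; rewrite in_itv /= andbT.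
by rewrite -[X in measurable X]setTI; exact: mF.
Qed.

Lemma measurable_sum_design N (G : R -> R -> R) :
  measurable_fun setT (fun yx : R * R => G yx.1 yx.2) ->
  measurable_fun setT (fun w => \sum_(i < n) G (xi i w) (inner N (design X w i))).
Proof.
move=> mG.
have -> : (fun w => \sum_(i < n) G (xi i w) (inner N (design X w i))) =
    (fun w => \sum_(i <- index_enum 'I_n) G (xi i w) (inner N (design X w i))) by [].
apply: measurable_sum => i.
apply: (measurableT_comp mG (g := fun w => (xi i w, inner N (design X w i)))).
apply: measurable_fun_pair => //; exact: measurable_inner_design.
Qed.

Lemma integral_normal_prob1 : (\int[normal_prob 0 sigma]_y 1%:E = 1%:E :> \bar R)%E.
Proof. by rewrite integral_cst// mul1e; exact: (@probability_setT _ _ _ (normal_prob 0 sigma)). Qed.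

Lemma integral_ind b : (\int[normal_prob 0 sigma]_y (ind b y)%:E = (noise_mass sigma b)%:E)%E.
Proof. by rewrite /ind integral_indic// setIT; exact: noise_massE. Qed.

Lemma expR_abs_le x : expR `|x| <= expR x + expR (- x).
Proof.
have [x0|x0] := leP 0 x.
  by rewrite ger0_norm// lerDl expR_ge0.
by rewrite ltr0_norm// lerDr expR_ge0.
Qed.

Lemma expR_half_le2 : expR (1 / 2) <= 2 :> R.
Proof.
have h : 1 / 2 < 1 :> R by lra.
apply: le_trans (expR_le_inv h) _.
by have -> : 1 - 1 / 2 = 2^-1 :> R; [field|rewrite invrK].
Qed.

Lemma expn_expR_le (q : R) : 0 <= 1 + q -> (1 + q) ^+ n <= expR (n%:R * q).
Proof.
by move=> q0; rewrite expRM_natl lerXn2r ?nnegrE ?expR_ge0 ?expR_ge1Dx.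
Qed.

Definition event_abs N : set T :=
  [set w | 13 / 10 * n%:R <= \sum_(i < n) `|inner N (design X w i)|].

(** The generating function at [13/10] is at most [2 exp (0.845)] per sample, and [2 <= exp (8/10)]:
    the rate is [1.69 - 0.8 - 0.845 = 0.045]. *)
Lemma event_absP N : frob N = 1 ->
  measurable (event_abs N) /\
  (P (event_abs N) <= (expR (- (45 / 1000 * n%:R)))%:E)%E.
Proof.
move=> N1.
have mE : measurable (event_abs N).
  apply: measurable_ge_set; apply: (@measurable_sum_design N (fun _ x : R => `|x|)).
  by apply: measurableT_comp.
split=> //.
pose th (t : 'I_2) : R := nth 0 [:: 13 / 10; - (13 / 10)] t.
apply: le_trans (chernoff_design model (c := fun=> 1) (th := th) (U := fun=> 1)
  (u := fun _ _ => 1) (G := fun _ x => 13 / 10 * `|x|) (B := 169 / 100 * n%:R) N1 _ _ _ _ mE _) _.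
- by move=> t; exact: measurable_cst.
- by [].
- by move=> t; exact: integral_normal_prob1.
- move=> _ x; rewrite !big_ord_recr big_ord0 /= !mul1r /th /= add0r mulNr.
  have -> : 13 / 10 * `|x| = `|13 / 10 * x| by rewrite normrM [in RHS]ger0_norm// divr_ge0.
  exact: expR_abs_le.
- move=> w; rewrite /event_abs /= -mulr_sumr => h.
  have : 0 <= n%:R :> R by []. lra.
rewrite lee_fin !big_ord_recr big_ord0 /= !mul1r /th /= add0r sqrrN.
have e8 : 2 <= expR (8 / 10) :> R.
  have -> : 8 / 10 = 4%:R * (1 / 5) :> R by field.
  rewrite expRM_natl; apply: le_trans (_ : (1 + 1 / 5) ^+ 4 <= _); first by rewrite !exprS expr0; lra.
  by rewrite lerXn2r ?nnegrE ?expR_ge0 ?expR_ge1Dx//; lra.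
have -> : (13 / 10) ^+ 2 / 2 = 845 / 1000 :> R by field.
apply: (@le_trans _ _ (expR (- (169 / 100 * n%:R)) * (expR (8 / 10) * expR (845 / 1000)) ^+ n)).
  rewrite ler_wpM2l ?expR_ge0// lerXn2r ?nnegrE ?addr_ge0 ?mulr_ge0 ?expR_ge0//.
  have := expR_ge0 (845 / 1000 : R); nra.
rewrite -expRD -expRM_natl -expRD ler_expR; lra.
Qed.

Definition event_ind b N : set T :=
  [set w | 5 * noise_mass sigma b * n%:R <=
    \sum_(i < n) ind b (xi i w) * `|inner N (design X w i)|].

(** Off the band the factor is 1, so the generating function is at most
    [1 + 2 p exp (1/2) <= 1 + 4 p], which leaves the rate [5 p - 4 p]. Both threshold and rate scale
    with the band mass. *)
Lemma event_indP b N : 0 <= b -> frob N = 1 ->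
  measurable (event_ind b N) /\
  (P (event_ind b N) <= (expR (- (noise_mass sigma b * n%:R)))%:E)%E.
Proof.
move=> b0 N1; set p := noise_mass sigma b.
have p0 : 0 <= p by exact: noise_mass_ge0.
have mE : measurable (event_ind b N).
  apply: measurable_ge_set; apply: (@measurable_sum_design N (fun y x : R => ind b y * `|x|)).
  apply: measurable_funM; apply: measurableT_comp => //; exact: measurable_ind.
split=> //.
pose th (t : 'I_3) : R := nth 0 [:: 0; 1; - 1] t.
pose u (t : 'I_3) : R -> R := nth (fun=> 1) [:: fun=> 1; ind b; ind b] t.
pose U (t : 'I_3) : R := nth 0 [:: 1; p; p] t.
apply: le_trans (chernoff_design model (c := fun=> 1) (th := th) (U := U)
  (u := u) (G := fun y x => ind b y * `|x|) (B := 5 * p * n%:R) N1 _ _ _ _ mE _) _.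
- by move=> [[|[|[|]]] //] ?; rewrite /u /=; try exact: measurable_ind; exact: measurable_cst.
- by move=> [[|[|[|]]] //] ? y; rewrite /u /=; exact: ind_ge0.
- by move=> [[|[|[|]]] //] ?; rewrite /u /U /=;
    [exact: integral_normal_prob1|exact: integral_ind|exact: integral_ind].
- move=> y x; rewrite !big_ord_recr big_ord0 /= !mul1r /th /u /= add0r mul0r expR0 ?mul1r ?mulN1r.
  rewrite indE; case: (`|y| <= b) => /=; last by rewrite !mul0r expR0 !addr0.
  by rewrite !mul1r -addrA; apply: le_trans (expR_abs_le x) _; rewrite lerDr.
- by [].
rewrite lee_fin !big_ord_recr big_ord0 /= !mul1r /th /U /= add0r sqrrN expr0n /= mul0r expR0 ?mul1r ?mulr1 ?expr1n.
have h2 := expR_half_le2.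
apply: (@le_trans _ _ (expR (- (5 * p * n%:R)) * (1 + 4 * p) ^+ n)).
  rewrite ler_wpM2l ?expR_ge0// lerXn2r ?nnegrE ?addr_ge0 ?mulr_ge0 ?expR_ge0//.
  by rewrite -addrA lerD2l; have := ler_wpM2l p0 h2; lra.
apply: le_trans (ler_wpM2l (expR_ge0 _) (expn_expR_le _)) _; first by lra.
rewrite -expRD ler_expR; lra.
Qed.

Definition event_sgn b e N : set T :=
  [set w | e * n%:R <= \sum_(i < n) sgn_off b (xi i w) * inner N (design X w i)].

(** Given the noises, the signed sum is centred Gaussian of variance at most [n]. The signs enter
    through the masses of the two outer sides, which add up to 1 with the band. *)
Lemma event_sgnP b e N : 0 <= b -> 0 <= e -> frob N = 1 ->
  measurable (event_sgn b e N) /\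
  (P (event_sgn b e N) <= (expR (- (e ^+ 2 / 2 * n%:R)))%:E)%E.
Proof.
move=> b0 e0 N1.
have mE : measurable (event_sgn b e N).
  apply: measurable_ge_set; apply: (@measurable_sum_design N (fun y x : R => sgn_off b y * x)).
  apply: measurable_funM => //; apply: measurableT_comp => //; exact: measurable_sgn_off.
split=> //.
pose A := `]b, +oo[%classic : set R.
pose B := `]-oo, (- b)%R[%classic : set R.
have mA : measurable A by exact: measurable_itv.
have mB : measurable B by exact: measurable_itv.
pose qA := fine (normal_prob 0 sigma A); pose qB := fine (normal_prob 0 sigma B).
have qAE : normal_prob 0 sigma A = qA%:E by rewrite /qA fineK// fin_num_measure.
have qBE : normal_prob 0 sigma B = qB%:E by rewrite /qB fineK// fin_num_measure.
have qA0 : 0 <= qA by rewrite -lee_fin -qAE.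
have qB0 : 0 <= qB by rewrite -lee_fin -qBE.
have q1 : noise_mass sigma b + qA + qB = 1.
  apply: EFin_inj; rewrite !EFinD -noise_massE -qAE -qBE.
  rewrite -(@probability_setT _ _ _ (normal_prob 0 sigma)).
  rewrite (_ : setT = `[(- b)%R, b]%classic `|` A `|` B); last first.
    apply/seteqP; split => // y _ /=; rewrite /A /B /= !in_itv /= andbT.
    have [h1|h1] := ltP b y; first by left; right.
    have [h2|h2] := ltP y (- b); first by right.
    by left; left.
  have dA : `[(- b)%R, b]%classic `&` A = set0.
    apply/seteqP; split => // y [] /=; rewrite /A /= !in_itv /= andbT.
    by move=> /andP[_ h1] h2; move: h1 h2; lra.
  have dB : (`[(- b)%R, b]%classic `|` A) `&` B = set0.
    apply/seteqP; split => // y [] /=; rewrite /A /B /= !in_itv /= andbT.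
    by case=> [/andP[h1 _]|h1] h2; move: b0 h1 h2; lra.
  have mI : measurable (`[(- b)%R, b]%classic : set R) by exact: measurable_itv.
  have E1 := measureU (normal_prob 0 sigma) mI mA dA.
  have E2 := measureU (normal_prob 0 sigma) (measurableU _ _ mI mA) mB dB.
  by apply/esym; apply: etrans E2 _; congr (_ + _)%E; exact: E1.
pose th (t : 'I_3) : R := nth 0 [:: 0; e; - e] t.
pose u (t : 'I_3) : R -> R := nth (fun=> 1) [:: ind b; \1_A; \1_B] t.
pose U (t : 'I_3) : R := nth 0 [:: noise_mass sigma b; qA; qB] t.
apply: le_trans (chernoff_design model (c := fun=> 1) (th := th) (U := U)
  (u := u) (G := fun y x => e * (sgn_off b y * x)) (B := e ^+ 2 * n%:R) N1 _ _ _ _ mE _) _.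
- by move=> [[|[|[|]]] //] ?; rewrite /u /=; exact: measurable_indic.
- by move=> [[|[|[|]]] //] ? y; rewrite /u /= indicE.
- move=> [[|[|[|]]] //] ?; rewrite /u /U /=; first exact: integral_ind.
    by rewrite integral_indic// setIT.
  by rewrite integral_indic// setIT.
- move=> y x; rewrite !big_ord_recr big_ord0 /= !mul1r /th /u /= add0r mul0r expR0 mulr1 mulNr.
  rewrite indE sgn_offE /A /B !indicE !mem_setE !in_itv /= andbT ler_norml.
  have [h1|h1] := ltP b y; have [h2|h2] := ltP y (- b).
  + by move: b0 h1 h2; lra.
  + by rewrite andbF /= subr0 !mul1r mul0r addr0 add0r.
  + by rewrite /= sub0r !mul0r !mul1r mulN1r mulrN !add0r.
  + by rewrite /= subrr !mul0r mulr0 expR0 !addr0.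
- by move=> w /(ler_wpM2l e0); rewrite mulr_sumr expr2 -mulrA.
rewrite lee_fin !big_ord_recr big_ord0 /= !mul1r /th /U /= add0r sqrrN expr0n /= mul0r expR0 mulr1.
have e1 : 1 <= expR (e ^+ 2 / 2) by rewrite -[leLHS]expR0 ler_expR divr_ge0 ?sqr_ge0.
apply: (@le_trans _ _ (expR (- (e ^+ 2 * n%:R)) * expR (e ^+ 2 / 2) ^+ n)).
  have p0 := noise_mass_ge0 sigma b.
  move: (noise_mass sigma b) (expR (e ^+ 2 / 2)) p0 q1 e1 => p E p0 q1 e1.
  have E0 : 0 <= E by exact: le_trans e1.
  apply: ler_wpM2l; first exact: expR_ge0.
  apply: lerXn2r; rewrite ?nnegrE//; first by rewrite !addr_ge0 ?mulr_ge0.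
  have := ler_wpM2l p0 e1; have : (p + qA + qB) * E = E by rewrite q1 mul1r.
  lra.
rewrite -expRM_natl -expRD ler_expR; lra.
Qed.

End Events.

(** * Constants of the lower-tail bound *)

Section ExpLower.
Context {R : realType}.
Implicit Types x z : R.

Lemma expRN_le_quad z : - (1 / 2) <= z -> expR (- z) <= 1 - z + 2 * z ^+ 2.
Proof.
move=> hz; have z1 : - z < 1 by lra.
have h : 0 < 1 + z by lra.
apply: le_trans (expR_le_inv z1) _; rewrite opprK.
by rewrite -[leLHS]mul1r ler_pdivrMr//; have := sqr_ge0 z; nra.
Qed.

(** With [l = 1/1000], [exp (l (28/100 - |x|))] is expanded to second order by [expRN_le_quad]. The
    linear term, through [abs_ge_cosh], gives [395.28], [- 256.25] and [58.75]. The quadratic one,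
    through [x^2 <= 100 (exp (x/5) + exp (- x/5)) - 200], adds [- 0.4 + 0.0002] to the first and
    [0.2] to the second. *)
Definition lower_k0 : R := 394 + 88 / 100 + 2 / 100 / 100.
Definition lower_k1 : R := - (256 + 5 / 100).
Definition lower_k2 : R := 58 + 75 / 100.

Lemma expR_abs_lower x : expR (1 / 1000 * (28 / 100 - `|x|)) <=
  1 + 1 / 1000 * (lower_k0 + lower_k1 * (expR (1 / 5 * x) + expR (- 1 / 5 * x))
                     + lower_k2 * (expR (2 / 5 * x) + expR (- 2 / 5 * x))).
Proof.
have A := abs_ge_cosh x.
have S := sqr_le_cosh (1 / 5 * x).
rewrite (_ : - (1 / 5 * x) = - 1 / 5 * x) in S; last by field.
have x0 := normr_ge0 x; have x2 := real_normK (num_real x).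
have z1 : - (1 / 2) <= 1 / 1000 * (`|x| - 28 / 100) by move: x0; clear; lra.
have := expRN_le_quad z1.
rewrite (_ : - (1 / 1000 * (`|x| - 28 / 100)) = 1 / 1000 * (28 / 100 - `|x|)); last by ring.
move=> /le_trans; apply; rewrite /lower_k0 /lower_k1 /lower_k2.
move: (expR (1 / 5 * x) + expR (- 1 / 5 * x)) (expR (2 / 5 * x) + expR (- 2 / 5 * x)) A S x2 x0.
move: `|x| => a C1 C2; clear => A S x2 x0.
lra.
Qed.

(** [E] stands for [exp (1/50)], the mean of [exp (x/5)] for a standard normal [x], and [E^4] for
    the mean of [exp (2 x / 5)]. So the expansion sees a mean excess of [|x|] over [28/100] of at
    least [27/100]. *)
Lemma kappa_le (E : R) : 102 / 100 <= E -> E <= 50 / 49 ->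
  lower_k0 + 2 * lower_k1 * E + 2 * lower_k2 * E ^+ 4 <= - (27 / 100).
Proof.
rewrite /lower_k0 /lower_k1 /lower_k2 => E1 E2; pose x := E - 1.
have -> : E = 1 + x by rewrite /x; ring.
have x1 : 2 / 100 <= x by rewrite /x; lra.
have x2 : x <= 1 / 49 by rewrite /x; lra.
have h1 : x ^+ 2 <= (2 / 100 + 1 / 49) * x - 2 / 100 * (1 / 49).
  have : 0 <= (x - 2 / 100) * (1 / 49 - x) by rewrite mulr_ge0// subr_ge0.
  lra.
have x20 := sqr_ge0 x.
have h2 : x ^+ 3 <= 1 / 49 * x ^+ 2 by rewrite exprS ler_wpM2r.
have h3 : x ^+ 4 <= 1 / 49 * x ^+ 3.
  by rewrite exprS ler_wpM2r// exprn_ge0//; lra.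
clearbody x; move: x1 x2 h1 h2 h3; clear; lra.
Qed.

End ExpLower.

(** * Tails of the overtaken noises and lower tail of the band sum *)

Section LowerEvents.
Context {R : realType} {dT : measure_display} {T : measurableType dT}.
Variable P : probability T R.
Variables (n d1 d2 : nat) (sigma : R).
Variables (X : 'I_n -> 'I_d1 -> 'I_d2 -> {RV P >-> R}) (xi : 'I_n -> {RV P >-> R}).
Hypotheses (sigma0 : 0 < sigma) (model : gaussian_model sigma X xi).
Implicit Types (N : 'M[R]_(d1, d2)) (b t x y z : R).

(** After rescaling by [8 t sigma] the summands measure how far a shift of norm up to [4 sigma t]
    overtakes the noise; the 8 leaves the norm at most [1/2] that [uniform_pos] asks for. *)
Definition event_pos t N : set T :=
  [set w | 33 * t * n%:R <= \sum_(i < n)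
     Num.max 0 (`|inner N (design X w i)| - (8 * t * sigma)^-1 * `|xi i w|)].

(** The exponential of the positive part is at most [1 + exp (- l |xi|) (exp x + exp (- x))], and
    [exp (- l |xi|)] has mean at most [8 t]; the generating function is at most [1 + 32 t], so the
    threshold [33 t] leaves the rate [t]. *)
Lemma event_posP t N : 0 < t -> frob N = 1 ->
  measurable (event_pos t N) /\
  (P (event_pos t N) <= (expR (- (t * n%:R)))%:E)%E.
Proof.
move=> t0 N1; set l := (8 * t * sigma)^-1.
have l0 : 0 < l by rewrite invr_gt0 !mulr_gt0.
have mE : measurable (event_pos t N).
  apply: measurable_ge_set; apply: (@measurable_sum_design _ _ _ P n d1 d2 X xi N
    (fun y x : R => Num.max 0 (`|x| - l * `|y|))).
  apply: measurable_maxr => //; apply: measurable_funB.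
    by apply: measurableT_comp.
  by apply: measurable_funM => //; apply: measurableT_comp.
split=> //.
pose v y := expR (- l * `|y|).
have mv : measurable_fun setT v.
  by apply: measurableT_comp => //; apply: measurable_funM.
pose V := fine (\int[normal_prob 0 sigma]_y (v y)%:E).
have V_le := integral_expRN_abs sigma0 l0.
have V0 : (0 <= \int[normal_prob 0 sigma]_y (v y)%:E)%E.
  by apply: integral_ge0 => y _; rewrite lee_fin expR_ge0.
have VE : (\int[normal_prob 0 sigma]_y (v y)%:E = V%:E)%E.
  by rewrite /V fineK// ge0_fin_numE//; apply: le_lt_trans V_le _; rewrite ltry.
have Vt : V <= 8 * t.
  rewrite -lee_fin -VE; apply: le_trans V_le _; rewrite lee_fin /l le_eqVlt.
  by apply/orP; left; apply/eqP; field; rewrite !gt_eqF.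
have V0' : 0 <= V by rewrite -lee_fin -VE.
pose th (t : 'I_3) : R := nth 0 [:: 0; 1; - 1] t.
pose u (t : 'I_3) : R -> R := nth (fun=> 1) [:: fun=> 1; v; v] t.
pose U (t : 'I_3) : R := nth 0 [:: 1; V; V] t.
apply: le_trans (chernoff_design model (c := fun=> 1) (th := th) (U := U)
  (u := u) (G := fun y x => Num.max 0 (`|x| - l * `|y|)) (B := 33 * t * n%:R) N1 _ _ _ _ mE _) _.
- by move=> [[|[|[|]]] //] ?; rewrite /u /=; try exact: mv; exact: measurable_cst.
- by move=> [[|[|[|]]] //] ? y; rewrite /u /= ?ler01 /v ?expR_ge0.
- by move=> [[|[|[|]]] //] ?; rewrite /u /U /=; exact: integral_normal_prob1.
- move=> y x; rewrite !big_ord_recr big_ord0 /= !mul1r /th /u /= add0r mul0r expR0 ?mul1r ?mulN1r.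
  have h := expR_abs_le x.
  have vy0 : 0 <= v y by exact: expR_ge0.
  have [h1|h1] := leP (`|x| - l * `|y|) 0.
    by rewrite expR0 -addrA lerDl addr_ge0// mulr_ge0// expR_ge0.
  rewrite expRD -mulNr -/(v y) mulrC -addrA -mulrDr.
  by apply: le_trans (ler_wpM2l vy0 h) _; rewrite lerDr.
- by [].
rewrite lee_fin !big_ord_recr big_ord0 /= !mul1r /th /U /= add0r sqrrN expr0n /= mul0r expR0 ?mul1r ?mulr1 ?expr1n.
have h2 := @expR_half_le2 R.
apply: (@le_trans _ _ (expR (- (33 * t * n%:R)) * (1 + 32 * t) ^+ n)).
  rewrite ler_wpM2l ?expR_ge0// lerXn2r ?nnegrE ?addr_ge0 ?mulr_ge0 ?expR_ge0 ?(ltW t0)//.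
  by rewrite -addrA lerD2l; have := ler_wpM2l V0' h2; lra.
apply: le_trans (ler_wpM2l (expR_ge0 _) (expn_expR_le _ _)) _; first by lra.
rewrite -expRD ler_expR; lra.
Qed.

(* 28/100 is twice the half-width of the band in units of its scale, see
   abs_shift_lower. *)
Definition event_low b N : set T :=
  [set w | - (26 / 100 * noise_mass sigma b * n%:R) <=
    \sum_(i < n) ind b (xi i w) * (28 / 100 - `|inner N (design X w i)|)].

(** The rate is [l (27/100 - 26/100) p] with [l = 1/1000]; so small an [l] keeps the second-order
    terms of the expansion within the gap. *)
Lemma event_lowP b N : 0 <= b -> frob N = 1 ->
  measurable (event_low b N) /\
  (P (event_low b N) <= (expR (- (1 / 100 / 1000 * noise_mass sigma b * n%:R)))%:E)%E.
Proof.
move=> b0 N1; set p := noise_mass sigma b.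
have p0 : 0 <= p by exact: noise_mass_ge0.
have p1 : p <= 1 by exact: noise_mass_le1.
have mE : measurable (event_low b N).
  apply: measurable_ge_set; apply: (@measurable_sum_design _ _ _ P n d1 d2 X xi N
    (fun y x : R => ind b y * (28 / 100 - `|x|))).
  apply: measurable_funM; first by apply: measurableT_comp => //; exact: measurable_ind.
  by apply: measurable_funB => //; apply: measurableT_comp.
split=> //.
pose l : R := 1 / 1000; have l0 : 0 <= l by rewrite /l; lra.
pose th (t : 'I_6) : R := nth 0 [:: 0; 0; 1 / 5; - 1 / 5; 2 / 5; - 2 / 5] t.
pose c (t : 'I_6) : R := nth 0 [:: 1; l * lower_k0; l * lower_k1; l * lower_k1; l * lower_k2; l * lower_k2] t.
pose u (t : 'I_6) : R -> R := nth (fun=> 1) [:: fun=> 1; ind b; ind b; ind b; ind b; ind b] t.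
pose U (t : 'I_6) : R := nth 0 [:: 1; p; p; p; p; p] t.
apply: le_trans (chernoff_design model (c := c) (th := th) (U := U)
  (u := u) (G := fun y x => l * (ind b y * (28 / 100 - `|x|)))
  (B := - (l * (26 / 100 * p * n%:R))) N1 _ _ _ _ mE _) _.
- by move=> [[|[|[|[|[|[|]]]]]] //] ?; rewrite /u /=; try exact: measurable_ind; exact: measurable_cst.
- by move=> [[|[|[|[|[|[|]]]]]] //] ? y; rewrite /u /=; exact: ind_ge0.
- by move=> [[|[|[|[|[|[|]]]]]] //] ?; rewrite /u /U /=;
    first exact: integral_normal_prob1; exact: integral_ind.
- move=> y x; rewrite !big_ord_recr big_ord0 /= /th /u /c /= add0r mul0r expR0 !mul1r.
  have h := expR_abs_lower x.
  rewrite indE; case: (`|y| <= b) => /=; last by rewrite !(mul0r, mulr0, addr0) expR0.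
  have e5 : 5^-1 * x = 1 / 5 * x by rewrite div1r.
  rewrite !mul1r mulr1 e5; apply: le_trans h _; rewrite -/l.
  by rewrite le_eqVlt; apply/orP; left; apply/eqP; ring.
- move=> w h; rewrite -mulr_sumr -mulrN; exact: (ler_wpM2l l0 h).
rewrite lee_fin !big_ord_recr big_ord0 /= /th /U /c /= add0r expr0n /= mul0r expR0 ?mul1r ?mulr1.
have -> : 5^-1 ^+ 2 / 2 = 1 / 50 :> R by field.
have -> : (- 1 / 5) ^+ 2 / 2 = 1 / 50 :> R by field.
have -> : (2 / 5) ^+ 2 / 2 = 4%:R * (1 / 50) :> R by field.
have -> : (- 2 / 5) ^+ 2 / 2 = 4%:R * (1 / 50) :> R by field.
rewrite expRM_natl.
have E1 : 102 / 100 <= expR (1 / 50) :> R by apply: le_trans (expR_ge1Dx _); lra.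
have E2 : expR (1 / 50) <= 50 / 49 :> R.
  have h : 1 / 50 < 1 :> R by lra.
  apply: le_trans (expR_le_inv h) _.
  by have -> : 1 - 1 / 50 = 49 / 50 :> R; [field|rewrite invf_div].
have kap := kappa_le E1 E2.
have E0 := expR_ge0 (1 / 50 : R).
move: (expR (1 / 50)) kap E1 E2 E0 => E kap E1 E2 E0.
set Sg := (X in X ^+ n).
have SgE : Sg = 1 + l * p * (lower_k0 + 2 * lower_k1 * E + 2 * lower_k2 * E ^+ 4) by rewrite /Sg; ring.
(* Makes [Sg] nonnegative, so that the power [n] is monotone; with negative coefficients around,
   this is not immediate. *)
have kap_lb : - 1000 <= lower_k0 + 2 * lower_k1 * E + 2 * lower_k2 * E ^+ 4 :> R.
  have E4 : 0 <= E ^+ 4 by rewrite exprn_ge0.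
  by rewrite /lower_k0 /lower_k1 /lower_k2; move: E2 E4; lra.
have Sg0 : 0 <= Sg.
  rewrite SgE; have := ler_wpM2l p0 kap_lb; move: p1; rewrite /l; lra.
have Sgle : Sg <= 1 + - (27 / 100 * l * p).
  by rewrite SgE; have := ler_wpM2l (mulr_ge0 l0 p0) kap; lra.
apply: le_trans (ler_wpM2l (expR_ge0 _) (_ : Sg ^+ n <= (1 + - (27 / 100 * l * p)) ^+ n)) _.
  by rewrite lerXn2r ?nnegrE// (le_trans Sg0).
apply: le_trans (ler_wpM2l (expR_ge0 _) (expn_expR_le _ _)) _; first exact: le_trans Sgle.
by rewrite -expRD ler_expR /l; lra.
Qed.

End LowerEvents.

(** * Effect of a shift on one absolute residual *)

Section Pointwise.
Context {R : realType}.
Implicit Types b y t : R.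

(** Off the band, [|y - t|] is at least [sign(y) (y - t)]; inside, it is at least [|t| - |y|] with
    [|y| <= b]. *)
Lemma abs_shift_lower b y t : 0 <= b ->
  ind b y * (`|t| - 2 * b) - sgn_off b y * t <= `|y - t| - `|y|.
Proof.
move=> b0; rewrite indE sgn_offE ler_norml.
have [h1|h1] := ltP b y; have [h2|h2] := ltP y (- b); rewrite /=.
- by move: b0 h1 h2; lra.
- rewrite subr0 mul0r mul1r sub0r (ger0_norm (le_trans b0 (ltW h1))).
  by have := ler_norm (y - t); lra.
- have y0 : y < 0 by move: b0 h2; lra.
  rewrite sub0r mul0r mulN1r sub0r opprK (ltr0_norm y0).
  have := ler_norm (- (y - t)); rewrite normrN; lra.
- rewrite subrr mul0r subr0 mul1r.
  have yb : `|y| <= b by rewrite ler_norml h2.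
  have := ler_normB y (y - t); rewrite opprB addrCA subrr addr0; lra.
Qed.

(** Off the band the linear term [- sign(y) t] is exact unless [y - t] changes sign, which takes
    [|t| > |y|] and costs at most [2 (|t| - |y|)]. *)
Lemma abs_shift_upper b y t : 0 <= b ->
  `|y - t| - `|y| <= ind b y * `|t| - sgn_off b y * t + 2 * Num.max 0 (`|t| - `|y|).
Proof.
move=> b0; rewrite indE sgn_offE ler_norml.
have m0 : 0 <= Num.max 0 (`|t| - `|y|) by rewrite le_max lexx.
have m1 : `|t| - `|y| <= Num.max 0 (`|t| - `|y|) by rewrite le_max lexx orbT.
have [h1|h1] := ltP b y; have [h2|h2] := ltP y (- b); rewrite /=.
- by move: b0 h1 h2; lra.
- rewrite subr0 mul0r mul1r sub0r.
  move: m0 m1; rewrite (ger0_norm (le_trans b0 (ltW h1))) => m0 m1.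
  have := ler_norm t; have [h|h] := leP 0 (y - t).
    by rewrite (ger0_norm h); lra.
  by rewrite (ltr0_norm h); lra.
- have y0 : y < 0 by move: b0 h2; lra.
  rewrite sub0r mul0r mulN1r sub0r opprK.
  move: m0 m1; rewrite (ltr0_norm y0) => m0 m1.
  have := ler_norm (- t); rewrite normrN; have [h|h] := leP 0 (y - t).
    by rewrite (ger0_norm h); lra.
  by rewrite (ltr0_norm h); lra.
- rewrite subrr mul0r subr0 mul1r.
  have := ler_normB y t; lra.
Qed.

(* Convexity along rays: y |-> |xi - y| - |xi| vanishes at 0. *)
Lemma abs_shift_scale y t (k : R) : 1 <= k ->
  k * (`|y - t| - `|y|) <= `|y - k * t| - `|y|.
Proof.
move=> k1; have := ler_normD (y - k * t) ((k - 1) * y).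
have -> : y - k * t + (k - 1) * y = k * (y - t) by ring.
rewrite !normrM (ger0_norm (_ : 0 <= k)) ?(ger0_norm (_ : 0 <= k - 1)); lra.
Qed.

End Pointwise.

(** * From the net to all low-rank matrices *)

Section Uniform.
Context {R : realType} {n d1 d2 r : nat}.
Variables (X : 'I_n -> 'M[R]_(d1, d2)) (xi : 'I_n -> R) (s : seq 'M[R]_(d1, d2)).
Hypothesis s_rank : forall N, N \in s -> (\rank N <= r)%N.
Hypothesis s_net : forall N, (\rank N <= r)%N -> frob N = 1 ->
  exists2 N', N' \in s & frob (N - N') <= 1 / 1000.
Implicit Types N : 'M[R]_(d1, d2).

Let eps_rng : 0 < (1 / 1000 : R) < 1 / 2.
Proof. by apply/andP; split; lra. Qed.

Lemma uniform_linear (v : 'I_n -> R) B : 0 <= B ->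
  (forall N, N \in s -> \sum_i v i * inner N (X i) <= B) ->
  forall N, (\rank N <= r)%N -> 998 / 1000 * \sum_i v i * inner N (X i) <= B * frob N.
Proof.
move=> B0 sB N rkN.
have WE N0 : inner (\sum_i v i *: X i) N0 = \sum_i v i * inner N0 (X i).
  by rewrite inner_suml; apply: eq_bigr => i _; rewrite innerZl innerC.
have Ws N0 : N0 \in s -> inner (\sum_i v i *: X i) N0 <= B by rewrite WE; exact: sB.
have := net_dual eps_rng B0 s_rank s_net Ws rkN; rewrite WE; apply: le_trans.
by rewrite le_eqVlt; apply/orP; left; apply/eqP; congr (_ * _); lra.
Qed.

Lemma uniform_abs (v : 'I_n -> R) B : (forall i, 0 <= v i) -> 0 <= B ->
  (forall N, N \in s -> \sum_i v i * `|inner N (X i)| <= B) ->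
  forall N, (\rank N <= r)%N -> 998 / 1000 * \sum_i v i * `|inner N (X i)| <= B * frob N.
Proof.
move=> v0 B0 sB N rkN.
have -> : \sum_i v i * `|inner N (X i)| = \sum_i (v i * Num.sg (inner N (X i))) * inner N (X i).
  by apply: eq_bigr => i _; rewrite -mulrA -normrEsg.
apply: uniform_linear => // N0 sN0; apply: le_trans (sB N0 sN0).
apply: ler_sum => i _; rewrite -mulrA ler_wpM2l//.
apply: le_trans (ler_norm _) _; rewrite normrM ler_piMl// normr_sg.
by case: (_ == 0).
Qed.

Lemma uniform_pos c B : 0 <= c -> 0 <= B ->
  (forall N, N \in s -> \sum_i Num.max 0 (`|inner N (X i)| - c * `|xi i|) <= B) ->
  forall N, (\rank N <= r)%N -> frob N <= 1 / 2 ->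
    \sum_i Num.max 0 (`|inner N (X i)| - c * `|xi i|) <= B.
Proof.
move=> c0 B0 sB N rkN N1.
pose q i : R := (0 <= `|inner N (X i)| - c * `|xi i|)%R%:R.
pose beta := \sum_i q i * (c * `|xi i|).
have q0 i : 0 <= q i by [].
have beta0 : 0 <= beta by apply: sumr_ge0 => i _; rewrite !mulr_ge0.
have E : \sum_i Num.max 0 (`|inner N (X i)| - c * `|xi i|) =
    \sum_i q i * `|inner N (X i)| - beta.
  rewrite /beta -sumrB; apply: eq_bigr => i _; rewrite -mulrBr /q.
  by case: leP; rewrite ?mul1r ?mul0r.
have Bb N0 : N0 \in s -> \sum_i q i * `|inner N0 (X i)| <= B + beta.
  move=> sN0; rewrite -lerBlDr /beta -sumrB; apply: le_trans (sB N0 sN0).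
  apply: ler_sum => i _; rewrite -mulrBr le_max /q.
  by case: (0 <= _); rewrite ?mul1r ?mul0r lexx ?orbT.
have := uniform_abs q0 (addr_ge0 B0 beta0) Bb rkN; rewrite E.
have := ler_wpM2l (addr_ge0 B0 beta0) N1; lra.
Qed.

Variables (sigma t p : R).
Let b := 14 / 100 * (sigma * t).
Hypotheses (sigma0 : 0 < sigma) (t01 : 0 < t <= 1)
  (p_ge : 979 / 100 / 100 * t <= p) (p_le : p <= 14 / 100 * t).
Hypothesis net_ind : forall N, N \in s ->
  \sum_i ind b (xi i) * `|inner N (X i)| <= 5 * p * n%:R.
Hypothesis net_sgn : forall N, N \in s ->
  \sum_i sgn_off b (xi i) * inner N (X i) <= 2 / 1000 * t * n%:R.
Hypothesis net_pos : forall N, N \in s ->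
  \sum_i Num.max 0 (`|inner N (X i)| - (8 * t * sigma)^-1 * `|xi i|) <= 33 * t * n%:R.
Hypothesis net_low : forall N, N \in s ->
  \sum_i ind b (xi i) * (28 / 100 - `|inner N (X i)|) <= - (26 / 100 * p * n%:R).

Let t0 : 0 < t. Proof. by case/andP: t01. Qed.
Let p0 : 0 <= p.
Proof. by apply: le_trans p_ge; apply: mulr_ge0; [lra|exact: ltW]. Qed.
Let n0 : 0 <= n%:R :> R. Proof. by []. Qed.
Let st0 : 0 <= sigma * t. Proof. by rewrite mulr_ge0// ltW. Qed.
Let b0 : 0 <= b. Proof. by rewrite /b; apply: mulr_ge0; [lra|exact: st0]. Qed.
Let tn0 : 0 <= t * n%:R. Proof. by rewrite mulr_ge0// ltW. Qed.
Let pn_le : p * n%:R <= 14 / 100 * (t * n%:R).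
Proof. by rewrite mulrA ler_wpM2r. Qed.
Let pn_ge : 979 / 100 / 100 * (t * n%:R) <= p * n%:R.
Proof. by rewrite mulrA ler_wpM2r. Qed.
Let pn0 : 0 <= p * n%:R. Proof. exact: mulr_ge0. Qed.

Lemma uniform_ind N : (\rank N <= r)%N ->
  998 / 1000 * \sum_i ind b (xi i) * `|inner N (X i)| <= 5 * p * n%:R * frob N.
Proof.
apply: uniform_abs => //.
by rewrite -mulrA mulr_ge0.
Qed.

Lemma uniform_sgn N : (\rank N <= r)%N ->
  998 / 1000 * \sum_i sgn_off b (xi i) * inner N (X i) <= 2 / 1000 * t * n%:R * frob N.
Proof.
apply: uniform_linear; last exact: net_sgn.
by rewrite -mulrA; apply: mulr_ge0; [lra|exact: tn0].
Qed.

(** Budget per [t n]: the band gives [(26/100 - 10/998) * 979 / 10^4], about [0.0245], and the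
    signed sum takes [2/998]. The rounding errors [E1], [E2] go through [uniform_ind], so they too
    are proportional to the band mass. *)
Lemma excess_lower N : (\rank N <= r)%N -> frob N = 1 ->
  22 / 1000 * n%:R * t * (sigma * t) <=
  \sum_i (`|xi i - inner ((sigma * t) *: N) (X i)| - `|xi i|).
Proof.
move=> rkN N1; have [N' sN' Ne] := s_net rkN N1.
have [E1 [E2 [NE rk1 rk2 E1e E2e]]] := low_rank_split rkN (s_rank sN').
have lowN : 26 / 100 * (p * n%:R) - 2 * (5 / 998 * (p * n%:R)) <=
    \sum_i ind b (xi i) * (`|inner N (X i)| - 28 / 100).
  have e1 : \sum_i ind b (xi i) * `|inner E1 (X i)| <= 5 / 998 * (p * n%:R).
    have := uniform_ind rk1; have := ler_wpM2l pn0 (le_trans E1e Ne); lra.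
  have e2 : \sum_i ind b (xi i) * `|inner E2 (X i)| <= 5 / 998 * (p * n%:R).
    have := uniform_ind rk2; have := ler_wpM2l pn0 (le_trans E2e Ne); lra.
  have h : \sum_i ind b (xi i) * (`|inner N' (X i)| - 28 / 100)
      - \sum_i ind b (xi i) * `|inner E1 (X i)| - \sum_i ind b (xi i) * `|inner E2 (X i)|
      <= \sum_i ind b (xi i) * (`|inner N (X i)| - 28 / 100).
    rewrite -!sumrB; apply: ler_sum => i _; rewrite -!mulrBr ler_wpM2l ?ind_ge0//.
    rewrite NE !innerDl.
    move: (inner N' (X i)) (inner E1 (X i)) (inner E2 (X i)) => u v w.
    have := ler_normB (u + v + w) (v + w); have -> : u + v + w - (v + w) = u by ring.
    by have := ler_normD v w; lra.
  have := net_low sN'.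
  rewrite (_ : \sum_i _ = - \sum_i ind b (xi i) * (`|inner N' (X i)| - 28 / 100)); last first.
    by rewrite -sumrN; apply: eq_bigr => i _; rewrite -mulrN opprB.
  lra.
have sg := uniform_sgn rkN; rewrite N1 mulr1 in sg.
apply: le_trans (_ : (sigma * t) * (\sum_i ind b (xi i) * (`|inner N (X i)| - 28 / 100)
    - \sum_i sgn_off b (xi i) * inner N (X i)) <= _).
  rewrite mulrC ler_wpM2l//; move: (pn_ge) (tn0) lowN sg; lra.
rewrite -sumrB mulr_sumr; apply: ler_sum => i _.
have := abs_shift_lower (xi i) (inner ((sigma * t) *: N) (X i)) b0.
rewrite innerZl normrM (ger0_norm st0) /b; lra.
Qed.

(** The three parts cost [3], [1] and [2 * 264], the last for the overtaken noises, with
    [264 = 8 * 33]. *)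
Lemma excess_upper N : (\rank N <= r)%N -> frob N <= 4 * (sigma * t) ->
  \sum_i (`|xi i - inner N (X i)| - `|xi i|) <= 600 * n%:R * (sigma * t) * t.
Proof.
move=> rkN Ns.
have st : 0 < sigma * t by rewrite mulr_gt0.
have h1 : \sum_i ind b (xi i) * `|inner N (X i)| <= 3 * (t * n%:R * (sigma * t)).
  have := uniform_ind rkN; have := ler_wpM2l pn0 Ns; have := ler_wpM2r st0 pn_le.
  have := mulr_ge0 tn0 st0; lra.
have h2 : - \sum_i sgn_off b (xi i) * inner N (X i) <= 1 * (t * n%:R * (sigma * t)).
  have := @uniform_sgn (- N); rewrite -scaleN1r rankZ_leq// => /(_ isT).
  rewrite frobZ normrN1 mul1r.
  rewrite (_ : \sum_i _ = - \sum_i sgn_off b (xi i) * inner N (X i)); last first.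
    by rewrite -sumrN; apply: eq_bigr => i _; rewrite innerZl mulN1r mulrN.
  have := ler_wpM2l tn0 Ns; have := mulr_ge0 tn0 st0; lra.
have h3 : \sum_i Num.max 0 (`|inner N (X i)| - `|xi i|) <= 264 * (t * n%:R * (sigma * t)).
  pose k := 8 * (sigma * t); have k0 : 0 < k by rewrite mulr_gt0.
  have kE : (8 * t * sigma)^-1 = k^-1 by rewrite /k -mulrA (mulrC t).
  have := @uniform_pos k^-1 (33 * t * n%:R) _ _ _ (k^-1 *: N) _ _.
  rewrite (_ : \sum_i _ = k^-1 * \sum_i Num.max 0 (`|inner N (X i)| - `|xi i|)); last first.
    rewrite mulr_sumr; apply: eq_bigr => i _.
    have ki : 0 <= k^-1 by rewrite invr_ge0 ltW.
    by rewrite innerZl normrM (ger0_norm ki) -mulrBr maxr_pMr// mulr0.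
  rewrite ler_pdivrMl// => H; have {H} : \sum_i Num.max 0 (`|inner N (X i)| - `|xi i|) <=
    k * (33 * t * n%:R).
    apply: H.
    - by rewrite invr_ge0 ltW.
    - by rewrite -mulrA mulr_ge0.
    - by move=> N0 sN0; rewrite -kE; exact: net_pos.
    - exact: rankZ_leq.
    - rewrite frobZ ger0_norm ?invr_ge0 ?(ltW k0)// ler_pdivrMl// /k; move: Ns; lra.
  by rewrite /k; lra.
apply: le_trans (_ : \sum_i (ind b (xi i) * `|inner N (X i)| - sgn_off b (xi i) * inner N (X i)
    + 2 * Num.max 0 (`|inner N (X i)| - `|xi i|)) <= _).
  by apply: ler_sum => i _; exact: abs_shift_upper.
rewrite big_split /= sumrB -mulr_sumr.
have := mulr_ge0 tn0 st0; lra.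
Qed.

End Uniform.

(** * Union bounds over the net and the dyadic scales *)

Section UnionBound.
Context {R : realType}.

Lemma measureU2_le (dT : measure_display) (T : measurableType dT) (P : probability T R)
    (A B : set T) (a b : R) : measurable A -> measurable B ->
  (P A <= a%:E -> P B <= b%:E -> P (A `|` B) <= (a + b)%:E)%E.
Proof.
move=> mA mB Aa Bb; rewrite EFinD; apply: (@le_trans _ _ (P A + P B)%E).
  by apply: measureU2.
exact: leeD.
Qed.

Lemma union_bound (dT : measure_display) (T : measurableType dT) (P : probability T R)
    (I : eqType) (L : seq I) (A : I -> set T) (x : I -> R) :
  (forall i, i \in L -> measurable (A i) /\ (P (A i) <= (x i)%:E)%E) ->
  exists U, [/\ measurable U, (forall i, i \in L -> A i `<=` U) &
    (P U <= (\sum_(i <- L) x i)%:E)%E].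
Proof.
elim: L => [|i L IH] H.
  by exists set0; split; rewrite ?big_nil ?measure0.
have [|U [mU AU PU]] := IH; first by move=> k kL; apply: H; rewrite inE kL orbT.
have [mA PA] := H i (mem_head _ _).
exists (A i `|` U); split.
- exact: measurableU.
- move=> k; rewrite inE => /predU1P[->|/AU kU]; first by left.
  by apply: subset_trans kU _; right.
- by rewrite big_cons; exact: measureU2_le.
Qed.

(** Doubling the scale squares the term, which is at most [1/2] since [be * s >= 1]; the finest
    scale dominates and the number of scales does not enter. *)
Lemma sum_expR_dyadic (be s : R) J : 1 <= be * s -> 0 <= be ->
  \sum_(j < J | s <= 2 ^- j) expR (- (be * 2 ^- j)) <= 2 * expR (- (be * s)).
Proof.
move=> bs be0.
have all_in K : s <= 2 ^- K ->
    \sum_(j < K.+1 | s <= 2 ^- j) expR (- (be * 2 ^- j)) <= 2 * expR (- (be * 2 ^- K)).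
  elim: K => [|K IH] sK.
    rewrite big_mkcond big_ord_recr big_ord0 /= sK add0r.
    by rewrite ler_peMl ?expR_ge0// ler1n.
  have hK : 2 ^- K = 2 * 2 ^- K.+1 :> R by rewrite exprS invfM mulrA divff ?mul1r.
  have p0 : 0 <= 2 ^- K.+1 :> R by rewrite invr_ge0 exprn_ge0.
  have sK' : s <= 2 ^- K.
    by apply: le_trans sK _; rewrite hK; move: p0; move: (2 ^- K.+1) => y; lra.
  rewrite big_mkcond big_ord_recr /= -big_mkcond /= sK.
  apply: le_trans (lerD (IH sK') (lexx _)) _.
  have x1 : 1 <= be * 2 ^- K.+1 by apply: le_trans bs _; rewrite ler_wpM2l.
  rewrite hK; move: (2 ^- K.+1) x1 => y x1.
  have -> : - (be * (2 * y)) = - (be * y) + - (be * y) by ring.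
  rewrite expRD.
  have h : 2 * expR (- (be * y)) <= 1.
    rewrite expRN -ler_pdivlMr ?invr_gt0 ?expR_gt0// invrK mul1r.
    by apply: le_trans (expR_ge1Dx _); lra.
  have := ler_wpM2r (expR_ge0 (- (be * y))) h; lra.
elim: J => [|J IH]; first by rewrite big_ord0 mulr_ge0 ?expR_ge0.
have [sJ|sJ] := leP s (2 ^- J).
  by apply: le_trans (all_in J sJ) _; rewrite ler_pM2l// ler_expR lerN2 ler_wpM2l.
by rewrite big_mkcond big_ord_recr /= -big_mkcond /= (lt_geF sJ) addr0.
Qed.

End UnionBound.

(** * The good event *)

Section GoodEvent.
Context {R : realType} {dT : measure_display} {T : measurableType dT}.
Variable P : probability T R.
Variables (n d1 d2 : nat) (sigma : R).
Variables (X : 'I_n -> 'I_d1 -> 'I_d2 -> {RV P >-> R}) (xi : 'I_n -> {RV P >-> R}).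
Hypotheses (sigma0 : 0 < sigma) (model : gaussian_model sigma X xi).
Implicit Types (N : 'M[R]_(d1, d2)) (t : R).

Definition band t : R := 14 / 100 * (sigma * t).

(** Just below [979 / 10^4 / 10^5], the constant in the exponent of [event_low], the smallest of the
    four. *)
Definition rate : R := 9 / 10 / 1000 / 1000.

Lemma band_ge0 t : 0 <= t -> 0 <= band t.
Proof.
move=> t0; have st : 0 <= sigma * t by rewrite mulr_ge0// ltW.
by apply: mulr_ge0 => //; lra.
Qed.

Lemma band_mass_le t : 0 <= t -> noise_mass sigma (band t) <= 14 / 100 * t.
Proof.
move=> t0; apply: le_trans (noise_mass_le sigma0 (band_ge0 t0)) _.
rewrite /band le_eqVlt; apply/orP; left; apply/eqP; field; rewrite gt_eqF//.
Qed.

Lemma band_mass_ge t : 0 <= t <= 1 -> 979 / 100 / 100 * t <= noise_mass sigma (band t).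
Proof.
move=> /andP[t0 t1].
have bs : band t <= sigma.
  have h : 14 / 100 * t <= 1 by lra.
  have -> : band t = sigma * (14 / 100 * t) by rewrite /band; ring.
  by rewrite ger_pMr.
apply: le_trans (noise_mass_ge sigma0 (band_ge0 t0) bs).
have -> : band t / sigma = 14 / 100 * t by rewrite /band; field; rewrite gt_eqF.
have -> : 2 * band t / (283 / 100 * sigma) = 28 / 283 * t.
  by rewrite /band; field; rewrite gt_eqF.
have tt : t ^+ 2 <= 1 by rewrite expr_le1.
have h : 990 / 1000 <= 1 - (14 / 100 * t) ^+ 2 / 2 by lra.
have t28 : 0 <= 28 / 283 * t by lra.
have := ler_wpM2l t28 h; lra.
Qed.

Definition net_good (s : seq 'M[R]_(d1, d2)) t w :=
  [/\ forall N, N \in s -> \sum_i ind (band t) (xi i w) * `|inner N (design X w i)|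
        <= 5 * noise_mass sigma (band t) * n%:R,
      forall N, N \in s -> \sum_i sgn_off (band t) (xi i w) * inner N (design X w i)
        <= 2 / 1000 * t * n%:R,
      forall N, N \in s -> \sum_i Num.max 0 (`|inner N (design X w i)|
          - (8 * t * sigma)^-1 * `|xi i w|) <= 33 * t * n%:R &
      forall N, N \in s -> \sum_i ind (band t) (xi i w) * (28 / 100 - `|inner N (design X w i)|)
        <= - (26 / 100 * noise_mass sigma (band t) * n%:R)].

(** The signed sum has an exponent of order [t^2], the others of order [t]. Up to constants [s0 * t]
    is below both, and it is linear in [t], as [sum_expR_dyadic] requires. *)
Lemma scale_event N t (s0 : R) : frob N = 1 -> 0 < s0 <= t -> t <= 1 -> exists U : set T,
  [/\ measurable U, (P U <= (4 * expR (- (rate * n%:R * s0 * t)))%:E)%E &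
    event_ind sigma X xi (band t) N `|` event_sgn X xi (band t) (2 / 1000 * t) N `|`
    event_pos sigma X xi t N `|` event_low sigma X xi (band t) N `<=` U].
Proof.
move=> N1 /andP[s00 s0t] t1.
have t0 : 0 < t by exact: lt_le_trans s0t.
have b0 := band_ge0 (ltW t0).
have e0 : 0 <= 2 / 1000 * t by move: t0; lra.
have [m1 P1] := event_indP model b0 N1.
have [m2 P2] := event_sgnP model b0 e0 N1.
have [m3 P3] := event_posP sigma0 model t0 N1.
have [m4 P4] := event_lowP model b0 N1.
exists (event_ind sigma X xi (band t) N `|` event_sgn X xi (band t) (2 / 1000 * t) N `|`
    event_pos sigma X xi t N `|` event_low sigma X xi (band t) N); split => //.
  by do 3!apply: measurableU => //.
have tn : 0 <= t * n%:R by rewrite mulr_ge0// ltW.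
have s0tn : s0 * (t * n%:R) <= 1 * (t * n%:R) by rewrite ler_wpM2r// (le_trans s0t).
have ttn : s0 * (t * n%:R) <= t * (t * n%:R) by rewrite ler_wpM2r.
have pn : 979 / 100 / 100 * t * n%:R <= noise_mass sigma (band t) * n%:R.
  by rewrite ler_wpM2r// band_mass_ge// t1 ltW.
have le4 (x : R) : rate * n%:R * s0 * t <= x ->
    ((expR (- x))%:E <= (expR (- (rate * n%:R * s0 * t)))%:E)%E.
  by move=> h; rewrite lee_fin ler_expR lerN2.
have {}P1 : (P (event_ind sigma X xi (band t) N) <= (expR (- (rate * n%:R * s0 * t)))%:E)%E.
  by apply: le_trans P1 (le4 _ _); rewrite /rate; move: pn s0tn tn; lra.
have {}P2 : (P (event_sgn X xi (band t) (2 / 1000 * t) N) <= (expR (- (rate * n%:R * s0 * t)))%:E)%E.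
  by apply: le_trans P2 (le4 _ _); rewrite /rate; have := mulr_ge0 (ltW t0) tn; move: ttn; lra.
have {}P3 : (P (event_pos sigma X xi t N) <= (expR (- (rate * n%:R * s0 * t)))%:E)%E.
  by apply: le_trans P3 (le4 _ _); rewrite /rate; move: s0tn tn; lra.
have {}P4 : (P (event_low sigma X xi (band t) N) <= (expR (- (rate * n%:R * s0 * t)))%:E)%E.
  by apply: le_trans P4 (le4 _ _); rewrite /rate; move: pn s0tn tn; lra.
move: (expR _) P1 P2 P3 P4 => y P1 P2 P3 P4.
have -> : 4 * y = y + y + y + y by ring.
have m12 := measurableU _ _ m1 m2; have m123 := measurableU _ _ m12 m3.
apply: measureU2_le m123 m4 _ P4; apply: measureU2_le m12 m3 _ P3.
exact: measureU2_le m1 m2 P1 P2.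
Qed.

Lemma net_good_event (s : seq 'M[R]_(d1, d2)) (s0 : R) :
  (forall N, N \in s -> frob N = 1) -> 0 < s0 <= 1 -> 1 <= rate * n%:R * s0 ^+ 2 ->
  exists U : set T, [/\ measurable U,
    (P U <= ((size s)%:R * (expR (- (45 / 1000 * n%:R))
                         + 8 * expR (- (rate * n%:R * s0 ^+ 2))))%:E)%E &
    forall w, ~ U w ->
      (forall N, N \in s -> \sum_i `|inner N (design X w i)| <= 13 / 10 * n%:R) /\
      forall j, s0 <= 2 ^- j -> net_good s (2 ^- j) w].
Proof.
move=> s1 /andP[s00 s01] big.
(* [2^-j >= s0] forces [j < 2^j <= 1 / s0], so finitely many scales occur. *)
pose J := (Num.truncn s0^-1).+1.
have Jbig j : s0 <= 2 ^- j -> (j < J)%N.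
  move=> sj; rewrite /J ltnS; apply: leq_trans (ltnW (ltn_expl j (ltnSn 1))) _.
  rewrite truncn_ge_nat ?invr_ge0 ?(ltW s00)// natrX.
  by rewrite -[leLHS]invrK lef_pV2 ?posrE ?invr_gt0 ?exprn_gt0.
have rate0 : 0 <= rate by rewrite /rate; lra.
have per_N N : N \in s -> exists U : set T, [/\ measurable U,
    (P U <= (expR (- (45 / 1000 * n%:R)) + 8 * expR (- (rate * n%:R * s0 ^+ 2)))%:E)%E &
    event_abs X N `<=` U /\ forall j, s0 <= 2 ^- j ->
      event_ind sigma X xi (band (2 ^- j)) N
      `|` event_sgn X xi (band (2 ^- j)) (2 / 1000 * 2 ^- j) N
      `|` event_pos sigma X xi (2 ^- j) N `|` event_low sigma X xi (band (2 ^- j)) N `<=` U].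
  move=> sN; have N1 := s1 N sN.
  have [mA PA] := event_absP model N1.
  have hj (j : 'I_J) : exists U : set T, s0 <= 2 ^- j ->
     [/\ measurable U, (P U <= (4 * expR (- (rate * n%:R * s0 * 2 ^- j)))%:E)%E &
       event_ind sigma X xi (band (2 ^- j)) N
      `|` event_sgn X xi (band (2 ^- j)) (2 / 1000 * 2 ^- j) N
      `|` event_pos sigma X xi (2 ^- j) N `|` event_low sigma X xi (band (2 ^- j)) N `<=` U].
    have [sj|sj] := leP s0 (2 ^- j); last by exists set0.
    have [||U HU] := @scale_event N (2 ^- j) s0 N1; first by rewrite s00.
      by rewrite invf_le1 ?exprn_gt0// exprn_ege1// ler1n.
    by exists U.
  have [U HU] := choice hj.
  have [|V [mV UV PV]] := @union_bound _ _ _ P _ [seq j <- index_enum 'I_J | s0 <= 2 ^- (val j)] U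
     (fun j => 4 * expR (- (rate * n%:R * s0 * 2 ^- (val j)))).
    by move=> j; rewrite mem_filter => /andP[/HU[]].
  exists (event_abs X N `|` V); split.
  - exact: measurableU.
  - apply: measureU2_le => //; apply: le_trans PV _; rewrite lee_fin big_filter -mulr_sumr.
    have bE : rate * n%:R * s0 * s0 = rate * n%:R * s0 ^+ 2 by rewrite expr2 mulrA.
    have be0 : 0 <= rate * n%:R * s0.
      by apply: mulr_ge0 (ltW s00); apply: mulr_ge0.
    have := @sum_expR_dyadic R (rate * n%:R * s0) s0 J; rewrite bE => /(_ big be0).
    by move: (\sum_(j < J | _) _) (expR _) => x y; lra.
  - split; first by left.
    move=> j sj; have [_ _ sub] := HU (Ordinal (Jbig j sj)) sj.
    apply: subset_trans sub _; apply: subset_trans (UV _ _) _; last by right.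
    by rewrite mem_filter sj mem_index_enum.
have hN N : exists U : set T, N \in s -> [/\ measurable U,
    (P U <= (expR (- (45 / 1000 * n%:R)) + 8 * expR (- (rate * n%:R * s0 ^+ 2)))%:E)%E &
    event_abs X N `<=` U /\ forall j, s0 <= 2 ^- j ->
      event_ind sigma X xi (band (2 ^- j)) N
      `|` event_sgn X xi (band (2 ^- j)) (2 / 1000 * 2 ^- j) N
      `|` event_pos sigma X xi (2 ^- j) N `|` event_low sigma X xi (band (2 ^- j)) N `<=` U].
  have [/per_N[U HU]|Ns] := boolP (N \in s); first by exists U.
  by exists set0.
have [U HU] := choice hN.
have [|V [mV UV PV]] := @union_bound _ _ _ P _ s U
   (fun=> expR (- (45 / 1000 * n%:R)) + 8 * expR (- (rate * n%:R * s0 ^+ 2))).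
  by move=> N /HU[].
exists V; split => //.
  by move: PV; rewrite big_const_seq count_predT iter_addr_0; set z := _ + _; rewrite mulr_natl.
move=> w nV.
have nU N : N \in s -> ~ U N w by move=> sN UN; apply: nV; exact: UV UN.
split.
  move=> N sN; have [_ _ [sub _]] := HU N sN.
  by rewrite leNgt; apply/negP => /ltW h; apply: (nU N sN); exact: sub.
move=> j sj; split=> N sN; have [_ _ [_ /(_ j sj) sub]] := HU N sN;
  rewrite leNgt; apply/negP => /ltW h; apply: (nU N sN); apply: sub.
- by left; left; left.
- by left; left; right.
- by left; right.
- by right.
Qed.

End GoodEvent.

Lemma dyadic_scale {R : realType} (x : R) : 0 < x <= 1 ->
  exists j : nat, 2 ^- j <= x < 2 * 2 ^- j.
Proof.
move=> /andP[x0 x1].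
have ex : exists j : nat, 2 ^- j <= x.
  exists (Num.truncn x^-1).+1.
  rewrite -[leRHS]invrK lef_pV2 ?posrE ?invr_gt0 ?exprn_gt0//.
  apply: le_trans (ltW (truncnS_gt _)) _.
  by rewrite -natrX ler_nat; apply: ltnW (ltn_expl _ _).
have := ex_minnP ex; case=> -[|j] xj minj.
  by exists 0%N; rewrite xj expr0 invr1 mulr1; move: x1; lra.
exists j.+1; rewrite xj exprS invfM mulrA divff// mul1r ltNge.
by apply/negP => /minj; rewrite ltnn.
Qed.

(** * Landscape of the loss on the good event *)

Section Landscape.
Context {R : realType} {dT : measure_display} {T : measurableType dT}.
Variable P : probability T R.
Variables (n d1 d2 r : nat) (sigma s0 tau : R) (Mstar : 'M[R]_(d1, d2)).
Variables (X : 'I_n -> 'I_d1 -> 'I_d2 -> {RV P >-> R}) (xi : 'I_n -> {RV P >-> R}).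
Variables (s : seq 'M[R]_(d1, d2)) (w : T) (Y : 'I_n -> R).
Hypothesis s_rank : forall N, N \in s -> (\rank N <= r)%N.
Hypothesis s_net : forall N, (\rank N <= r)%N -> frob N = 1 ->
  exists2 N', N' \in s & frob (N - N') <= 1 / 1000.
Hypotheses (sigma0 : 0 < sigma) (tau0 : 0 < tau) (s01 : s0 <= 1)
  (s0E : s0 = tau / (2 * sigma)).
Hypothesis net_abs : forall N, N \in s ->
  \sum_i `|inner N (design X w i)| <= 13 / 10 * n%:R.
Hypothesis net_band : forall j, s0 <= 2 ^- j -> net_good sigma X xi s (2 ^- j) w.
Hypothesis YE : forall i, Y i = inner (design X w i) Mstar + xi i w.
Implicit Types (A B N : 'M[R]_(d1, d2)) (t : R).

Let f := abs_loss (design X w) Y.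

Lemma loss_excess A : f A - f Mstar =
  \sum_i (`|xi i w - inner (A - Mstar) (design X w i)| - `|xi i w|).
Proof.
rewrite /f /abs_loss -sumrB; apply: eq_bigr => i _.
rewrite YE innerBl !(innerC (design X w i)) [inner Mstar _ + _]addrC addrK.
by congr (`|_| - _); rewrite opprB addrA.
Qed.

Lemma loss_lipschitz A N : (\rank N <= r)%N ->
  f (A + N) - f A <= 14 / 10 * n%:R * frob N.
Proof.
move=> rkN; apply: (@le_trans _ _ (\sum_i 1 * `|inner N (design X w i)|)).
  rewrite /f /abs_loss -sumrB; apply: ler_sum => i _.
  rewrite mul1r innerDl lerBlDr opprD addrA.
  by rewrite [leRHS]addrC; exact: ler_normB.
have B0 : 0 <= 13 / 10 * n%:R :> R by apply: mulr_ge0 => //; lra.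
have nf : 0 <= n%:R * frob N by rewrite mulr_ge0// frob_ge0.
have H : 998 / 1000 * \sum_i 1 * `|inner N (design X w i)| <= 13 / 10 * n%:R * frob N.
  apply: (uniform_abs s_rank s_net (v := fun=> 1) _ B0) => // N0 sN0.
  by apply: le_trans (net_abs sN0); apply: ler_sum => i _; rewrite mul1r.
by move: H nf; move: (\sum_i _) => S; lra.
Qed.

Lemma dyadic_rng j : 0 < (2 ^- j : R) <= 1.
Proof. by rewrite invr_gt0 exprn_gt0//= invf_le1 ?exprn_gt0// exprn_ege1// ler1n. Qed.

Lemma loss_lower j A : s0 <= 2 ^- j -> (\rank (A - Mstar)%R <= r)%N ->
  sigma * 2 ^- j <= frob (A - Mstar) ->
  22 / 1000 * n%:R * 2 ^- j * frob (A - Mstar) <= f A - f Mstar.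
Proof.
move=> /net_band[h1 h2 h3 h4] rkN; rewrite loss_excess.
move: (A - Mstar) rkN => N rkN; have trng := dyadic_rng j.
move: (2 ^- j) trng h1 h2 h3 h4 => t trng h1 h2 h3 h4 tN.
have t0 : 0 < t by case/andP: trng.
have st0 : 0 < sigma * t by rewrite mulr_gt0.
have F0 : 0 < frob N by exact: lt_le_trans tN.
pose k := frob N / (sigma * t).
have k1 : 1 <= k by rewrite ler_pdivlMr// mul1r.
have rk1 : (\rank ((frob N)^-1 *: N) <= r)%N by exact: rankZ_leq.
have N1 : frob ((frob N)^-1 *: N) = 1.
  by rewrite frobZ ger0_norm ?invr_ge0 ?frob_ge0// mulVf// gt_eqF.
have t01 : 0 <= t <= 1 by rewrite ltW//=; case/andP: trng.
have low := excess_lower s_rank s_net sigma0 trng (band_mass_ge sigma0 t01) h1 h2 h4 rk1 N1.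
have kst : k * (sigma * t) = frob N by rewrite /k divfK// gt_eqF.
apply: (@le_trans _ _ (k * (22 / 1000 * n%:R * t * (sigma * t)))).
  by rewrite -kst le_eqVlt; apply/orP; left; apply/eqP; ring.
apply: le_trans (ler_wpM2l (le_trans ler01 k1) low) _.
rewrite mulr_sumr; apply: ler_sum => i _.
apply: le_trans (abs_shift_scale _ _ k1) _.
rewrite -innerZl !scalerA kst divff ?gt_eqF// scale1r.
exact: lexx.
Qed.

(** The dyadic scale below [x / sigma] may be as small as half of it, whence the 2 in
    [s0 = tau / (2 sigma)] and the halving of [22/1000] in [loss_near]. *)
Lemma s0_le t x : tau <= x -> x / sigma < 2 * t -> s0 <= t.
Proof.
move=> tx; rewrite ltr_pdivrMr// => xt.
rewrite s0E ler_pdivrMr ?mulr_gt0//; move: tx xt; lra.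
Qed.

Lemma scale_rng x : tau <= x < sigma -> 0 < x / sigma <= 1.
Proof.
case/andP => tx xs; have x0 := lt_le_trans tau0 tx.
by rewrite divr_gt0//= ler_pdivrMr// mul1r ltW.
Qed.

Lemma loss_near A : (\rank (A - Mstar)%R <= r)%N -> tau <= frob (A - Mstar) < sigma ->
  11 / 1000 * n%:R * frob (A - Mstar) ^+ 2 / sigma <= f A - f Mstar.
Proof.
move=> rkA F; have [j /andP[jl ju]] := dyadic_scale (scale_rng F).
have /andP[tF _] := F.
have sj : sigma * 2 ^- j <= frob (A - Mstar) by rewrite mulrC -ler_pdivlMr.
apply: le_trans (loss_lower (s0_le tF ju) rkA sj).
have nF : 0 <= n%:R * frob (A - Mstar) by rewrite mulr_ge0// frob_ge0.
have := ler_wpM2l nF (ltW ju).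
move: (2 ^- j) (frob _) => t F1; lra.
Qed.

Lemma loss_far A : (\rank (A - Mstar)%R <= r)%N -> sigma <= frob (A - Mstar) ->
  22 / 1000 * n%:R * frob (A - Mstar) <= f A - f Mstar.
Proof.
move=> rkA F; have := @loss_lower 0 A.
by rewrite expr0 invr1 !mulr1; apply.
Qed.

Lemma loss_upper B d : (\rank (B - Mstar)%R <= r)%N -> tau <= d < sigma ->
  frob (B - Mstar) <= 2 * d -> f B - f Mstar <= 600 * n%:R * d ^+ 2 / sigma.
Proof.
move=> rkB dr Bd; have [j /andP[jl ju]] := dyadic_scale (scale_rng dr).
have /andP[td _] := dr.
have [h1 h2 h3 h4] := net_band (s0_le td ju).
rewrite loss_excess; have trng := dyadic_rng j.
have t01 : 0 <= (2 ^- j : R) <= 1 by case/andP: trng => /ltW -> ->.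
have dlt : d < 2 * (sigma * 2 ^- j).
  by move: ju; rewrite ltr_pdivrMr// -mulrA (mulrC _ sigma).
have B4 : frob (B - Mstar) <= 4 * (sigma * 2 ^- j).
  by apply: le_trans Bd _; move: dlt; lra.
have t0 : 0 <= (2 ^- j : R) by case/andP: t01.
apply: le_trans (excess_upper s_rank s_net sigma0 trng (band_mass_ge sigma0 t01)
  (band_mass_le sigma0 t0) h1 h2 h3 rkB B4) _.
have dj : sigma * 2 ^- j <= d by rewrite mulrC -ler_pdivlMr.
have d0 : 0 <= d by apply: le_trans td; exact: ltW.
have dd : sigma * 2 ^- j * 2 ^- j <= d * (d / sigma).
  by apply: ler_pM => //; rewrite mulr_ge0// ltW.
have n0 : 0 <= 600 * n%:R :> R by rewrite -natrM ler0n.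
move: (600 * _) n0 => k k0.
rewrite -[k * _ * _]mulrA; apply: le_trans (ler_wpM2l k0 dd) _.
by rewrite -[leRHS]mulrA expr2 -mulrA lexx.
Qed.

End Landscape.

(** * Iteration counts and failure probability *)

Section Counting.
Context {R : realType}.

(** Rounding [x / q] up adds at most 1, hence at most [x / L]: a lower bound on the logarithm is
    what keeps the upper [Theta] constant absolute. *)
Lemma geometric_steps (q L x : R) : 0 < q < 1 -> 0 < L <= x ->
  exists l : nat, theta_between q^-1 (q^-1 + L^-1) x l /\ (1 - q) ^+ l <= expR (- x).
Proof.
move=> /andP[q0 q1] /andP[L0 Lx]; have x0 : 0 < x by exact: lt_le_trans Lx.
have xq : 0 <= q^-1 * x by rewrite mulr_ge0 ?invr_ge0 ?(ltW q0) ?(ltW x0).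
exists (Num.truncn (q^-1 * x)).+1.
have ge := ltW (truncnS_gt (q^-1 * x)).
split.
  rewrite /theta_between ge mulrDl -natr1 lerD//.
    by rewrite truncn_le.
  by rewrite ler_pdivlMl// mulr1.
have q10 : 0 <= 1 - q by lra.
move: (_.+1) ge => l ge.
apply: le_trans (_ : expR (- q) ^+ l <= _).
  by rewrite lerXn2r ?nnegrE ?expR_ge0// expR_ge1Dx.
rewrite -expRM_natl ler_expR mulrN lerN2.
by rewrite mulrC -ler_pdivrMl.
Qed.

(** [A * D] is the entropy of the net. Of the surplus [5 D] in the exponent, [4 D] pays for the
    factor 9 and the rest covers [D / 2]. *)
Lemma failure_probability (A C1 C2 D n s0 size : R) :
  0 <= size <= expR (A * D) -> 1 <= D -> C1 * D <= n -> n * s0 ^+ 2 = C2 ^+ 2 * D / 4 ->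
  A + 5 <= 45 / 1000 * C1 -> A + 5 <= rate * (C2 ^+ 2 / 4) ->
  size * (expR (- (45 / 1000 * n)) + 8 * expR (- (rate * n * s0 ^+ 2))) <=
    expR (- (1 / 2 * D)).
Proof.
move=> /andP[size0 hs] D1 hn hs0 h1 h2; have D0 : 0 <= D by apply: le_trans D1.
have e2 : 2 <= expR 1 :> R by have := expR_ge1Dx (1 : R); lra.
have f1 : expR (- (45 / 1000 * n)) <= expR (- ((A + 5) * D)).
  by rewrite ler_expR lerN2; have := ler_wpM2r D0 h1; lra.
have f2 : expR (- (rate * n * s0 ^+ 2)) <= expR (- ((A + 5) * D)).
  rewrite ler_expR lerN2 -mulrA hs0; have := ler_wpM2r D0 h2; lra.
have f : expR (- (45 / 1000 * n)) + 8 * expR (- (rate * n * s0 ^+ 2)) <=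
    9 * expR (- ((A + 5) * D)).
  by move: f1 f2; move: (expR _) (expR _) (expR _) => x y z; clear; lra.
apply: le_trans (ler_wpM2l size0 f) _.
apply: le_trans (ler_wpM2r _ hs) _; first by rewrite mulr_ge0 ?expR_ge0.
rewrite mulrCA -expRD.
have -> : A * D + - ((A + 5) * D) = - (4 * D) + - D by ring.
have h9 : 9 * expR (- (4 * D)) <= 1.
  rewrite expRN ler_pdivrMr ?expR_gt0// mul1r.
  apply: le_trans (_ : expR 1 ^+ 4 <= _).
    apply: le_trans (_ : 2 ^+ 4 <= _); first by rewrite -natrX ler_nat.
    by rewrite lerXn2r ?nnegrE ?expR_ge0.
  by rewrite -expRM_natl ler_expR mulr1; lra.
rewrite expRD mulrA; apply: le_trans (_ : 1 * expR (- D) <= _).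
  by rewrite ler_wpM2r ?expR_ge0.
rewrite mul1r ler_expR; lra.
Qed.

End Counting.

(** * Choice of constants and assembly *)

Theorem theorem1 (R : realType) :
  exists C1 C2 C4 c0 c1 c2 c3 a1 b1 a2 b2 : R,
  [/\ 0 < C1, 0 < C2 & 0 < C4] /\
  [/\ 0 < c0 < 1, 0 < c1 < 1, 0 < c2 < 1 & 0 < c3 < 1] /\
  [/\ 0 < a1, 0 < b1, 0 < a2 & 0 < b2] /\
  forall (d1 d2 r n : nat) (Mstar : 'M[R]_(d1, d2)) (sigma sigma_r : R)
    (dT : measure_display) (T : measurableType dT) (P : probability T R)
    (X : 'I_n -> 'I_d1 -> 'I_d2 -> {RV P >-> R}) (xi : 'I_n -> {RV P >-> R})
    (Y : 'I_n -> T -> R)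
    (M : nat -> T -> 'M[R]_(d1, d2)) (eta : nat -> T -> R),
  let tau_comp := sigma in
  let tau_stat := C2 * sigma * Num.sqrt ((r * d1)%:R / n%:R) in
  let mu_comp := n%:R / 12 in
  let mu_stat := n%:R / (12 * sigma) in
  let L_comp := 2 * n%:R in
  let L_stat := C4 * n%:R * sigma^-1 in
  let f := fun w : T => abs_loss (design X w) (fun i => Y i w) in
  let D := fun (w : T) (l : nat) => frob (M l w - Mstar) in
  (d2 <= d1)%N ->
  (0 < r)%N -> \rank Mstar = r ->
  smallest_nonzero_singular_value Mstar sigma_r ->
  0 < sigma ->
  gaussian_model sigma X xi ->
  (forall i w, Y i w = inner (design X w i) Mstar + xi i w) ->
  C1 * (r * d1)%:R <= n%:R ->
  (forall w, rsgrad_run r (f w) (eta^~ w) (M^~ w)) ->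
  (forall w, frob (M 0%N w - Mstar) <= c0 * sigma_r) ->
  (forall w, two_phase_schedule tau_comp tau_stat mu_comp mu_stat L_comp L_stat
               (D w) (eta^~ w)) ->
  exists l1 l2 : nat,
    (if sigma <= c0 * sigma_r
     then theta_between a1 b1 (ln (sigma_r / sigma)) l1 else l1 = 0%N) /\
    theta_between a2 b2 (ln (n%:R / (d1 * r)%:R)) l2 /\
    exists E : set T,
      [/\ measurable E,
          ((1 - expR (- (c1 * (r * d1)%:R)))%:E <= P E)%E &
          forall w, E w ->
            [/\ forall l, scheduled tau_stat (D w) l ->
                  tau_comp <= D w l ->
                  D w l.+1 <= (1 - c2) ^+ l.+1 * D w 0%N,
                scheduled tau_stat (D w) l1 -> D w l1 <= sigma,
                forall k, scheduled tau_stat (D w) k ->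
                  tau_stat <= D w k < tau_comp ->
                  D w k.+1 <= (1 - c3) * D w k &
                scheduled tau_stat (D w) (l1 + l2) ->
                  D w (l1 + l2)%N
                    <= C2 * sigma * Num.sqrt ((r * d1)%:R / n%:R)]].
Proof.
(* Entropy constant of a net of mesh [1/1000]; the 8 in [A] comes from the rank [4 r] and from
   [d1 + d2 <= 2 d1]. *)
pose Kn : R := 2 + (1 / 1000 / 4) ^- 2.
have Kn0 : 0 <= Kn by rewrite addr_ge0 ?invr_ge0 ?sqr_ge0.
pose A := 8 * Kn; have A0 : 0 <= A by rewrite mulr_ge0.
have AE : A = 8 * Kn by [].
clearbody A.
pose C2 := 4 * (A + 5) / rate.
have rate0 : 0 < rate :> R by rewrite /rate; clear; lra.
have rate1 : rate <= 9 / 100 :> R by rewrite /rate; clear; lra.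
have C2r : rate * C2 = 4 * (A + 5) by rewrite /C2 mulrC divfK// gt_eqF.
have C21 : 200 <= C2.
  rewrite /C2 ler_pdivlMr//; move: rate1 A0; clear; lra.
(* [C1 >= C2^2] gives [C2 * sqrt (r d1 / n) <= 1], that is, tau_stat at most sigma. *)
pose C1 := C2 ^+ 2 + 3.
have C2C : C2 <= C2 ^+ 2 by rewrite expr2 ler_peMl//; move: C21; clear; lra.
have C11 : 3 <= C1 by rewrite /C1; move: C2C C21; clear; lra.
have h1 : A + 5 <= 45 / 1000 * C1.
  have : rate * C2 <= 9 / 100 * C2 by rewrite ler_wpM2r//; move: C21; clear; lra.
  by rewrite C2r /C1; move: C2C A0; clear; lra.
have h2 : A + 5 <= rate * (C2 ^+ 2 / 4).
  by have := ler_wpM2l (ltW rate0) C2C; rewrite C2r; move: A0; clear; lra.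
(* [C4] makes the stepsizes small enough for [K = 600]; [c0] then makes the truncation error small
   against the contraction, of order [mu / C4^2]. *)
pose C4 : R := 3 * 1000; pose c0 : R := 1 / 1000 / 1000 / 10; pose mu : R := 11 / 1000.
pose q : R := 1 / 144 / 100; pose c3 := mu / (768 * C4 ^+ 2).
have C40 : 0 < C4 by rewrite /C4; clear; lra.
have c00 : 0 < c0 by rewrite /c0; clear; lra.
have c01 : c0 < 1 by rewrite /c0; clear; lra.
have mu0 : 0 < mu by rewrite /mu; clear; lra.
have q01 : 0 < q < 1 by apply/andP; split; rewrite /q; clear; lra.
have C42 : 9 * 1000 <= C4 ^+ 2 / 1000 <= 9 * 1000.
  by rewrite /C4 exprMn expr2; apply/andP; split; clear; lra.
have K0 : 0 < 600 :> R by rewrite ltr0n.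
have C4p := exprn_gt0 2 C40.
have k0 : 0 < 768 * C4 ^+ 2 by move: C4p; clear; lra.
have k0' : 0 < 384 * C4 ^+ 2 by move: C4p; clear; lra.
have c30 : 0 < c3 < 1.
  apply/andP; split; first exact: divr_gt0.
  by rewrite (ltr_pdivrMr _ _ k0); move: C42; rewrite /mu; clear; lra.
have c0b : 0 < c0 <= 1 / 100 / 100 by rewrite c00 /c0; clear; lra.
have Kc : 600 * c0 <= mu / 2 by rewrite /c0 /mu; clear; lra.
have KC : 600 ^+ 2 <= 8 * mu * C4 ^+ 2 by move: C42; rewrite /mu; clear; lra.
have cC : 16 * c0 ^+ 2 <= mu / (384 * C4 ^+ 2).
  by rewrite (ler_pdivlMr _ _ k0'); move: C42; rewrite expr2 /c0 /mu; clear; lra.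
have muC : mu <= 192 * C4 ^+ 2 by move: C42; rewrite /mu; clear; lra.
(* Lower bounds on the two logarithms, from [sigma <= c0 * sigma_r] and from [C1 r d1 <= n]. *)
pose L1 := ln c0^-1; pose L2 := ln C1.
have L10 : 0 < L1 by rewrite ln_gt0// invf_gt1.
have L20 : 0 < L2 by rewrite ln_gt0//; move: C11; clear; lra.
have muE : mu = 11 / 1000 by [].
have c3E : c3 = mu / (768 * C4 ^+ 2) by [].
clearbody C2; clearbody c3; clearbody mu C4 c0.
exists C1, C2, C4, c0, (1 / 2), q, c3, q^-1, (q^-1 + L1^-1), c3^-1, (c3^-1 + L2^-1).
split; first by split=> //; [move: C11; clear; lra|move: C21; clear; lra].
split; first by split=> //; [exact/andP|apply/andP; split; clear; lra].
have [q0 c3p] : 0 < q /\ 0 < c3 by case/andP: q01; case/andP: c30.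
split; first by split; rewrite ?addr_gt0 ?invr_gt0.
move=> d1 d2 r n Mstar sigma sr dT T P X xi Y M eta /= d21 r0 rkM hsr sigma0 model YE Cn run init sched.
have d20 : (0 < d2)%N by apply: leq_trans r0 _; rewrite -rkM rank_leq_col.
have d10 : (0 < d1)%N by exact: leq_trans d21.
pose D : R := (r * d1)%:R.
have D1 : 1 <= D by rewrite /D ler1n muln_gt0 r0.
have D0 : 0 < D by exact: lt_le_trans D1.
have C10 : 0 < C1 by move: C11; clear; lra.
have n0 : 0 < n%:R :> R by apply: lt_le_trans Cn; rewrite mulr_gt0.
pose rho := D / n%:R.
have rho0 : 0 < rho by rewrite divr_gt0.
have C1rho : C1 <= rho^-1 by rewrite /rho invf_div ler_pdivlMr.
have rhoC : C2 ^+ 2 * rho <= 1.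
  have : C1 * rho <= 1 by rewrite -ler_pdivlMr// mul1r.
  by rewrite /C1; move: rho0; clear; lra.
pose tau := C2 * sigma * Num.sqrt rho.
have C20 : 0 < C2 by move: C21; clear; lra.
have sq0 : 0 < Num.sqrt rho by rewrite sqrtr_gt0.
have sq2 : Num.sqrt rho ^+ 2 = rho by rewrite sqr_sqrtr// ltW.
have tau0 : 0 < tau by rewrite !mulr_gt0.
have C2sq : C2 * Num.sqrt rho <= 1.
  by rewrite -(@expr_le1 _ 2)// ?exprMn ?sq2// mulr_ge0 ?ltW.
pose s0 := tau / (2 * sigma).
have s0E : s0 = C2 * Num.sqrt rho / 2 by rewrite /s0 /tau; field; rewrite gt_eqF.
have s00 : 0 < s0 by rewrite divr_gt0// mulr_gt0.
have s01 : s0 <= 1 by rewrite s0E; move: C2sq; clear; lra.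
have ns0 : n%:R * s0 ^+ 2 = C2 ^+ 2 * D / 4.
  rewrite s0E !exprMn sq2 /rho; field; rewrite gt_eqF//.
have big : 1 <= rate * n%:R * s0 ^+ 2.
  have A50 : 0 <= A + 5 by move: A0; clear; lra.
  rewrite -mulrA ns0; have := ler_pM A50 (ltW ltr01) h2 D1.
  by move: A0; clear; lra.
have e01 : 0 < (1 / 1000 : R) <= 1 by apply/andP; split; clear; lra.
have r40 : (0 < 4 * r)%N by rewrite muln_gt0.
have [s [sz s_in s_net]] := low_rank_net d10 d20 r40 e01.
have s_rank N : N \in s -> (\rank N <= 4 * r)%N by case/s_in.
have s_norm N : N \in s -> frob N = 1 by case/s_in.
have szA : (size s)%:R <= expR (A * D).
  apply: le_trans sz _; rewrite ler_expR -/Kn AE /D [8 * _]mulrC -mulrA ler_wpM2l//.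
  rewrite -natrM ler_nat -mulnA (_ : 8 = 4 * 2)%N// -mulnA leq_mul2l/=.
  by rewrite mulnCA leq_mul2l mul2n -addnn leq_add2l d21 orbT.
have [U [mU PU good]] := net_good_event sigma0 model s_norm (introT andP (conj s00 s01)) big.
have PU' : (P U <= (expR (- (1 / 2 * D)))%:E)%E.
  apply: le_trans PU _; rewrite lee_fin; apply: (failure_probability (C1 := C1) _ _ _ ns0 h1 h2) => //.
  by rewrite ler0n.
have L2_le : L2 <= ln (n%:R / (d1 * r)%:R).
  by rewrite mulnC -/D -invf_div -/rho ler_ln ?posrE ?invr_gt0.
have [l2 [l2t l2p]] := geometric_steps c30 (introT andP (conj L20 L2_le)).
have {}l2p : (1 - c3) ^+ l2 <= rho.
  by apply: le_trans l2p _; rewrite mulnC -/D -invf_div -/rho expRN lnK ?posrE ?invr_gt0// invrK.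
have sr0 : 0 < sr by have [[sr0 _] srn _] := hsr; rewrite lt_def srn.
have [l1 [l1t l1p]] : exists l1 : nat,
    (if sigma <= c0 * sr then theta_between q^-1 (q^-1 + L1^-1) (ln (sr / sigma)) l1
     else l1 = 0%N) /\ (1 - q) ^+ l1 * (c0 * sr) < sigma.
  (* If [sigma > c0 * sr] the initialisation is already within [sigma] and phase one is empty. *)
  have [ss|ss] := leP sigma (c0 * sr); last by exists 0%N; rewrite expr0 mul1r.
  have L1_le : L1 <= ln (sr / sigma).
    by rewrite ler_ln ?posrE ?invr_gt0 ?divr_gt0// ler_pdivlMr// ler_pdivrMl.
  have [l1 [l1t l1p]] := geometric_steps q01 (introT andP (conj L10 L1_le)).
  exists l1; split=> //; apply: le_lt_trans (ler_wpM2r _ l1p) _.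
    by rewrite mulr_ge0 ?ltW.
  rewrite expRN lnK ?posrE ?divr_gt0// invf_div mulrCA divfK ?gt_eqF//.
  by rewrite gtr_pMl.
exists l1, l2; split=> //; split=> //; exists (~` U); split.
- exact: measurableC.
- rewrite probability_setC// EFinB; apply: leeB => //.
move=> w nU; have [net_abs net_band] := good w nU.
have rk4 B : (\rank B <= r)%N -> (\rank (B - Mstar)%R <= 4 * r)%N.
  move=> rB; have := rankB_leq rB (eq_leq rkM); move=> /leq_trans; apply.
  by rewrite addnn -mul2n leq_mul2r orbT.
have YEw i := YE i w.
have lip := loss_lipschitz (fun i => Y i w) s_rank s_net net_abs.
have far B rB := loss_far s_rank s_net sigma0 s01 net_band YEw (rk4 B rB).
have near B rB := loss_near s_rank s_net sigma0 tau0 erefl net_band YEw (rk4 B rB).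
rewrite -muE in near.
have upper := loss_upper s_rank s_net sigma0 tau0 erefl net_band YEw.
have rkM' : (\rank Mstar <= r)%N by rewrite rkM.
have P1 := phase_one n0 sr0 sigma0 mu0 K0 C40 c0b Kc KC cC muC tau0 rkM' hsr
  lip far near upper (run w) (init w) (sched w).
have P2 := phase_two n0 sr0 sigma0 mu0 K0 C40 c0b Kc KC cC muC tau0 rkM' hsr
  lip far near upper (run w) (init w) (sched w).
have P2i := phase_two_iter n0 sr0 sigma0 mu0 K0 C40 c0b Kc KC cC muC tau0 rkM' hsr
  lip far near upper (run w) (init w) (sched w).
rewrite -c3E in P2 P2i.
have inv := iterate_invariant n0 sr0 sigma0 mu0 K0 C40 c0b Kc KC cC muC tau0 rkM' hsr
  lip far near upper (run w) (init w) (sched w).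
have q1 : 0 <= 1 - q by case/andP: q01 => _; clear; lra.
have Dl1 : scheduled tau (fun l => frob (M l w - Mstar)) l1 -> frob (M l1 w - Mstar) < sigma.
  move=> /inv[_ [//|H]]; apply: le_lt_trans H _; apply: le_lt_trans l1p.
  by rewrite ler_wpM2l// exprn_ge0.
split.
- exact: P1.
- by move=> /Dl1/ltW.
- exact: P2.
- move=> sc; have [|_ H] := P2i l1 l2 sc.
    by apply: Dl1 => k kl; apply: sc; exact: ltn_addr.
  (* The distance is at most [rho * sigma], and [rho <= C2 * sqrt rho] because
     [sqrt rho <= 1 / C2 <= C2]. *)
  apply: le_trans H _; apply: le_trans (ler_wpM2r (ltW sigma0) l2p) _.
  rewrite mulrC [C2 * _]mulrC -mulrA ler_pM2l// -/rho -[leLHS]sq2 expr2.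
  rewrite ler_pM2r//; move: C2sq sq0 C21; clear; nra.
Qed.
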